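(* Let $\mathbf{K}$ be an algebraically closed field of arbitrary characteristic. (1) Let $\Gamma\subset\mathbf{K}^2$ be a coordinate line of degree $n>1$ and let $\gamma$ be its branch at infinity. Then the semigroup $G(\gamma)$ is generated by an Abhyankar-Moh characteristic sequence with initial term $n$; that is, there is an Abhyankar-Moh characteristic sequence $(r_0,\ldots,r_h)$ with $r_0=n$ and $G(\gamma)=r_0\mathbf{N}+\cdots+r_h\mathbf{N}$. (2) Let $G\subseteq\mathbf{N}$ be a semigroup generated by an Abhyankar-Moh characteristic sequence with initial term $n>1$; that is, $G=r_0\mathbf{N}+\cdots+r_h\mathbf{N}$ for some Abhyankar-Moh characteristic sequence $(r_0,\ldots,r_h)$ with $r_0=n$. Then there exists a coordinate line $\Gamma\subset\mathbf{K}^2$ of degree $n$, with branch at infinity $\gamma$, such that $G(\gamma)=G$.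
   Context: $\mathbf{N}$ denotes the set of nonnegative integers (including $0$). Abhyankar-Moh characteristic sequence: a sequence of positive integers $(r_0,\ldots,r_h)$ such that, setting $d_k=\gcd(r_0,\ldots,r_{k-1})$ for $1\le k\le h+1$, the following hold: (i) $d_k>d_{k+1}$ for $1\le k\le h$ and $d_{h+1}=1$; (ii) $d_kr_k<d_{k+1}r_{k+1}$ for $1\le k<h$; (iii) $d_hr_h<r_0^2$; (iv) $\sum_{k=1}^h\left(\frac{d_k}{d_{k+1}}-1\right)r_k=(r_0-1)^2$. The number $r_0$ is called its initial term. Coordinate line: an affine curve $\Gamma\subset\mathbf{K}^2$ for which there exists a polynomial automorphism $(f,g):\mathbf{K}^2\to\mathbf{K}^2$ (a polynomial map with a polynomial inverse) such that $f=0$ is the minimal equation of $\Gamma$, i.e. $f$ generates the ideal of $\Gamma$ in $\mathbf{K}[x,y]$. The degree of $\Gamma$ is the total degree of its minimal equation. Branches: a plane algebroid branch centered at a point $O$ of a nonsingular algebraic surface over $\mathbf{K}$ is given by an irreducible element, up to units, of the completed local ring of the surface at $O$ (isomorphic to $\mathbf{K}[[u,v]]$); an algebroid curve centered at $O$ is given by a nonzero element of this ring up to units, and its components are its irreducible factors. If $\gamma,\gamma'$ are given by $\phi,\psi$, their intersection number is $i(\gamma,\gamma')=\dim_{\mathbf{K}}\mathbf{K}[[u,v]]/(\phi,\psi)$. The semigroup $G(\gamma)\subseteq\mathbf{N}$ of a branch $\gamma$ centered at $O$ consists of $0$ and all intersection numbers $i(\gamma,\gamma')$, where $\gamma'$ runs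 over all algebroid curves centered at $O$ not having $\gamma$ as a component. Branch at infinity: regard $\mathbf{K}^2$ as the projective plane over $\mathbf{K}$ minus the line at infinity $L$. An irreducible affine curve $\Gamma$ has one branch at infinity if its projective closure $\overline\Gamma$ meets $L$ at only one point $O$ and $\overline\Gamma$ has only one branch centered at $O$; that branch is then called the branch at infinity of $\Gamma$. Every coordinate line has one branch at infinity. *)

(* Defs.v *)
From HB Require Import structures.
From mathcomp Require Import all_boot all_order all_algebra.
From mathcomp Require Import boolp classical_sets.
From mathcomp Require Import mpoly.
Set Implicit Arguments.
Unset Strict Implicit.
Unset Printing Implicit Defensive.
Import GRing.Theory.
Local Open Scope ring_scope.
Local Open Scope classical_set_scope.

(* Formal power series R[[X_0, ..., X_{n-1}]] as coefficient families indexed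
   by monomials; the Cauchy product is the formula mcoeffM of {mpoly R[n]}. *)
Record mfps (n : nat) (R : Type) := Mfps { mfps_coef : 'X_{1..n} -> R }.

HB.instance Definition _ n R := [isNew for @mfps_coef n R].
HB.instance Definition _ n (R : choiceType) := gen_eqMixin (mfps n R).
HB.instance Definition _ n (R : choiceType) := gen_choiceMixin (mfps n R).

Section PowerSeriesRing.
Variables (n : nat) (R : comNzRingType).
Implicit Types (f g h : mfps n R) (m : 'X_{1..n}) (p q : {mpoly R[n]}).

Lemma mfpsP f g : (forall m, mfps_coef f m = mfps_coef g m) <-> f = g.
Proof.
by split=> [|-> //]; case: f g => [f] [g] /= e; congr Mfps; apply/funext.
Qed.

Definition mfps_of_mpoly p : mfps n R := Mfps (fun m => p@_m).

Definition mfps_zero : mfps n R := Mfps (fun=> 0).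
Definition mfps_opp f := Mfps (fun m => - mfps_coef f m).
Definition mfps_add f g := Mfps (fun m => mfps_coef f m + mfps_coef g m).
Definition mfps_one : mfps n R := Mfps (fun m => (m == 0%MM)%:R).
Definition mfps_scale (c : R) f := Mfps (fun m => c * mfps_coef f m).
Definition mfps_mul f g := Mfps (fun m =>
  \sum_(k : 'X_{1..n < (mdeg m).+1, (mdeg m).+1} | m == (k.1 + k.2)%MM)
     mfps_coef f k.1 * mfps_coef g k.2).

Fact mfps_addA : associative mfps_add.
Proof. by move=> f g h; apply/mfpsP=> m; apply: addrA. Qed.
Fact mfps_addC : commutative mfps_add.
Proof. by move=> f g; apply/mfpsP=> m; apply: addrC. Qed.
Fact mfps_add0 : left_id mfps_zero mfps_add.
Proof. by move=> f; apply/mfpsP=> m; apply: add0r. Qed.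
Fact mfps_addN : left_inverse mfps_zero mfps_opp mfps_add.
Proof. by move=> f; apply/mfpsP=> m; apply: addNr. Qed.

HB.instance Definition _ := GRing.isZmodule.Build (mfps n R)
  mfps_addA mfps_addC mfps_add0 mfps_addN.

Definition mfps_trunc d f : {mpoly R[n]} :=
  \sum_(m : 'X_{1..n < d}) mfps_coef f m *: 'X_[m].

Lemma mcoeff_trunc d f m : (mdeg m < d)%N -> (mfps_trunc d f)@_m = mfps_coef f m.
Proof. exact: mcoeff_mpoly. Qed.

Lemma eq_mcoeffM d p p' q q' m : (mdeg m < d)%N ->
  (forall k, mdeg k < d -> p@_k = p'@_k)%N ->
  (forall k, mdeg k < d -> q@_k = q'@_k)%N -> (p * q)@_m = (p' * q')@_m.
Proof.
move=> lt_md ep eq; rewrite !(mcoeff_poly_mul _ _ lt_md).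
by apply: eq_bigr => k _; rewrite ep ?eq ?bmdeg.
Qed.

Lemma mfps_mulE d f g m : (mdeg m < d)%N ->
  mfps_coef (mfps_mul f g) m = (mfps_trunc d f * mfps_trunc d g)@_m.
Proof.
move=> lt_md; rewrite mcoeffM; apply: eq_bigr => k _.
by rewrite !mcoeff_trunc // (leq_trans (bmdeg _)).
Qed.

Fact mfps_mulA : associative mfps_mul.
Proof.
move=> f g h; apply/mfpsP=> m; have lt := ltnSn (mdeg m).
rewrite !(mfps_mulE _ _ lt) (@eq_mcoeffM _ _ (mfps_trunc (mdeg m).+1 f) _
  (mfps_trunc (mdeg m).+1 g * mfps_trunc (mdeg m).+1 h) _ lt) //; last first.
  by move=> k ltk; rewrite mcoeff_trunc // (mfps_mulE _ _ ltk).
rewrite mulrA; apply: eq_mcoeffM lt _ _ => // k ltk.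
by rewrite mcoeff_trunc // (mfps_mulE _ _ ltk).
Qed.

Fact mfps_mulC : commutative mfps_mul.
Proof.
move=> f g; apply/mfpsP=> m.
by rewrite !(mfps_mulE _ _ (ltnSn (mdeg m))) mulrC.
Qed.

Fact mfps_mul1 : left_id mfps_one mfps_mul.
Proof.
move=> f; apply/mfpsP=> m; have lt := ltnSn (mdeg m).
rewrite (mfps_mulE _ _ lt) (@eq_mcoeffM _ _ 1 _ (mfps_trunc (mdeg m).+1 f) _ lt) //.
  by rewrite mul1r mcoeff_trunc.
by move=> k ltk; rewrite mcoeff_trunc // mcoeff1.
Qed.

Fact mfps_mulDl : left_distributive mfps_mul mfps_add.
Proof.
move=> f g h; apply/mfpsP=> m /=; rewrite -big_split /=.
by apply: eq_bigr => k _; rewrite mulrDl.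
Qed.

Fact mfps_one_neq0 : mfps_one != 0.
Proof.
apply/eqP => /mfpsP/(_ 0%MM) /=; rewrite eqxx => /eqP.
by rewrite oner_eq0.
Qed.

HB.instance Definition _ := GRing.Zmodule_isComNzRing.Build (mfps n R)
  mfps_mulA mfps_mulC mfps_mul1 mfps_mulDl mfps_one_neq0.

Fact mfps_scaleA a b f : mfps_scale a (mfps_scale b f) = mfps_scale (a * b) f.
Proof. by apply/mfpsP=> m; apply: mulrA. Qed.
Fact mfps_scale1 : left_id 1 mfps_scale.
Proof. by move=> f; apply/mfpsP=> m; apply: mul1r. Qed.
Fact mfps_scaleDr : right_distributive mfps_scale +%R.
Proof. by move=> c f g; apply/mfpsP=> m; apply: mulrDr. Qed.
Fact mfps_scaleDl f : {morph mfps_scale^~ f : a b / a + b}.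
Proof. by move=> a b; apply/mfpsP=> m; apply: mulrDl. Qed.

HB.instance Definition _ := GRing.Zmodule_isLmodule.Build R (mfps n R)
  mfps_scaleA mfps_scale1 mfps_scaleDr mfps_scaleDl.

Definition mfps_unit : pred (mfps n R) := fun f => `[< exists g, g * f = 1 >].
Definition mfps_inv f : mfps n R :=
  if pselect (exists g, g * f = 1) is left ex then projT1 (cid ex) else f.

Fact mfps_mulVf : {in mfps_unit, left_inverse 1 mfps_inv *%R}.
Proof.
move=> f /asboolP exf; rewrite /mfps_inv; case: pselect => // ex.
by case: cid.
Qed.
Fact mfps_unitP f g : g * f = 1 -> mfps_unit f.
Proof. by move=> e; apply/asboolP; exists g. Qed.
Fact mfps_inv_out : {in [predC mfps_unit], mfps_inv =1 id}.
Proof.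
by move=> f /asboolP nex; rewrite /mfps_inv; case: pselect.
Qed.

HB.instance Definition _ := GRing.ComNzRing_hasMulInverse.Build (mfps n R)
  mfps_mulVf mfps_unitP mfps_inv_out.

End PowerSeriesRing.

Section Divisibility.
Variable A : comUnitRingType.
Implicit Types a b c : A.

Definition divides a b := exists c, b = c * a.

Definition associate a b := exists2 c, c \is a GRing.unit & b = c * a.

Definition irreducible_elt a :=
  [/\ a != 0, a \isn't a GRing.unit
    & forall b c, a = b * c -> b \is a GRing.unit \/ c \is a GRing.unit].

Definition ideal2 a b : set A := [set c | exists s t, c = s * a + t * b].

Definition irreducible_factor c a := irreducible_elt c /\ divides c a.

End Divisibility.

(* dim_K (V / W) = m : there are m vectors of V whose classes modulo the
   subspace W form a basis of V / W. *)
Definition has_codim (K : fieldType) (V : lmodType K) (W : set V) (m : nat) :=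
  exists e : 'I_m -> V, forall v : V,
    exists! c : 'rV[K]_m, W (v - \sum_(i < m) c 0 i *: e i).

Section Branches.
Variable K : fieldType.
Implicit Types phi psi gamma : mfps 2 K.

Definition intersection_number phi psi (m : nat) := has_codim (ideal2 phi psi) m.

Definition branch_semigroup gamma : set nat :=
  [set m | m = 0%N \/
     exists psi, [/\ psi != 0, ~ divides gamma psi
                   & intersection_number gamma psi m]].

End Branches.

Section AffineCurves.
Variable K : closedFieldType.
Implicit Types (Gamma : set 'rV[K]_2) (f p : {mpoly K[2]}).

Definition zeros p : set 'rV[K]_2 := [set P : 'rV[K]_2 | p.@[P 0] = 0].

Definition affine_curve Gamma := exists2 p, (1 < msize p)%N & Gamma = zeros p.

Definition irreducible_curve Gamma :=
  affine_curve Gamma /\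
  forall A B : set 'rV[K]_2, affine_curve A -> affine_curve B ->
    Gamma = A `|` B -> A = Gamma \/ B = Gamma.

Definition minimal_equation Gamma f :=
  forall p, Gamma `<=` zeros p <-> divides f p.

(* msize is the total degree plus one *)
Definition curve_degree Gamma (n : nat) :=
  exists2 f, minimal_equation Gamma f & msize f = n.+1.

Definition polymap (F : 2.-tuple {mpoly K[2]}) (P : 'rV[K]_2) : 'rV[K]_2 :=
  \row_i (tnth F i).@[P 0].

Definition polynomial_automorphism (F : 2.-tuple {mpoly K[2]}) :=
  exists G : 2.-tuple {mpoly K[2]},
    cancel (polymap F) (polymap G) /\ cancel (polymap G) (polymap F).

Definition coordinate_line Gamma :=
  affine_curve Gamma /\
  exists2 F, polynomial_automorphism F & minimal_equation Gamma (tnth F 0).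

End AffineCurves.

(* Points of the projective plane are nonzero rows (x, y, z) up to scaling;
   K^2 is embedded by (x, y) |-> (x : y : 1) and z = 0 is the line at infinity. *)
Section ProjectiveClosure.
Variable K : closedFieldType.
Implicit Types (Gamma : set 'rV[K]_2) (C : set 'rV[K]_3) (O P : 'rV[K]_3).

Definition affine_embed (P : 'rV[K]_2) : 'rV[K]_(2 + 1) := row_mx P (const_mx 1).

Definition line_at_infinity : set 'rV[K]_3 :=
  [set P : 'rV[K]_3 | P != 0 /\ P 0 ord_max = 0].

Definition projective_closure Gamma : set 'rV[K]_3 :=
  [set P : 'rV[K]_3 | P != 0 /\ forall d (F : {mpoly K[3]}), F \is d.-homog ->
     (forall Q, Gamma Q -> F.@[affine_embed Q 0] = 0) -> F.@[P 0] = 0].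

Definition homogeneous_minimal_equation C (F : {mpoly K[3]}) :=
  (exists d, F \is d.-homog) /\
  forall d (G : {mpoly K[3]}), G \is d.-homog ->
    (C `<=` [set P : 'rV[K]_3 | G.@[P 0] = 0] <-> divides F G).

(* Local equation at O of the curve F = 0, in the affine chart where the i-th
   homogeneous coordinate is 1 (meaningful when O 0 i != 0): the two other
   coordinates are translated by those of O.  The completed local ring of the
   plane at O is thereby identified with K[[u, v]]. *)
Definition germ (i : 'I_3) O (F : {mpoly K[3]}) : mfps 2 K :=
  mfps_of_mpoly (F \mPo [tuple
    (if unlift i k is Some j then (O 0 k / O 0 i)%:MP + 'X_j else 1) | k < 3]).

Definition branch_at C O (i : 'I_3) (gamma : mfps 2 K) :=
  exists2 F, homogeneous_minimal_equation C F
           & irreducible_factor gamma (germ i O F).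

(* Gamma has one branch at infinity and gamma is an equation of it; the chart i
   used to write the equation is arbitrary among those containing O. *)
Definition branch_at_infinity Gamma (gamma : mfps 2 K) :=
  irreducible_curve Gamma /\
  exists O : 'rV[K]_3,
    (forall P, (projective_closure Gamma `&` line_at_infinity) P <->
       exists2 c : K, c != 0 & P = c *: O) /\
    exists i : 'I_3,
      [/\ O 0 i != 0, branch_at (projective_closure Gamma) O i gamma
        & forall delta, branch_at (projective_closure Gamma) O i delta ->
            associate gamma delta].

End ProjectiveClosure.

(* The sequence (r_0, ..., r_h) is a list of size h + 1.  The divisions in the
   last condition are exact; for h = 0 the empty gcd makes d 0 = 0 and the
   only such sequence is (1). *)
Section AbhyankarMoh.
Local Open Scope nat_scope.

Definition char_gcd (r : seq nat) (k : nat) := \big[gcdn/0]_(j < k) nth 0 r j.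

Definition abhyankar_moh_sequence (r : seq nat) :=
  let h := (size r).-1 in let d := char_gcd r in let r_ := nth 0 r in
  [/\ 0 < size r /\ (forall k, k <= h -> 0 < r_ k),
      (forall k, 1 <= k <= h -> d k.+1 < d k) /\ d h.+1 = 1,
      forall k, 1 <= k < h -> d k * r_ k < d k.+1 * r_ k.+1,
      d h * r_ h < r_ 0 ^ 2
    & \sum_(1 <= k < h.+1) (d k %/ d k.+1 - 1) * r_ k = (r_ 0 - 1) ^ 2].

Definition generated_semigroup (r : seq nat) : set nat :=
  [set m | exists c : 'I_(size r) -> nat,
             m = \sum_(i < size r) c i * nth 0 r i].

End AbhyankarMoh.

(* Main.v *)
Require Import Defs.
From HB Require Import structures.
From mathcomp Require Import all_boot all_order all_algebra.
From mathcomp Require Import boolp classical_sets.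
From mathcomp Require Import mpoly.
From mathcomp Require Import zify ring.
Set Implicit Arguments.
Unset Strict Implicit.
Unset Printing Implicit Defensive.
Import Order.TTheory GRing.Theory.

(**
The proof rests on one fact about degrees, [degree_dvd]: when the axis of a
polynomial automorphism of the plane is parametrized by t |-> (x(t), y(t)),
one of deg x, deg y divides the other, if both are positive. This holds in
every characteristic and is proved by linear algebra. With a = deg y and
b = deg x, the Newton polygon of the equation f lies under the segment from
(a, 0) to (0, b) and contains its ends ([newton_weight], [newton_vertex]). If
neither of a, b divided the other, dimension counts would produce a combination
of the powers g^d (d < a) of the second coordinate, reduced modulo f, whose
leading monomial is at the same time forced into a small box and annihilated
there.

Given [degree_dvd], a Euclidean algorithm writes the parametrization of a
coordinate line, up to affine changes of the parameter and of the coordinates,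
as the first two terms of a sequence p_{k-1} = p_{k+1} + P_k(p_k), for
1 <= k <= h, with p_h = t, p_{h+1} = 0 and e_k = deg P_k >= 2
([coordinate_curve_chain]). Eliminating in the same way, f_{k+1} =
f_{k-1} - P_k(f_k), from two linear forms f_0 and f_1 gives an equation
f = f_{h+1} of the curve ([chain_end]), and every sequence of P_k arises from a
coordinate line. The curve has degree n = e_1 ... e_h, its form of degree n is a
power of a linear form, and the key polynomial f_k meets the branch at infinity
with multiplicity n N_k - d_{k+1}, where N_k = e_1 ... e_{k-1} is the degree of
f_k and d_{k+1} = e_{k+1} ... e_h is the degree of its restriction p_k to the
curve. On the numerical side, the defining conditions of an Abhyankar-Moh
sequence with initial term n > 1 say precisely that r_k = n N_k - d_{k+1} for a
factorization of n into factors at least 2 ([am_seq_am], [am_seqP]): the upper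
bound r_k <= n N_k - d_{k+1} follows from the inequalities, and the last
condition makes it an equality.

It remains to compute the semigroup from its definition. At the point at
infinity the local equation G0 of the curve is, up to a constant, u^n modulo v,
where v = 0 is the line at infinity, and reversing the parametrization at
t = oo gives a morphism Phi from K[[u, v]] to K[[t]] killing G0, with
ord Phi(v) = n ([chart_parametrization]). Products of key polynomials provide
germs g_j = u^j modulo v for j < n, whose images have orders pairwise distinct
modulo n ([good_family]). Weierstrass division then expands each power series
as q G0 + sum_j c_j(v) g_j, and since no cancellation of orders is possible,
ker Phi is generated by G0, the orders of the image of Phi form the semigroup
generated by the r_k, and dim K[[u, v]] / (G0, psi) is the order of Phi(psi)
([codim_ideal2], [branch_semigroup_values]). The same expansion shows that G0
is irreducible, so that the branch at infinity is unique.
*)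

Local Open Scope ring_scope.

(** * Linear algebra over a domain and leading monomials *)

(** Pivoting on the last column without dividing: the statement is needed over
    polynomial rings, not only over fields. *)
Lemma left_kernel_nonzero (R : idomainType) n : forall m (A : 'I_m -> 'I_n -> R),
  (n < m)%N -> exists2 v : 'I_m -> R, exists i, v i != 0 &
    forall j, \sum_i v i * A i j = 0.
Proof.
elim: n => [|n IHn] [//|m] A ltnm.
  exists (fun=> 1) => [|[//]]; exists ord0; exact: oner_neq0.
have [[i0 nz]|all0] := pselect (exists i, A i ord_max != 0); last first.
  have [|v nzv kerv] := IHn m.+1 (fun i j => A i (widen_ord (leqnSn n) j)).
    exact: ltnW.
  exists v => // j; have [->|jmax] := eqVneq j ord_max.
    apply: big1 => i _; have [->|nz] := eqVneq (A i ord_max) 0.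
      by rewrite mulr0.
    by case: all0; exists i.
  have ltj : (j < n)%N.
    by rewrite ltn_neqAle -ltnS ltn_ord andbT; apply: contraNneq jmax => e; apply/eqP/val_inj.
  rewrite -[RHS](kerv (Ordinal ltj)); apply: eq_bigr => i _; congr (_ * A _ _).
  exact: val_inj.
set a := A i0 ord_max in nz.
have [|w [k nzw] kerw] := IHn m (fun i j => a * A (lift i0 i) (widen_ord (leqnSn n) j)
   - A (lift i0 i) ord_max * A i0 (widen_ord (leqnSn n) j)) => //.
pose v i := if unlift i0 i is Some i' then a * w i'
            else - \sum_i w i * A (lift i0 i) ord_max.
have vE j : \sum_i v i * A i j =
   \sum_i w i * (a * A (lift i0 i) j - A (lift i0 i) ord_max * A i0 j).
  rewrite (bigD1_ord i0) //= {1}/v unlift_none mulNr mulr_suml addrC -sumrB.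
  apply: eq_bigr => i _; rewrite /v liftK; ring.
exists v; first by exists (lift i0 k); rewrite /v liftK mulf_neq0.
move=> j; rewrite vE; have [->|jmax] := eqVneq j ord_max.
  by apply: big1 => i _; rewrite -/a; ring.
have ltj : (j < n)%N.
  by rewrite ltn_neqAle -ltnS ltn_ord andbT; apply: contraNneq jmax => e; apply/eqP/val_inj.
rewrite -[RHS](kerw (Ordinal ltj)); apply: eq_bigr => i _.
by have -> : widen_ord (leqnSn n) (Ordinal ltj) = j by apply: val_inj.
Qed.

Lemma left_kernel_finType (R : idomainType) n (I : finType) (A : I -> 'I_n -> R) :
  (n < #|I|)%N -> exists2 v : I -> R, exists i, v i != 0 &
    forall j, \sum_i v i * A i j = 0.
Proof.
move=> /(left_kernel_nonzero (fun k => A (enum_val k)))[v [k nzk] kerv].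
exists (v \o enum_rank); first by exists (enum_val k); rewrite /= enum_valK.
move=> j; rewrite -[RHS](kerv j) (reindex_onto enum_val enum_rank) /=; last first.
  by move=> i _; rewrite enum_rankK.
by apply: eq_big => [l|l _]; rewrite enum_valK ?eqxx.
Qed.

Lemma size_sum_distinct (R : nzRingType) (I : finType) (F : I -> {poly R}) :
  (forall i j, F i != 0 -> F j != 0 -> size (F i) = size (F j) -> i = j) ->
  (exists i, F i != 0) -> \sum_i F i != 0.
Proof.
move=> inj [i0 nz0].
case: (@arg_maxnP I i0 (fun i => F i != 0) (fun i => size (F i)) nz0) => i nzi maxi.
have ci : (\sum_i F i)`_(size (F i)).-1 = lead_coef (F i).
  rewrite coef_sum (bigD1 i) //= big1 ?addr0 // => j neji.
  have [->|nzj] := eqVneq (F j) 0; first by rewrite coef0.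
  rewrite nth_default // -ltnS prednK ?size_poly_gt0 // ltn_neqAle.
  apply/andP; split; last exact: maxi.
  by apply: contraNneq neji => e; apply/eqP/inj.
apply: contraNneq nzi => e; rewrite -lead_coef_eq0 -ci e coef0; exact/eqP.
Qed.

Lemma mpoly_rmorph_ext (R : comNzRingType) n (S : comNzRingType)
    (f g : {rmorphism {mpoly R[n]} -> S}) :
  (forall c, f c%:MP = g c%:MP) -> (forall i, f 'X_i = g 'X_i) -> f =1 g.
Proof.
move=> eC eX p; rewrite [p]mpolyE !rmorph_sum; apply: eq_bigr => m _.
rewrite -mul_mpolyC !rmorphM eC mpolyXE_id !rmorph_prod; congr (_ * _).
by apply: eq_bigr => i _; rewrite !rmorphXn eX.
Qed.

(** Pseudo-division by psi leaves remainders with only deg psi coefficients, so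
    more than deg psi elements are dependent modulo psi. *)
Lemma pseudo_dependent (R : idomainType) (A : comNzRingType)
    (phi : {rmorphism A -> {poly R}}) (chi : {rmorphism {poly R} -> A})
    (psi : A) N (h : 'I_N -> A) :
  cancel phi chi -> phi psi != 0 -> ((size (phi psi)).-1 < N)%N ->
  exists2 c : 'I_N -> R, exists k, c k != 0
    & exists T, \sum_k chi (c k)%:P * h k = T * psi.
Proof.
move=> phiK nz ltN; set P := phi psi in nz ltN *.
have [v nzv kerv] := left_kernel_nonzero (fun k j => (phi (h k) %% P)`_(val j)) ltN.
exists (fun k => v k * lead_coef P ^+ scalp (phi (h k)) P).
  by case: nzv => k nzk; exists k; rewrite mulf_neq0 // expf_neq0 // lead_coef_eq0.
exists (chi (\sum_k v k *: (phi (h k) %/ P))).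
rewrite -[psi]phiK -/P -rmorphM mulr_suml !rmorph_sum /=.
have eqk k : (v k * lead_coef P ^+ scalp (phi (h k)) P)%:P * phi (h k) =
    v k *: (phi (h k) %/ P) * P + v k *: (phi (h k) %% P).
  by rewrite mul_polyC -scalerA Pdiv.Idomain.divp_eq scalerDr scalerAl.
under eq_bigr => k _ do rewrite -[X in _ * X]phiK -rmorphM eqk.
rewrite -rmorph_sum -[RHS]rmorph_sum; congr (chi _).
rewrite big_split /= [X in _ + X](_ : _ = 0) ?addr0 //.
apply/polyP=> j; rewrite coef0 coef_sum.
under eq_bigr => k _ do rewrite coefZ.
have [ltj|lej] := ltnP j (size P).-1.
  exact: (kerv (Ordinal ltj)).
apply: big1 => k _; rewrite nth_default ?mulr0 //.
apply: leq_trans lej; rewrite -ltnS prednK ?size_poly_gt0 //.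
by rewrite ltn_modp.
Qed.

Section LeadingMonomials.
Variables (R : idomainType) (n : nat).
Implicit Types p : {mpoly R[n]}.

Lemma mlead_sum_distinct (I : finType) (F : I -> {mpoly R[n]}) :
  (forall i j, F i != 0 -> F j != 0 -> mlead (F i) = mlead (F j) -> i = j) ->
  (exists i, F i != 0) ->
  exists i, [/\ F i != 0, \sum_i F i != 0 & mlead (\sum_i F i) = mlead (F i)].
Proof.
move=> inj [i0 nz0].
case: (@arg_maxP _ _ I i0 (fun i => F i != 0) (fun i => mlead (F i)) nz0) => i nzi maxi.
have ci : (\sum_i F i)@_(mlead (F i)) = mleadc (F i).
  rewrite raddf_sum (bigD1 i) //= big1 ?addr0 // => j neji.
  have [->|nzj] := eqVneq (F j) 0; first by rewrite mcoeff0.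
  apply: mcoeff_gt_mlead; rewrite lt_neqAle; apply/andP; split; last exact: maxi.
  by apply: contraNneq neji => e; apply/eqP/inj.
have nz : \sum_i F i != 0.
  apply: contraNneq nzi => e; rewrite -mleadc_eq0 -ci e mcoeff0; exact/eqP.
exists i; split=> //; apply/eqP; rewrite eq_le; apply/andP; split; last first.
  by apply: msupp_le_mlead; rewrite mcoeff_msupp ci mleadc_eq0.
have: mleadc (\sum_i F i) != 0 by rewrite mleadc_eq0.
rewrite raddf_sum /= => nzs; rewrite leNgt; apply: contraNN nzs => lti.
apply/eqP/big1 => j _; have [->|nzj] := eqVneq (F j) 0; first by rewrite mcoeff0.
apply: mcoeff_gt_mlead; apply: le_lt_trans lti; exact: maxi.
Qed.

(** The powers of p have distinct leading monomials, so nothing cancels in c(p). *)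
Lemma mlead_horner (c : {poly R}) p : c != 0 -> mlead p != 0%MM ->
  (map_poly (@mpolyC n R) c).[p] != 0 /\
  mlead (map_poly (@mpolyC n R) c).[p] = (mlead p *+ (size c).-1)%MM.
Proof.
move=> nzc nzp; have pn0 : p != 0 by apply: contraNneq nzp => ->; rewrite mlead0.
elim/poly_ind: c nzc => [|c a IHc]; first by rewrite eqxx.
have [->|nzc] := eqVneq c 0.
  rewrite mul0r add0r polyC_eq0 => nza; rewrite map_polyC /= hornerC.
  by rewrite mpolyC_eq0 nza mleadC size_polyC nza mulm0n.
have {IHc}[nzh eh] := IHc nzc; move=> _.
rewrite size_MXaddC (negPf nzc) /= rmorphD rmorphM /= map_polyX map_polyC /=.
rewrite hornerD hornerMX hornerC.
have el : mlead ((map_poly (@mpolyC n R) c).[p] * p) = (mlead p *+ size c)%MM.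
  rewrite mleadM // eh -[X in _ = (_ *+ X)%MM](@prednK (size c)) ?size_poly_gt0 //.
  by rewrite mulmSr.
have lt : (mlead (a%:MP_[n] : {mpoly R[n]}) <
           mlead ((map_poly (@mpolyC n R) c).[p] * p))%O.
  rewrite mleadC el; apply: lt_mdeg_ltmc; rewrite mdeg0 mdegMn muln_gt0.
  by rewrite size_poly_gt0 nzc andbT lt0n mdeg_eq0.
rewrite mleadDl //; split=> //; rewrite -mleadc_eq0 mleadDl // mcoeffD.
rewrite [_ _ a%:MP](mcoeff_gt_mlead lt) addr0 mleadc_eq0.
by rewrite mulf_neq0.
Qed.

End LeadingMonomials.

(** A lower bound for the degree of psi in the main variable of phi. The leading
    monomials of the products c_k(f) * h_k are pairwise distinct and never
    divisible by that of psi, so no combination of the h_k over R[f] is a multiple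
    of psi; now [pseudo_dependent] applies. The morphism rho only serves to change
    the monomial order. *)
Lemma rank_bound (R : idomainType) n (A : comNzRingType)
    (phi : {rmorphism A -> {poly {poly R}}}) (chi : {rmorphism {poly {poly R}} -> A})
    (rho : {rmorphism A -> {mpoly R[n]}}) (f psi : A) N (h : 'I_N -> A) :
  cancel phi chi ->
  (forall c : {poly R}, rho (chi c%:P) = (map_poly (@mpolyC n R) c).[rho f]) ->
  rho psi != 0 -> mlead (rho f) != 0%MM -> (forall k, rho (h k) != 0) ->
  (forall k k' a a', (mlead (rho (h k)) + mlead (rho f) *+ a =
     mlead (rho (h k')) + mlead (rho f) *+ a')%MM -> k = k') ->
  (forall k a, ~~ (mlead (rho psi) <= mlead (rho (h k)) + mlead (rho f) *+ a)%MM) ->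
  (N <= (size (phi psi)).-1)%N.
Proof.
move=> phiK chif nzpsi nzf nzh dist ndiv; rewrite leqNgt; apply/negP => ltN.
have nzphi : phi psi != 0.
  by apply: contraNneq nzpsi => e; rewrite -[psi]phiK e !rmorph0.
have [c [k0 nzc] [T eT]] := pseudo_dependent h phiK nzphi ltN.
pose F k := rho (chi (c k)%:P * h k).
have Fnz k : F k != 0 -> mlead (F k) =
    (mlead (rho (h k)) + mlead (rho f) *+ (size (c k)).-1)%MM.
  rewrite /F rmorphM chif => nz; have [e0|nzck] := eqVneq (c k) 0.
    by rewrite e0 map_poly0 horner0 mul0r eqxx in nz.
  have [nz1 e1] := mlead_horner nzck nzf.
  by rewrite mleadM // e1 addmC.
have nzF : exists k, F k != 0.
  exists k0; rewrite /F rmorphM chif mulf_neq0 //.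
  by case: (mlead_horner nzc nzf).
have [k1 k2 nz1 nz2 e12|k [nzk nzs ek]] := mlead_sum_distinct _ nzF.
  by rewrite !Fnz // in e12; apply: dist e12.
have := ndiv k (size (c k)).-1; rewrite -Fnz // -ek.
rewrite /F -rmorph_sum eT rmorphM mleadM // ?lem_addl //.
by apply: contraNneq nzs => e; rewrite /F -rmorph_sum eT rmorphM e mul0r.
Qed.

Section TwoVariables.
Variable R : idomainType.
Notation P2 := {mpoly R[2]}.
Notation X := ('X_(ord0 : 'I_2) : P2).
Notation Y := ('X_(ord_max : 'I_2) : P2).
Implicit Types (f g h p q : P2).

Definition mn i j : 'X_{1..2} := [multinom (if k == ord0 then i else j) | k < 2].

Lemma mnE (m : 'X_{1..2}) : m = mn (m ord0) (m ord_max).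
Proof.
apply/mnmP => k; rewrite mnmE; case: eqP => [->//|/eqP ne]; congr (m _).
by apply: val_inj; case: k ne => [[|[]]].
Qed.

Lemma mn0 i j : mn i j ord0 = i. Proof. by rewrite mnmE. Qed.
Lemma mn1 i j : mn i j ord_max = j. Proof. by rewrite mnmE. Qed.

Lemma mnD i j i' j' : (mn i j + mn i' j')%MM = mn (i + i') (j + j').
Proof. by apply/mnmP => k; rewrite mnmDE !mnmE; case: ifP. Qed.

Lemma mnM i j k : (mn i j *+ k)%MM = mn (i * k) (j * k).
Proof. by apply/mnmP => l; rewrite mulmnE !mnmE; case: ifP. Qed.

Lemma mnI i j i' j' : mn i j = mn i' j' -> i = i' /\ j = j'.
Proof. by move=> e; rewrite -(mn0 i j) -{2}(mn1 i j) e mn0 mn1. Qed.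

Lemma mn_le i j i' j' : (mn i j <= mn i' j')%MM = (i <= i')%N && (j <= j')%N.
Proof.
apply/mnm_lepP/andP => [le|[le0 le1] k]; last by rewrite !mnmE; case: ifP.
by split; [have := le ord0; rewrite !mn0 | have := le ord_max; rewrite !mn1].
Qed.

Lemma mn_deg i j : mdeg (mn i j) = (i + j)%N.
Proof. by rewrite mdegE !big_ord_recl big_ord0 !mnmE addn0. Qed.

Section Eval2.
Variables (S : comNzRingType) (iota : {rmorphism R -> S}) (a b : S).

Definition ev2 : P2 -> S := mmap iota (fun k => if k == ord0 then a else b).
HB.instance Definition _ := GRing.RMorphism.copy ev2 ev2.

Lemma ev2C c : ev2 c%:MP = iota c. Proof. exact: mmapC. Qed.
Lemma ev2X : ev2 X = a. Proof. by rewrite /ev2 mmapX mmap1U. Qed.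
Lemma ev2Y : ev2 Y = b. Proof. by rewrite /ev2 mmapX mmap1U. Qed.
Lemma ev2Z c h : ev2 (c *: h) = iota c * ev2 h. Proof. exact: mmapZ. Qed.

Lemma ev2mn i j : ev2 'X_[mn i j] = a ^+ i * b ^+ j.
Proof.
by rewrite /ev2 mmapX /mmap1 !big_ord_recl big_ord0 mulr1 /= !mnmE.
Qed.

Lemma ev2E h : ev2 h = \sum_(m <- msupp h) iota h@_m * (a ^+ m ord0 * b ^+ m ord_max).
Proof.
rewrite {1}[h]mpolyE rmorph_sum; apply: eq_bigr => m _.
by rewrite /= ev2Z [in 'X_[m]](mnE m) ev2mn.
Qed.
End Eval2.

Lemma rmorph_ev2 (S : comNzRingType) (F : {rmorphism P2 -> S})
    (iota : {rmorphism R -> S}) :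
  (forall c, F c%:MP = iota c) -> F =1 ev2 iota (F X) (F Y).
Proof.
move=> eC; apply: mpoly_rmorph_ext => [c|k]; first by rewrite eC /= ev2C.
have [->|ne] := eqVneq k ord0; first by rewrite /= ev2X.
have -> : k = ord_max by apply: val_inj; case: k ne => [[|[]]].
by rewrite /= ev2Y.
Qed.

Lemma ev2_comp (S S' : comNzRingType) (iota : {rmorphism R -> S})
    (G : {rmorphism S -> S'}) a b h :
  G (ev2 iota a b h) = ev2 (G \o iota) (G a) (G b) h.
Proof.
rewrite -[LHS]/((G \o ev2 iota a b) h) (@rmorph_ev2 _ _ (G \o iota)) => [|c] /=.
  by rewrite ev2X ev2Y.
by rewrite ev2C.
Qed.

Lemma ev2_id h : ev2 (@mpolyC 2 R) X Y h = h.
Proof. by have := @rmorph_ev2 _ idfun (@mpolyC 2 R) (fun=> erefl) h. Qed.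

(** Substituting powers of the variables turns the degree order on monomials into
    the order by weighted degree, with weights w0 and w1. *)
Definition wsub w0 w1 : P2 -> P2 := ev2 (@mpolyC 2 R) (X ^+ w0) (Y ^+ w1).
HB.instance Definition _ w0 w1 := GRing.RMorphism.copy (wsub w0 w1) (wsub w0 w1).

Lemma mcoeff_wsub w0 w1 h i j : (0 < w0)%N -> (0 < w1)%N ->
  (wsub w0 w1 h)@_(mn (w0 * i) (w1 * j)) = h@_(mn i j).
Proof.
move=> w0p w1p; rewrite /wsub ev2E raddf_sum /= [RHS](_ : _ =
   \sum_(m <- msupp h) h@_m * (m == mn i j)%:R); last first.
  by rewrite {1}[h]mpolyE raddf_sum; apply: eq_bigr => m _; rewrite /= mcoeffZ mcoeffX.
apply: eq_bigr => m _; rewrite mcoeffCM -!exprM; congr (_ * _).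
have -> : X ^+ (w0 * m ord0) * Y ^+ (w1 * m ord_max) = 'X_[mn (w0 * m ord0) (w1 * m ord_max)].
  by rewrite -[RHS]ev2_id ev2mn.
rewrite mcoeffX; congr ((nat_of_bool _)%:R); apply/eqP/eqP => [/mnI[/eqP e0 /eqP e1]|->].
  rewrite (mnE m); congr mn; apply/eqP; first by rewrite -(eqn_pmul2l w0p).
  by rewrite -(eqn_pmul2l w1p).
by rewrite mn0 mn1.
Qed.

Lemma msupp_wsub w0 w1 h m : (wsub w0 w1 h)@_m != 0 ->
  exists i j, [/\ m = mn (w0 * i) (w1 * j) & h@_(mn i j) != 0].
Proof.
rewrite /wsub ev2E raddf_sum /= => nz.
have [m' m'h] : exists2 m', m' \in msupp h & m = mn (w0 * m' ord0) (w1 * m' ord_max).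
  apply: contrapT => no; move/negP: nz; apply; apply/eqP; rewrite big_seq.
  apply: big1 => m' m'h; rewrite mcoeffCM -!exprM.
  have -> : X ^+ (w0 * m' ord0) * Y ^+ (w1 * m' ord_max) = 'X_[mn (w0 * m' ord0) (w1 * m' ord_max)].
    by rewrite -[RHS]ev2_id ev2mn.
  rewrite mcoeffX; case: eqP => [e|_]; rewrite ?mulr0 //.
  by case: no; exists m'.
by move=> ->; exists (m' ord0), (m' ord_max); rewrite -mnE -mcoeff_msupp.
Qed.

Definition lead_exp w0 w1 h i j :=
  wsub w0 w1 h != 0 /\ mlead (wsub w0 w1 h) = mn (w0 * i) (w1 * j).

Lemma lead_exp_ex w0 w1 h : (0 < w0)%N -> (0 < w1)%N -> h != 0 ->
  exists i j, [/\ lead_exp w0 w1 h i j, h@_(mn i j) != 0 &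
    forall i' j', h@_(mn i' j') != 0 -> (w0 * i' + w1 * j' <= w0 * i + w1 * j)%N].
Proof.
move=> w0p w1p nzh; have nz : wsub w0 w1 h != 0.
  apply: contraNneq nzh => e; apply/eqP/mpolyP => m; rewrite mcoeff0 (mnE m).
  by rewrite -(mcoeff_wsub _ _ _ w0p w1p) e mcoeff0.
have: (wsub w0 w1 h)@_(mlead (wsub w0 w1 h)) != 0 by rewrite mleadc_eq0.
move=> /msupp_wsub[i [j [e nzij]]]; exists i, j; split=> // i' j' nz'.
rewrite -!mn_deg -e; apply: lemc_mdeg; apply: msupp_le_mlead.
by rewrite mcoeff_msupp mcoeff_wsub.
Qed.

Lemma lead_exp_uniq w0 w1 h i j : (0 < w0)%N -> (0 < w1)%N -> h@_(mn i j) != 0 ->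
  (forall i' j', h@_(mn i' j') != 0 -> (i', j') <> (i, j) ->
     (w0 * i' + w1 * j' < w0 * i + w1 * j)%N) ->
  lead_exp w0 w1 h i j.
Proof.
move=> w0p w1p nz max; have nzh : h != 0 by apply: contraNneq nz => ->; rewrite mcoeff0.
have [i' [j' [le nz' max']]] := lead_exp_ex w0p w1p nzh.
have [[<- <-]//|ne] := pselect ((i', j') = (i, j)).
by have := max _ _ nz' ne; rewrite ltnNge max'.
Qed.

End TwoVariables.

(** * Plane automorphisms and the curves they straighten *)

Section PlaneAutomorphisms.
Variable K : fieldType.
Notation P2 := {mpoly K[2]}.
Notation X := ('X_(ord0 : 'I_2) : P2).
Notation Y := ('X_(ord_max : 'I_2) : P2).
Implicit Types (f g h p q psi : P2).

Definition cmp f g : P2 -> P2 := ev2 (@mpolyC 2 K) f g.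
HB.instance Definition _ f g := GRing.RMorphism.copy (cmp f g) (cmp f g).

(** Restriction of a polynomial to the curve t |-> (a(t), b(t)). *)
Definition curve_ev (a b : {poly K}) : P2 -> {poly K} := ev2 (@polyC K) a b.
HB.instance Definition _ a b := GRing.RMorphism.copy (curve_ev a b) (curve_ev a b).

(** Polynomials in two variables as polynomials in Y over K[X]. *)
Definition toPP : P2 -> {poly {poly K}} := ev2 (polyC \o polyC) 'X%:P 'X.
HB.instance Definition _ := GRing.RMorphism.copy toPP toPP.

(** Evaluation of K[X][Y] at (f, g); for (X, Y) it is the inverse of [toPP]. *)
Definition fromPP f g : {poly {poly K}} -> P2 :=
  horner_eval g \o map_poly (horner_eval f \o map_poly (@mpolyC 2 K)).
HB.instance Definition _ f g := GRing.RMorphism.copy (fromPP f g) (fromPP f g).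

Lemma fromPPC f g c : fromPP f g c%:P = (map_poly (@mpolyC 2 K) c).[f].
Proof. by rewrite /fromPP /= map_polyC /= /horner_eval hornerC. Qed.

Lemma fromPPX f g : fromPP f g 'X = g.
Proof. by rewrite /fromPP /= map_polyX /horner_eval hornerX. Qed.

Lemma fromPP_toPP f g h : fromPP f g (toPP h) = cmp f g h.
Proof.
rewrite -[LHS]/((fromPP f g \o toPP) h) (@rmorph_ev2 _ _ _ (@mpolyC 2 K)) => [|c] /=.
  by rewrite /toPP ev2X ev2Y fromPPX fromPPC map_polyX hornerX.
by rewrite /toPP ev2C /= fromPPC map_polyC hornerC.
Qed.

Lemma coef_toPP h i j : (toPP h)`_j`_i = h@_(mn i j).
Proof.
rewrite /toPP ev2E coef_sum coef_sum [RHS](_ : _ =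
   \sum_(m <- msupp h) h@_m * (m == mn i j)%:R); last first.
  by rewrite {1}[h]mpolyE raddf_sum; apply: eq_bigr => m _; rewrite /= mcoeffZ mcoeffX.
apply: eq_bigr => m _ /=; rewrite coefCM coefCM; congr (_ * _).
rewrite -rmorphXn /= coefCM coefXn; case: (eqVneq j (m ord_max)) => [->|ne].
  rewrite mulr1 coefXn; case: (eqVneq i (m ord0)) => [->|ne0].
    by rewrite -mnE eqxx.
  by case: eqP => // e; rewrite e mn0 eqxx in ne0.
rewrite mulr0 coef0; case: eqP => [e|//].
by rewrite e mn1 eqxx in ne.
Qed.

Lemma size_toPP_leq h n :
  (size (toPP h) <= n)%N <-> (forall i j, h@_(mn i j) != 0 -> (j < n)%N).
Proof.
split=> [le i j nz|lt].
  rewrite ltnNge; apply: contraNN nz => lej.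
  by rewrite -coef_toPP [(toPP h)`_j]nth_default ?coef0 // (leq_trans le).
apply/leq_sizeP => j lej; apply/polyP => i; rewrite coef0 coef_toPP.
by apply/eqP; apply: contraTT lej => /lt; rewrite -ltnNge.
Qed.

Lemma toPP_inj : injective toPP.
Proof.
move=> h h' e; apply/mpolyP => m; rewrite (mnE m) -!coef_toPP; congr _`__.
by rewrite e.
Qed.

Definition inverse_pair f g p q :=
  [/\ cmp f g p = X, cmp f g q = Y, cmp p q f = X & cmp p q g = Y].

Lemma inverse_pair_sym f g p q : inverse_pair f g p q -> inverse_pair p q f g.
Proof. by case. Qed.

Lemma cmp_cmp f g p q h : cmp f g (cmp p q h) = cmp (cmp f g p) (cmp f g q) h.
Proof.
rewrite -[LHS]/((cmp f g \o cmp p q) h) (@rmorph_ev2 _ _ _ (@mpolyC 2 K)) => [|c] /=.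
  by rewrite [cmp p q X]ev2X [cmp p q Y]ev2Y.
by rewrite /cmp !ev2C.
Qed.

Lemma curve_ev_cmp a b p q h :
  curve_ev a b (cmp p q h) = curve_ev (curve_ev a b p) (curve_ev a b q) h.
Proof.
rewrite -[LHS]/((curve_ev a b \o cmp p q) h) (@rmorph_ev2 _ _ _ (@polyC K)) => [|c] /=.
  by rewrite [cmp p q X]ev2X [cmp p q Y]ev2Y.
by rewrite /cmp /curve_ev !ev2C.
Qed.

Lemma cmpXY h : cmp X Y h = h. Proof. exact: ev2_id. Qed.

Lemma inverse_pairK f g p q h : inverse_pair f g p q -> cmp f g (cmp p q h) = h.
Proof. by case=> ep eq _ _; rewrite cmp_cmp ep eq cmpXY. Qed.

Lemma wsub_fromPPC w0 w1 f g (c : {poly K}) :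
  wsub w0 w1 (fromPP f g c%:P) = (map_poly (@mpolyC 2 K) c).[wsub w0 w1 f].
Proof.
rewrite fromPPC -horner_map -map_poly_comp; congr _.[_].
by apply: eq_map_poly => a /=; rewrite /wsub ev2C.
Qed.

Lemma wsubX w0 w1 i j : wsub w0 w1 'X_[mn i j] = 'X_[mn (w0 * i) (w1 * j)] :> P2.
Proof. by rewrite /wsub ev2mn -!exprM -[RHS]ev2_id ev2mn. Qed.

Lemma mpolyX_neq0 (m : 'X_{1..2}) : 'X_[m] != 0 :> P2.
Proof. by rewrite -msupp_eq0 msuppX. Qed.

Lemma size_phi h n : (forall i j, h@_(mn i j) != 0 -> (j <= n)%N) ->
  ((size (toPP h)).-1 <= n)%N.
Proof.
move=> le; have : (size (toPP h) <= n.+1)%N by apply/size_toPP_leq => i j /le.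
by case: size.
Qed.

(** The b * i monomials X^k Y^l with k < i and l < b satisfy the hypotheses of
    [rank_bound], for the coordinates in which f is the first variable. *)
Lemma leading_rank_y w0 w1 f g p q psi b i j :
  (0 < w0)%N -> (0 < w1)%N -> (0 < b)%N -> inverse_pair f g p q ->
  lead_exp w0 w1 f 0 b -> lead_exp w0 w1 psi i j ->
  (i * b <= (size (toPP (cmp p q psi))).-1)%N.
Proof.
move=> w0p w1p bp inv [nzf lf] [nzpsi lpsi].
pose hh (k : 'I_(i * b)) : P2 := 'X_[mn (k %/ b) (k %% b)].
have fK : cancel (toPP \o cmp p q) (fromPP f g).
  by move=> h /=; rewrite fromPP_toPP (inverse_pairK _ inv).
apply: (@rank_bound K 2 P2 (toPP \o cmp p q) (fromPP f g) (wsub w0 w1)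
   f psi (i * b) hh fK _ nzpsi).
- by move=> c; rewrite /= wsub_fromPPC.
- apply/eqP => e; have := congr1 (fun m : 'X_{1..2} => m ord_max) e.
  by rewrite /= lf mn1 mnm0E => /eqP; rewrite muln_eq0 (gtn_eqF w1p) (gtn_eqF bp).
- by move=> k; rewrite /= wsubX mpolyX_neq0.
- move=> k k' a a' /=; rewrite lf !wsubX !mleadXm !mnM !mnD => /mnI[].
  rewrite muln0 !mul0n !addn0 => /eqP; rewrite eqn_pmul2l // => /eqP e1.
  move=> /eqP; rewrite -!mulnA -!mulnDr eqn_pmul2l // => /eqP.
  move=> /(congr1 (modn^~ b)).
  rewrite ![(_ + b * _)%N]addnC ![(b * _)%N]mulnC !modnMDl !modn_mod => e2.
  apply: val_inj; rewrite /= (divn_eq k b) (divn_eq k' b).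
  by rewrite e1; congr (_ + _)%N.
- move=> k a /=; rewrite lpsi lf !wsubX !mleadXm !mnM !mnD mn_le negb_and.
  rewrite muln0 !mul0n !addn0 leq_pmul2l // -ltnNge ltn_divLR //.
  by rewrite ltn_ord.
Qed.

Lemma leading_rank_x w0 w1 f g p q psi a i j :
  (0 < w0)%N -> (0 < w1)%N -> (0 < a)%N -> inverse_pair f g p q ->
  lead_exp w0 w1 f a 0 -> lead_exp w0 w1 psi i j ->
  (j * a <= (size (toPP (cmp p q psi))).-1)%N.
Proof.
move=> w0p w1p ap inv [nzf lf] [nzpsi lpsi].
pose hh (k : 'I_(j * a)) : P2 := 'X_[mn (k %% a) (k %/ a)].
have fK : cancel (toPP \o cmp p q) (fromPP f g).
  by move=> h /=; rewrite fromPP_toPP (inverse_pairK _ inv).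
apply: (@rank_bound K 2 P2 (toPP \o cmp p q) (fromPP f g) (wsub w0 w1)
   f psi (j * a) hh fK _ nzpsi).
- by move=> c; rewrite /= wsub_fromPPC.
- apply/eqP => e; have := congr1 (fun m : 'X_{1..2} => m ord0) e.
  by rewrite /= lf mn0 mnm0E => /eqP; rewrite muln_eq0 (gtn_eqF w0p) (gtn_eqF ap).
- by move=> k; rewrite /= wsubX mpolyX_neq0.
- move=> k k' n n' /=; rewrite lf !wsubX !mleadXm !mnM !mnD => /mnI[].
  move=> /eqP; rewrite -!mulnA -!mulnDr eqn_pmul2l // => /eqP e2.
  rewrite !(muln0, mul0n, addn0) => /eqP; rewrite eqn_pmul2l // => /eqP e1.
  move: e2 => /(congr1 (modn^~ a)).
  rewrite ![(_ + a * _)%N]addnC ![(a * _)%N]mulnC !modnMDl !modn_mod => e2.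
  apply: val_inj; rewrite /= (divn_eq k a) (divn_eq k' a).
  by rewrite e1; congr (_ + _)%N.
- move=> k n /=; rewrite lpsi lf !wsubX !mleadXm !mnM !mnD mn_le negb_and orbC.
  rewrite muln0 !mul0n !addn0 leq_pmul2l // -ltnNge ltn_divLR //.
  by rewrite ltn_ord.
Qed.

Lemma coef_swap h i j : (cmp Y X h)@_(mn i j) = h@_(mn j i).
Proof.
rewrite /cmp ev2E raddf_sum /= [RHS](_ : _ =
   \sum_(m <- msupp h) h@_m * (m == mn j i)%:R); last first.
  by rewrite {1}[h]mpolyE raddf_sum; apply: eq_bigr => m _; rewrite /= mcoeffZ mcoeffX.
apply: eq_bigr => m _; rewrite mcoeffCM; congr (_ * _).
have -> : Y ^+ m ord0 * X ^+ m ord_max = 'X_[mn (m ord_max) (m ord0)].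
  by rewrite mulrC -[RHS]ev2_id ev2mn.
rewrite mcoeffX (mnE m) mn0 mn1; congr ((nat_of_bool _)%:R).
by apply/eqP/eqP => /mnI[-> ->].
Qed.

Lemma cmpX f g : cmp f g X = f. Proof. exact: ev2X. Qed.
Lemma cmpY f g : cmp f g Y = g. Proof. exact: ev2Y. Qed.

Lemma inverse_pair_swap f g p q :
  inverse_pair f g p q -> inverse_pair (cmp Y X f) (cmp Y X g) q p.
Proof.
case=> ep eq ef eg.
split; first by rewrite -cmp_cmp eq cmpY.
- by rewrite -cmp_cmp ep cmpX.
- by rewrite cmp_cmp cmpX cmpY ef.
- by rewrite cmp_cmp cmpX cmpY eg.
Qed.

Lemma toPP_swap_ev h : (toPP (cmp Y X h)).[0] = curve_ev 0 'X h.
Proof.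
rewrite -[LHS]/((horner_eval 0 \o toPP \o cmp Y X) h) (@rmorph_ev2 _ _ _ (@polyC K)) => [|c] /=.
  by rewrite cmpX cmpY /toPP ev2X ev2Y /horner_eval hornerX hornerC.
by rewrite /cmp ev2C /= /toPP ev2C /= /horner_eval hornerC.
Qed.

(** In the coordinates (f, g) the curve is the axis f = 0: the factor theorem. *)
Lemma curve_kernel f g p q h : inverse_pair f g p q ->
  curve_ev (curve_ev 0 'X p) (curve_ev 0 'X q) h = 0 -> exists T, h = T * f.
Proof.
move=> inv; rewrite -curve_ev_cmp -toPP_swap_ev => /eqP/factor_theorem[T].
rewrite subr0 => /(congr1 (fromPP Y X)); rewrite fromPP_toPP rmorphM /= fromPPX.
rewrite cmp_cmp cmpX cmpY cmpXY => /(congr1 (cmp f g)).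
rewrite (inverse_pairK _ inv) rmorphM /= cmpX => ->.
by exists (cmp f g (fromPP Y X T)).
Qed.

Lemma curve_first f g p q : inverse_pair f g p q ->
  curve_ev (curve_ev 0 'X p) (curve_ev 0 'X q) f = 0.
Proof. by case=> _ _ ef _; rewrite -curve_ev_cmp ef /curve_ev ev2X. Qed.

Lemma curve_second f g p q : inverse_pair f g p q ->
  curve_ev (curve_ev 0 'X p) (curve_ev 0 'X q) g = 'X.
Proof. by case=> _ _ _ eg; rewrite -curve_ev_cmp eg /curve_ev ev2Y. Qed.

Lemma inverse_pair_neq0 f g p q : inverse_pair f g p q -> f != 0.
Proof.
case=> _ _ ef _; apply/eqP => e; move/eqP: ef.
by rewrite e rmorph0 eq_sym (negPf (mpolyX_neq0 _)).
Qed.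

End PlaneAutomorphisms.

(** * The Newton polygon of a coordinate *)

Section Divisibility.
Variable K : fieldType.
Notation P2 := {mpoly K[2]}.
Notation X := ('X_(ord0 : 'I_2) : P2).
Notation Y := ('X_(ord_max : 'I_2) : P2).
Implicit Types (f g h p q psi : P2).

Lemma mcoeff_sumX (I : finType) (v : I -> K) (m : I -> 'X_{1..2}) k :
  (\sum_i v i *: 'X_[m i] : P2)@_k = \sum_i v i * (m i == k)%:R.
Proof. by rewrite raddf_sum; apply: eq_bigr => i _; rewrite /= mcoeffZ mcoeffX. Qed.

Lemma curve_ev_mn (a b : {poly K}) i j :
  curve_ev a b 'X_[mn i j] = a ^+ i * b ^+ j.
Proof. exact: ev2mn. Qed.

Lemma curve_evZ (a b : {poly K}) c h : curve_ev a b (c *: h) = c%:P * curve_ev a b h.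
Proof. exact: ev2Z. Qed.

Lemma size_exp_leq (p : {poly K}) d i : (size p <= d.+1)%N ->
  (size (p ^+ i) <= (i * d).+1)%N.
Proof.
move=> sp; apply: leq_trans (size_poly_exp_leq _ _) _.
by rewrite ltnS mulnC leq_mul2l; apply/orP; right; lia.
Qed.

Lemma size_curve_mn (x y : {poly K}) a b i j :
  (size x <= b.+1)%N -> (size y <= a.+1)%N ->
  (size (curve_ev x y 'X_[mn i j]) <= (i * b + j * a).+1)%N.
Proof.
move=> sx sy; rewrite curve_ev_mn; apply: leq_trans (size_polyMleq _ _) _.
have := size_exp_leq i sx; have := size_exp_leq j sy.
by move: (size _) (size _) => u w; lia.
Qed.

(** Suppose that the leading exponent (i, j) of f has weight c > a b. In a large
    box, the monomials X^k Y^l with k < i or l < j restrict to the curve with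
    degree at most D, and there are more than D + 1 of them. Some combination of
    them therefore vanishes on the curve, hence is a multiple of f, although its
    leading monomial is not divisible by X^i Y^j. *)
Lemma newton_weight f (x y : {poly K}) a b :
  f != 0 -> (0 < a)%N -> (0 < b)%N -> (size x <= b.+1)%N -> (size y <= a.+1)%N ->
  (forall h, curve_ev x y h = 0 -> exists T, h = T * f) ->
  forall i j, f@_(mn i j) != 0 -> (i * b + j * a <= a * b)%N.
Proof.
move=> nzf ap bp sx sy ker i' j' nz'.
have [i [j [[nzw lw] nz max]]] := lead_exp_ex bp ap nzf.
apply: (@leq_trans (b * i + a * j)).
  by rewrite ![(_ * b)%N]mulnC ![(_ * a)%N]mulnC; exact: max.
rewrite leqNgt; apply/negP => lt.
(* The size of the box makes the count below exceed D + 1: since c >= a b + 1,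
   the box contains c N >= (a b + 1) N monomials, and N > c + 1. *)
pose c := (b * i + a * j)%N; pose N := c.+2.
pose I := ('I_(N * a) * 'I_j + 'I_i * 'I_(N * b))%type.
pose m (k : I) : 'X_{1..2} := match k with
  | inl (u, w) => mn u w | inr (u, w) => mn u (j + w) end.
have mI : injective m.
  case=> [[u w]|[u w]] [[u' w']|[u' w']] /mnI[e1 e2].
  - by congr (inl (_, _)); apply: val_inj.
  - by have := ltn_ord w; rewrite e2 ltnNge leq_addr.
  - by have := ltn_ord w'; rewrite -e2 ltnNge leq_addr.
  - by congr (inr (_, _)); apply: val_inj => //; exact: addnI e2.
pose D := (N * (a * b) + c)%N.
have szm k : (size (curve_ev x y 'X_[m k]) <= D.+1)%N.
  case: k => [[u w]|[u w]]; apply: leq_trans (size_curve_mn _ _ sx sy) _.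
    have u1 := ltn_ord u; have w1 := ltn_ord w; rewrite ltnS /D /c.
    have h1 : (u * b <= N * a * b)%N by rewrite leq_mul2r ltnW ?orbT.
    have h2 : (w * a <= j * a)%N by rewrite leq_mul2r ltnW ?orbT.
    move: h1 h2; rewrite -mulnA; lia.
  have u1 := ltn_ord u; have w1 := ltn_ord w; rewrite ltnS /D /c.
  have h1 : (u * b <= i * b)%N by rewrite leq_mul2r ltnW ?orbT.
  have h2 : (w * a <= N * b * a)%N by rewrite leq_mul2r ltnW ?orbT.
  move: h1 h2; rewrite mulnDl -[(N * b * a)%N]mulnA [(b * a)%N]mulnC; lia.
have cardI : (D.+1 < #|{: I}|)%N.
  rewrite card_sum !card_prod !card_ord /D.
  have h1 : ((a * b).+1 * N <= c * N)%N by rewrite leq_mul2r lt orbT.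
  have -> : (N * a * j + i * (N * b) = c * N)%N by rewrite /c; ring.
  apply: leq_trans h1; rewrite /N; lia.
have [v [k0 nzk] kerv] := left_kernel_finType
   (fun k (d : 'I_D.+1) => (curve_ev x y 'X_[m k])`_d) cardI.
pose psi : P2 := \sum_k v k *: 'X_[m k].
have [T eT] : exists T, psi = T * f.
  apply: ker; rewrite rmorph_sum; apply/polyP => d; rewrite coef0 coef_sum.
  have [ltd|led] := ltnP d D.+1.
    rewrite -[RHS](kerv (Ordinal ltd)); apply: eq_bigr => k _.
    by rewrite /= curve_evZ coefCM.
  apply: big1 => k _; rewrite /= curve_evZ coefCM nth_default ?mulr0 //.
  exact: leq_trans (szm k) led.
have nzpsi : psi != 0.
  apply: contraNneq nzk => e; have := congr1 (mcoeff (m k0)) e.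
  rewrite mcoeff0 mcoeff_sumX (bigD1 k0) //= eqxx mulr1 big1 ?addr0 => [->//|k ne].
  by rewrite (inj_eq mI) (negPf ne) mulr0.
have [i1 [j1 [[nzw1 lw1] nz1 _]]] := lead_exp_ex bp ap nzpsi.
have nzT : wsub b a T != 0.
  by apply: contraNneq nzw1 => e; rewrite eT rmorphM /= e mul0r.
move: lw1; rewrite eT rmorphM /= mleadM // lw => e1.
have : (mn (b * i) (a * j) <= mn (b * i1) (a * j1))%MM by rewrite -e1 lem_addl.
rewrite mn_le !leq_pmul2l // => /andP[lei lej].
suff [k ek] : exists k, m k = mn i1 j1.
  case: k ek => [[u w]|[u w]] /mnI[e2 e3].
    by have := ltn_ord w; rewrite e3 ltnNge lej.
  by have := ltn_ord u; rewrite e2 ltnNge lei.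
apply: contrapT => no; move/negP: nz1; apply; apply/eqP.
rewrite mcoeff_sumX; apply: big1 => k _; case: eqP => [e|]; last by rewrite mulr0.
by case: no; exists k.
Qed.

(** If Y^b did not occur in f, then f would have degree less than b in Y, and the
    b powers g^k would be dependent over K[X] modulo f. On the curve this reads
    sum_k c_k(x(t)) t^k = 0 with k < b = deg x, where the degrees are distinct
    modulo b. *)
Lemma newton_vertex f g p q (x := curve_ev 0 'X p) (y := curve_ev 0 'X q) a b :
  inverse_pair f g p q -> (0 < a)%N -> (0 < b)%N -> size x = b.+1 -> (size y <= a.+1)%N ->
  (forall i j, f@_(mn i j) != 0 -> (i * b + j * a <= a * b)%N) /\ f@_(mn 0 b) != 0.
Proof.
move=> inv ap bp sx sy; have nzf := inverse_pair_neq0 inv.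
have wt : forall i j, f@_(mn i j) != 0 -> (i * b + j * a <= a * b)%N.
  apply: (newton_weight (x := x) (y := y)) => //; first by rewrite sx.
  by move=> h; apply: curve_kernel inv.
split=> //.
suff [i [j [lej nz]]] : exists i j, (b <= j)%N /\ f@_(mn i j) != 0.
  have := wt _ _ nz; rewrite mulnC => le.
  have ej : j = b.
    apply/eqP; rewrite eqn_leq lej andbT -(leq_pmul2l ap); lia.
  have ei : i = 0%N by move: le; rewrite ej; case: i {nz} => // i; nia.
  by move: nz; rewrite ej ei.
apply: contrapT => no.
have small : ((size (toPP f)).-1 < b)%N.
  rewrite (@leq_ltn_trans b.-1) ?prednK // size_phi // => i j nz.
  rewrite -ltnS prednK // ltnNge; apply/negP => le; case: no; by exists i, j.
have fK : cancel (@toPP K) (fromPP X Y).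
  by move=> h; rewrite fromPP_toPP cmpXY.
have nzP : toPP f != 0 by rewrite -(rmorph0 (@toPP K)) (inj_eq (@toPP_inj K)).
have [c [k0 nzc] [T eT]] := pseudo_dependent (fun k : 'I_b => g ^+ k) fK nzP small.
have xn0 : x != 0 by rewrite -size_poly_gt0 sx.
have /negP[] : \sum_(k < b) (c k \Po x) * 'X^k != 0.
  have nz2 (k : 'I_b) : (c k \Po x) * 'X^k != 0 -> c k != 0.
    by apply: contraNneq => ->; rewrite comp_poly0 mul0r.
  have szE (k : 'I_b) : c k != 0 ->
      size ((c k \Po x) * 'X^k) = ((size (c k)).-1 * b + k).+1.
    move=> nz; have nz3 : c k \Po x != 0 by rewrite comp_poly_eq0 // sx ltnS.
    rewrite size_mul ?expf_neq0 ?polyX_eq0 // size_polyXn addnS /=.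
    have := size_comp_poly (c k) x; rewrite sx /=.
    have := size_poly_gt0 (c k \Po x); rewrite nz3.
    by move: (size _) => s; lia.
  apply: size_sum_distinct => [k k' /nz2 nz /nz2 nz'|].
    rewrite !szE // => -[e]; apply: val_inj => /=.
    have := congr1 (modn^~ b) e; by rewrite !modnMDl !modn_small.
  exists k0; apply: contraNneq nzc => /eqP.
  by rewrite mulf_eq0 comp_poly_eq0 ?sx ?ltnS // expf_eq0 polyX_eq0 andbF orbF.
have := congr1 (curve_ev x y) eT; rewrite rmorphM /= (curve_first inv) mulr0 => e.
apply/eqP; rewrite -[RHS]e rmorph_sum; apply: eq_bigr => k _.
rewrite rmorphM rmorphXn /= (curve_second inv) fromPPC -horner_map /=.
rewrite -map_poly_comp /comp_poly {1}/curve_ev ev2X; congr (_.[_] * _).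
by apply: eq_map_poly => z /=; rewrite /curve_ev ev2C.
Qed.
End Divisibility.

Section Divisibility.
Variable K : fieldType.
Notation P2 := {mpoly K[2]}.
Notation X := ('X_(ord0 : 'I_2) : P2).
Notation Y := ('X_(ord_max : 'I_2) : P2).
Implicit Types (f g h p q psi : P2).

Lemma coef_curve0 h k : (curve_ev 0 'X h)`_k = h@_(mn 0 k).
Proof. by rewrite -toPP_swap_ev horner_coef0 coef_toPP coef_swap. Qed.

Lemma size_toPP_eq h n : h@_(mn 0 n) != 0 ->
  (forall i j, h@_(mn i j) != 0 -> (j <= n)%N) -> size (toPP h) = n.+1.
Proof.
move=> nz le; apply/eqP; rewrite eqn_leq; apply/andP; split.
  by apply/size_toPP_leq => i j /le.
by rewrite ltnNge; apply: contraNN nz => /size_toPP_leq/(_ 0%N n); case: eqP => // _ /(_ isT); rewrite ltnn.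
Qed.

Lemma size_curve0 h n : h@_(mn 0 n) != 0 ->
  (forall i j, h@_(mn i j) != 0 -> (j <= n)%N) -> size (curve_ev 0 'X h) = n.+1.
Proof.
move=> nz le; apply/eqP; rewrite eqn_leq; apply/andP; split.
  apply/leq_sizeP => j ltj; rewrite coef_curve0; apply/eqP.
  by apply: contraTT ltj => /le; rewrite -leqNgt.
by rewrite ltnNge; apply: contraNN nz => le'; rewrite -coef_curve0 nth_default.
Qed.

Lemma newton_vertex_y f g p q (x := curve_ev 0 'X p) b :
  inverse_pair f g p q -> (0 < b)%N -> size x = b.+1 ->
  f@_(mn 0 b) != 0 /\
  forall i j, f@_(mn i j) != 0 -> (j <= b)%N /\ (j = b -> i = 0%N).
Proof.
move=> inv bp sx.
pose a := maxn 1 (size (curve_ev 0 'X q)).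
have ap : (0 < a)%N by rewrite /a leq_maxl.
have [|wt nz] := newton_vertex inv ap bp sx.
  by rewrite (@leq_trans a) ?leqnSn ?leq_maxr.
split=> // i j /wt le.
have lej : (j <= b)%N by rewrite -(leq_pmul2l ap); lia.
by split=> // e; move: le; rewrite e; case: i => // i; nia.
Qed.

(** A polynomial of degree less than b in Y has, once written in the coordinates
    (p, q), a top coefficient in Y that is constant; otherwise [leading_rank_y],
    applied to the inverse automorphism, would make its degree in Y at least b. *)
Lemma restricted_degree f g p q b psi
    (x := curve_ev 0 'X p) (y := curve_ev 0 'X q) :
  inverse_pair f g p q -> (0 < b)%N -> size x = b.+1 -> psi != 0 ->
  (forall i j, psi@_(mn i j) != 0 -> (j < b)%N) ->
  size (toPP (cmp p q psi)) = size (curve_ev x y psi).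
Proof.
move=> inv bp sx nz lt.
have [nzf maxf] := newton_vertex_y inv bp sx.
have sf : size (curve_ev 0 'X f) = b.+1.
  by apply: size_curve0 => // i j /maxf[].
have [nzp maxp] := newton_vertex_y (inverse_pair_sym inv) bp sf.
(* The weight of Y is so large that the order is by degree in Y first. *)
pose M := (msize p).+1; have Mp : (0 < M)%N by [].
have lp : lead_exp 1 M p 0 b.
  apply: lead_exp_uniq => // i j nzij ne; have [lej ej] := maxp _ _ nzij.
  have ltj : (j < b)%N.
    rewrite ltn_neqAle lej andbT; apply/eqP => e; case: ne.
    by rewrite ej // e.
  have := msize_mdeg_lt (n := 2) (p := p) (m := mn i j).
  rewrite mcoeff_msupp mn_deg => /(_ nzij) ltM.
  have: (M * j.+1 <= M * b)%N by rewrite leq_mul2l ltj orbT.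
  rewrite mulnS /M; lia.
have nzP : cmp p q psi != 0.
  apply: contraNneq nz => e; rewrite -(inverse_pairK psi inv) e; exact/eqP/rmorph0.
have [i [j [lP nzij max]]] := lead_exp_ex (ltn0Sn 0) Mp nzP.
have := leading_rank_y (ltn0Sn 0) Mp bp (inverse_pair_sym inv) lp lP.
rewrite (inverse_pairK psi inv) => leb.
have i0 : i = 0%N.
  have: ((size (toPP psi)).-1 < b)%N.
    rewrite (@leq_ltn_trans b.-1) ?prednK // size_phi // => i' j' /lt.
    by case: (b) bp.
  by case: i leb {lP nzij max} => // i; rewrite mulSn; lia.
rewrite i0 in nzij max.
have lej i' j' : (cmp p q psi)@_(mn i' j') != 0 -> (j' <= j)%N.
  by move=> /max le; rewrite -(leq_pmul2l Mp); lia.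
by rewrite (size_toPP_eq nzij lej) /x /y -curve_ev_cmp (size_curve0 nzij lej).
Qed.

(** Euclidean division in Y: the top coefficient of f in Y is a constant. *)
Lemma reduce_mod f b h : (0 < b)%N -> f@_(mn 0 b) != 0 ->
  (forall i j, f@_(mn i j) != 0 -> (j <= b)%N /\ (j = b -> i = 0%N)) ->
  exists r T, h = T * f + r /\ forall i j, r@_(mn i j) != 0 -> (j < b)%N.
Proof.
move=> bp nz max.
have sf : size (toPP f) = b.+1 by apply: size_toPP_eq => // i j /max[].
have lcf : lead_coef (toPP f) = (f@_(mn 0 b))%:P.
  rewrite lead_coefE sf /=; apply/polyP => i; rewrite coef_toPP coefC.
  case: eqP => [->//|ne]; apply/eqP; apply: contraT => /max[_ /(_ erefl)] //.
have ulc : lead_coef (toPP f) \is a GRing.unit.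
  by rewrite lcf poly_unitE size_polyC nz coefC /= unitfE.
have e := Pdiv.IdomainUnit.divp_eq ulc (toPP h).
have fK u : toPP (fromPP X Y u) = u.
  elim/poly_ind: u => [|u c IH]; first by rewrite !rmorph0.
  rewrite 2!rmorphD 2!rmorphM /= IH fromPPX [toPP Y]ev2Y fromPPC; congr (_ + _).
  rewrite -horner_map -map_poly_comp /= [toPP X]ev2X.
  rewrite (@eq_map_poly _ _ _ (polyC \o polyC)) => [|a] /=; last exact: ev2C.
  rewrite map_poly_comp horner_map /=; congr _%:P; exact: comp_polyXr.
exists (fromPP X Y (toPP h %% toPP f)), (fromPP X Y (toPP h %/ toPP f)).
split; first by apply: toPP_inj; rewrite rmorphD rmorphM /= !fK.
apply/size_toPP_leq; rewrite fK -ltnS -sf.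
by rewrite ltn_modp -size_poly_gt0 sf.
Qed.

End Divisibility.

(** * Divisibility of the degrees of a coordinate line *)

(** Two weights, each a multiple by M of (b, a) perturbed in one variable, that
    order the monomials (k, 0) and (i, j) in opposite ways: M exceeds the exponents,
    so the unperturbed weights must agree. *)
Lemma equal_weights M a b i j k :
  (M * b * k + (M * a).+1 * 0 <= M * b * i + (M * a).+1 * j)%N ->
  ((M * b).+1 * i + M * a * j <= (M * b).+1 * k + M * a * 0)%N ->
  (j < M)%N -> (k < M)%N -> (b * k = b * i + a * j)%N.
Proof.
rewrite !muln0 !addn0 !mulSn -!mulnA => m1 m2 lj lk.
have {}m1 : (M * (b * k) <= M * (b * i + a * j) + j)%N by rewrite mulnDr; lia.
have {}m2 : (M * (b * i + a * j) <= M * (b * k) + k)%N by rewrite mulnDr; lia.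
apply/eqP; rewrite eqn_leq; apply/andP; split; rewrite leqNgt; apply/negP => lt.
  have : (M * (b * i + a * j).+1 <= M * (b * k))%N by rewrite leq_mul2l lt orbT.
  by rewrite mulnS; lia.
have : (M * (b * k).+1 <= M * (b * i + a * j))%N by rewrite leq_mul2l lt orbT.
by rewrite mulnS; lia.
Qed.

Section Divisibility.
Variable K : fieldType.
Notation P2 := {mpoly K[2]}.
Notation X := ('X_(ord0 : 'I_2) : P2).
Notation Y := ('X_(ord_max : 'I_2) : P2).
Implicit Types (f g h p q psi : P2).

Lemma newton_triangle f g p q (x := curve_ev 0 'X p) (y := curve_ev 0 'X q) a b :
  inverse_pair f g p q -> (0 < a)%N -> (0 < b)%N -> size x = b.+1 -> size y = a.+1 ->
  [/\ forall i j, f@_(mn i j) != 0 -> (i * b + j * a <= a * b)%N,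
      f@_(mn 0 b) != 0 & f@_(mn a 0) != 0].
Proof.
move=> inv ap bp sx sy.
have sy' : (size y <= a.+1)%N by rewrite sy.
have sx' : (size x <= b.+1)%N by rewrite sx.
have [wt nzb] := newton_vertex inv ap bp sx sy'.
have [_ nza] := newton_vertex (inverse_pair_swap inv) bp ap sy sx'.
by split=> //; rewrite -coef_swap; exact: nza.
Qed.

(** Each of the two vertices leads f for one perturbation of the weight for which
    they are tied. *)
Lemma perturbed_lead f a' b' e M : (0 < a')%N -> (0 < b')%N -> (0 < e)%N -> (0 < M)%N ->
  (forall i j, f@_(mn i j) != 0 -> (i * (e * b') + j * (e * a') <= (e * a') * (e * b'))%N) ->
  f@_(mn 0 (e * b')) != 0 -> f@_(mn (e * a') 0) != 0 ->
  lead_exp (M * b') (M * a').+1 f 0 (e * b') /\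
  lead_exp (M * b').+1 (M * a') f (e * a') 0.
Proof.
move=> ap bp ep Mp wt nzb nza.
have wt' i j : f@_(mn i j) != 0 -> (i * b' + j * a' <= e * a' * b')%N.
  by move=> /wt; rewrite -(leq_pmul2l ep) => le; nia.
split; apply: lead_exp_uniq => //; rewrite ?muln_gt0 ?ap ?bp ?Mp // => i j nz ne.
- have le := wt' _ _ nz.
  have lej : (j <= e * b')%N by rewrite -(leq_pmul2r ap); nia.
  have [e1|ne1] := eqVneq j (e * b')%N.
    case: ne; rewrite e1; congr (_, _).
    by move: le; rewrite e1; case: (i) => // i'; nia.
  have {}lej : (j < e * b')%N by rewrite ltn_neqAle ne1.
  have : (M * (i * b' + j * a') <= M * (e * a' * b'))%N by rewrite leq_mul2l le orbT.
  nia.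
- have le := wt' _ _ nz.
  have lei : (i <= e * a')%N by rewrite -(leq_pmul2r bp); nia.
  have [e1|ne1] := eqVneq i (e * a')%N.
    case: ne; rewrite e1; congr (_, _).
    by move: le; rewrite e1; case: (j) => // i'; nia.
  have {}lei : (i < e * a')%N by rewrite ltn_neqAle ne1.
  have : (M * (i * b' + j * a') <= M * (e * a' * b'))%N by rewrite leq_mul2l le orbT.
  nia.
Qed.

(** Let e = gcd(a, b), a = e a', b = e b', and suppose a', b' > 1. The powers g^d
    with d < a, reduced modulo f, restrict to t^d on the curve. As s = ceil(a'/b')
    is less than a', some nonzero combination psi of them has zero coefficients at
    the s e exponents (i, b' r) with i < s and r < e. Written in the coordinates
    (p, q), psi has degree less than a in Y, so [leading_rank_y] puts its leading
    exponent (i, j) for the first perturbed weight at i < s, while [leading_rank_x]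
    puts the one for the second at some (k, 0). Both have the same weight, so
    b' divides j by coprimality, and (i, j) is one of the excluded exponents. *)
Lemma degree_dvd f g p q (x := curve_ev 0 'X p) (y := curve_ev 0 'X q) a b :
  inverse_pair f g p q -> (0 < a)%N -> (0 < b)%N -> size x = b.+1 -> size y = a.+1 ->
  (a %| b)%N || (b %| a)%N.
Proof.
move=> inv ap bp sx sy.
have [wt nzb nza] := newton_triangle inv ap bp sx sy.
have [_ maxf] := newton_vertex_y inv bp sx.
pose e := gcdn a b; have ep : (0 < e)%N by rewrite gcdn_gt0 ap.
pose a' := (a %/ e)%N; pose b' := (b %/ e)%N.
have ea : a = (e * a')%N by rewrite mulnC divnK ?dvdn_gcdl.
have eb : b = (e * b')%N by rewrite mulnC divnK ?dvdn_gcdr.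
have a'p : (0 < a')%N by move: ap; rewrite ea muln_gt0 => /andP[].
have b'p : (0 < b')%N by move: bp; rewrite eb muln_gt0 => /andP[].
have cop : coprime b' a'.
  by rewrite /coprime -(eqn_pmul2l ep) muln_gcdr -ea -eb muln1 gcdnC.
have [a1|a2] := leqP a' 1.
  by rewrite ea eb (_ : a' = 1%N) ?muln1 ?dvdn_mulr //; lia.
have [b1|b2] := leqP b' 1.
  by rewrite ea eb (_ : b' = 1%N) ?muln1 ?dvdn_mulr ?orbT //; lia.
exfalso; pose s := ((a' + b').-1 %/ b')%N.
have lts : (s < a')%N by rewrite ltn_divLR //; nia.
have red (d : 'I_a) : exists r T, g ^+ d = T * f + r /\
    forall i j, r@_(mn i j) != 0 -> (j < b)%N by apply: reduce_mod.
have [h hP] := choice red.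
have hd (d : 'I_a) : curve_ev x y (h d) = 'X^d.
  have [T [/(congr1 (curve_ev x y)) eT _]] := hP d.
  move: eT; rewrite rmorphXn rmorphD rmorphM /= [curve_ev x y g](curve_second inv).
  by rewrite [curve_ev x y f](curve_first inv) mulr0 add0r.
(* The index k encodes the exponent (k / e, b' (k mod e)). *)
pose A (d : 'I_a) (k : 'I_(s * e)) := (h d)@_(mn (k %/ e) (b' * (k %% e))).
have lt_dim : (s * e < a)%N by rewrite ea mulnC ltn_pmul2l.
have [v [d0 nzd] kerv] := left_kernel_nonzero A lt_dim.
pose psi := \sum_d v d *: h d.
have evpsi : curve_ev x y psi = \poly_(d < a) (if insub d is Some d' then v d' else 0).
  rewrite rmorph_sum poly_def; apply: eq_bigr => d _.
  by rewrite /= curve_evZ hd mul_polyC valK.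
have nzev : curve_ev x y psi != 0.
  apply: contraNneq nzd => /polyP/(_ (d0 : nat)).
  by rewrite evpsi coef_poly ltn_ord valK coef0 => /eqP.
have nzpsi : psi != 0 by apply: contraNneq nzev => ->; rewrite rmorph0.
have ltpsi i j : psi@_(mn i j) != 0 -> (j < b)%N.
  move=> nz; apply: contrapT => no; move/negP: nz; apply; apply/eqP.
  rewrite raddf_sum; apply: big1 => d _; rewrite /= mcoeffZ.
  have [->|nzh] := eqVneq ((h d)@_(mn i j)) 0; first by rewrite mulr0.
  by case: no; have [T [_ lt]] := hP d; apply: lt nzh.
have sD : ((size (toPP (cmp p q psi))).-1 < a)%N.
  rewrite (restricted_degree inv bp sx nzpsi ltpsi) -/x -/y evpsi.
  by apply: (@leq_ltn_trans a.-1); rewrite ?prednK // -!subn1 leq_sub2r // size_poly.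
set D := (size _).-1 in sD.
pose M := (msize psi).+1; have Mp : (0 < M)%N by [].
have small i j : psi@_(mn i j) != 0 -> (i + j < M)%N.
  move=> nz; have := msize_mdeg_lt (n := 2) (p := psi) (m := mn i j).
  by rewrite mcoeff_msupp mn_deg => /(_ nz) /leqW.
have Mb : (0 < M * b')%N by rewrite muln_gt0 Mp.
have Ma : (0 < M * a')%N by rewrite muln_gt0 Mp.
have := @perturbed_lead f a' b' e M a'p b'p ep Mp.
rewrite -ea -eb => /(_ wt nzb nza)[lf1 lf2].
have [i [j [lp1 nz1 max1]]] := lead_exp_ex Mb (ltn0Sn (M * a')) nzpsi.
have [k [l [lp2 nz2 max2]]] := lead_exp_ex (ltn0Sn (M * b')) Ma nzpsi.
have r1 := leading_rank_y Mb (ltn0Sn _) bp inv lf1 lp1.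
have r2 := leading_rank_x (ltn0Sn _) Ma ap inv lf2 lp2.
rewrite -/D in r1 r2.
have l0 : l = 0%N.
  have : (l * a < a)%N by apply: leq_ltn_trans r2 sD.
  by rewrite -[X in (_ < X)%N]mul1n ltn_pmul2r //; case: (l).
have lti : (i < s)%N.
  have : (i * b < a)%N by apply: leq_ltn_trans r1 sD.
  rewrite ea eb mulnCA ltn_pmul2l // => lt.
  rewrite leq_divRL // mulSn addnC -ltnS prednK ?addn_gt0 ?a'p //.
  by rewrite ltn_add2r.
have ew : (b' * k = b' * i + a' * j)%N.
  have m1 := max1 _ _ nz2; have m2 := max2 _ _ nz1.
  rewrite l0 in m1 m2; apply: (equal_weights m1 m2).
    by apply: leq_ltn_trans (small _ _ nz1); rewrite leq_addl.
  by apply: leq_ltn_trans (small _ _ nz2); rewrite leq_addr.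
have dj : (b' %| j)%N.
  rewrite -(Gauss_dvdr _ cop) -(dvdn_addr (m := (b' * i)%N)) ?dvdn_mulr //.
  by rewrite -ew dvdn_mulr.
have [r er] := dvdnP dj.
have ltr : (r < e)%N.
  by have := ltpsi _ _ nz1; rewrite er eb ltn_pmul2r.
have ltk : (i * e + r < s * e)%N.
  by apply: (@leq_trans (i.+1 * e)); rewrite ?leq_mul2r ?lti ?orbT // mulSn addnC ltn_add2r.
have := kerv (Ordinal ltk); rewrite /A /= divnMDl // divn_small // addn0.
rewrite modnMDl modn_small // [(b' * r)%N]mulnC -er => e0.
move/negP: nz1; apply; apply/eqP; rewrite -[RHS]e0 raddf_sum.
by apply: eq_bigr => d _; rewrite /= mcoeffZ.
Qed.
End Divisibility.

(** * Abhyankar-Moh sequences and factorizations of the degree *)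

Section Numerical.
Local Open Scope nat_scope.
Implicit Types (es : seq nat) (r : seq nat).

(** The factors in es are the quotients d_k / d_{k+1} of the successive gcds, N is
    the product of the factors already read. *)
Fixpoint am_tail n N es : seq nat :=
  if es is e :: es' then (n * N - \prod_(i <- es') i) :: am_tail n (N * e) es' else [::].

Definition am_seq es := let n := \prod_(i <- es) i in n :: am_tail n 1 es.

Lemma size_am_tail n N es : size (am_tail n N es) = size es.
Proof. by elim: es N => //= e es IH N; rewrite IH. Qed.

Lemma nth_am_tail n N es k : k < size es ->
  nth 0 (am_tail n N es) k = n * (N * \prod_(i <- take k es) i) - \prod_(i <- drop k.+1 es) i.
Proof.
elim: es N k => [//|e es IH] N [|k] /= ltk; first by rewrite big_nil muln1 drop0.
by rewrite IH // big_cons -(mulnA N).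
Qed.

Lemma char_gcdS r k : char_gcd r k.+1 = gcdn (char_gcd r k) (nth 0 r k).
Proof. by rewrite /char_gcd big_ord_recr. Qed.

Section Products.
Variable es : seq nat.
Hypothesis es2 : all (leq 2) es.
Let n := \prod_(i <- es) i.
Let T k := \prod_(i <- take k es) i.
Let D k := \prod_(i <- drop k es) i.

Let TD k : T k * D k = n.
Proof. by rewrite /T /D /n -{3}(cat_take_drop k es) big_cat. Qed.

Let prod_gt0 s : {subset s <= es} -> 0 < \prod_(i <- s) i.
Proof.
move=> sub; rewrite big_seq prodn_cond_gt0 // => i /sub/(allP es2) /=.
exact: ltnW.
Qed.

Let T_gt0 k : 0 < T k. Proof. by apply: prod_gt0 => i /mem_take. Qed.
Let D_gt0 k : 0 < D k. Proof. by apply: prod_gt0 => i /mem_drop. Qed.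
Let D_S k : k < size es -> D k = nth 0 es k * D k.+1.
Proof. by move=> lt; rewrite /D (drop_nth 0 lt) big_cons. Qed.
Let T_S k : k < size es -> T k.+1 = T k * nth 0 es k.
Proof. by move=> lt; rewrite /T (take_nth 0 lt) -cats1 big_cat big_seq1. Qed.
Let es_ge2 k : k < size es -> 2 <= nth 0 es k.
Proof. by move=> lt; apply: (allP es2); apply: mem_nth. Qed.
Let D_last : D (size es) = 1. Proof. by rewrite /D drop_size big_nil. Qed.
Let D0 : D 0 = n. Proof. by rewrite /D drop0. Qed.
Let T0 : T 0 = 1. Proof. by rewrite /T take0 big_nil. Qed.

Let rE k : k < size es -> nth 0 (am_seq es) k.+1 = n * T k - D k.+1.
Proof. by move=> lt; rewrite /am_seq /= nth_am_tail // mul1n. Qed.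

Let D_lt k : k < size es -> D k.+1 < D k.
Proof. by move=> lt; rewrite (D_S lt) -{1}[D _]mul1n ltn_pmul2r // es_ge2. Qed.

Let D_le_n k : D k <= n.
Proof. by rewrite -(TD k) leq_pmull. Qed.

Let D_lt_nT k : k < size es -> D k.+1 < n * T k.
Proof.
move=> lt; apply: leq_trans (D_lt lt) _; apply: leq_trans (D_le_n k) _.
by rewrite leq_pmulr.
Qed.

Let gcdE k : k <= size es -> char_gcd (am_seq es) k.+1 = D k.
Proof.
elim: k => [_|k IH lt]; first by rewrite /char_gcd big_ord_recl big_ord0 /= gcdn0 D0.
rewrite char_gcdS IH 1?ltnW // rE //.
have -> : n * T k = T k * T k * D k by rewrite -(TD k); ring.
rewrite (D_S lt); set e := nth 0 es k; set Dk := D k.+1.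
have -> : T k * T k * (e * Dk) - Dk = (T k * T k * e - 1) * Dk by rewrite mulnBl mul1n mulnA.
rewrite -muln_gcdl.
have -> : gcdn e (T k * T k * e - 1) = 1; last by rewrite mul1n.
have p : 0 < T k * T k * e by rewrite !muln_gt0 T_gt0 /= ltnW // es_ge2.
apply/eqP; rewrite -dvdn1 -(dvdn_addr _ (dvdn_gcdr e (T k * T k * e - 1))).
by rewrite subnK // (dvdn_trans (dvdn_gcdl _ _)) // dvdn_mull.
Qed.

Let DrE k : k < size es -> D k * nth 0 (am_seq es) k.+1 = n * n - D k * D k.+1.
Proof.
move=> lt; rewrite rE // mulnBr; congr (_ - _).
by rewrite mulnCA [D k * _]mulnC TD.
Qed.

Lemma am_seq_am : 0 < size es -> abhyankar_moh_sequence (am_seq es).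
Proof.
move=> s0.
have sh : (size (am_seq es)).-1 = size es by rewrite /= size_am_tail.
rewrite /abhyankar_moh_sequence sh; split.
- split=> [//|[|k] lek]; first exact: prod_gt0.
  by rewrite rE // subn_gt0 D_lt_nT.
- split; last by rewrite gcdE // D_last.
  case=> // k /andP[_ ltk]; rewrite !gcdE // ?D_lt //; exact: ltnW.
- case=> // k /andP[_ ltk].
  have lk := ltnW ltk; rewrite (gcdE (ltnW lk)) (gcdE lk) (DrE lk) (DrE ltk).
  have h1 : D k.+1 * D k.+2 < D k * D k.+1.
    by rewrite mulnC ltn_pmul2r // (ltn_trans (D_lt ltk)) // D_lt // ltnW.
  have h2 : D k * D k.+1 <= n * n by rewrite leq_mul ?D_le_n.
  by move: h1 h2; move: (D k * _) (D k.+1 * _) (n * n) => u v w; lia.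
- case s : (size es) s0 => [//|h] _.
  have lt : h < size es by rewrite s.
  rewrite (gcdE (ltnW lt)) (DrE lt) [nth 0 _ 0]/= -/n -mulnn.
  have h1 : 0 < D h * D h.+1 by rewrite muln_gt0 !D_gt0.
  have h2 : 0 < n * n by rewrite muln_gt0 -D0 !D_gt0.
  by move: h1 h2; move: (D h * _) (n * n) => u v; lia.
- suff H m : m <= size es -> \sum_(1 <= k < m.+1)
    (char_gcd (am_seq es) k %/ char_gcd (am_seq es) k.+1 - 1) * nth 0 (am_seq es) k + n + n
     = n * T m + D m.
    have := H _ (leqnn _); rewrite D_last.
    have -> : T (size es) = n by rewrite /T take_size.
    have : 0 < n by rewrite -D0.
    by rewrite /= -/n; move: (\sum_(1 <= k < _) _) n => S [//|m] _; rewrite subn1 /=; nia.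
  elim: m => [_|m IH lt]; first by rewrite big_geq // T0 D0 muln1.
  rewrite big_nat_recr //= -/(am_seq es) (gcdE lt) (gcdE (ltnW lt)).
  have {IH} := IH (ltnW lt); move: (\sum_(1 <= k < _) _) => S.
  have := rE lt; rewrite /= => ->; rewrite (D_S lt) mulnK // (T_S lt).
  have := D_lt_nT lt; have := es_ge2 lt.
  move: (nth 0 es m) (D m.+1) (T m) => [|e] // d t _ ltd eS.
  rewrite subn1 /= mulnBr; have : e * d <= e * (n * t) by rewrite leq_mul2l ltnW ?orbT.
  by move: eS; rewrite mulnS !mulnDr !mulSn; nia.
Qed.
End Products.
(** The increasing sequence d_k r_k stays below n^2, and both n^2 and d_k r_k are
    multiples of d_k d_{k+1}, so r_k <= n N_k - d_{k+1}. The weighted sum of these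
    upper bounds telescopes to (n - 1)^2, hence all of them are attained. *)
Lemma am_seqP r : abhyankar_moh_sequence r -> 1 < nth 0 r 0 ->
  exists es, [/\ all (leq 2) es, 0 < size es & r = am_seq es].
Proof.
case=> -[s0 rpos] [dlt dlast] mono last sumr n1.
set h := (size r).-1 in rpos dlt dlast mono last sumr.
set d := char_gcd r in dlt dlast mono last sumr.
set n := nth 0 r 0 in n1 last sumr.
have dS k : d k.+1 = gcdn (d k) (nth 0 r k) := char_gcdS r k.
have d1 : d 1 = n by rewrite dS /d /char_gcd big_ord0 gcd0n.
have dS_dvd k : d k.+1 %| d k by rewrite dS dvdn_gcdl.
have dS_dvdr k : d k.+1 %| nth 0 r k by rewrite dS dvdn_gcdr.
have dn k : d k.+1 %| n.
  by elim: k => [|k IH]; [rewrite d1 | apply: dvdn_trans (dS_dvd _) IH].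
have n0 : 0 < n by apply: ltnW.
have dpos k : 0 < d k.+1 by apply: dvdn_gt0 (dn k).
have h0 : 0 < h by rewrite lt0n; apply/eqP => e; rewrite e d1 in dlast; rewrite dlast in n1.
pose e_ k := d k.+1 %/ d k.+2.
have eD k : d k.+1 = e_ k * d k.+2 by rewrite divnK.
have e2 k : k < h -> 2 <= e_ k.
  move=> lt; have := dlt k.+1 lt; rewrite (eD k) -{1}[d k.+2]mul1n ltn_pmul2r //.
pose es := mkseq e_ h.
have szes : size es = h by rewrite size_mkseq.
have dropE k : k <= h -> \prod_(i <- drop k es) i = d k.+1.
  move=> le; rewrite -(subKn le); move: (h - k) (leq_subr k h) => {le}k.
  elim: k => [_|k IH lt]; first by rewrite subn0 -szes drop_size big_nil szes dlast.
  have lth : h - k.+1 < h by rewrite ltn_subrL h0.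
  rewrite (drop_nth 0) ?szes //.
  have e : (h - k.+1).+1 = h - k by rewrite subnS prednK // subn_gt0.
  rewrite big_cons nth_mkseq // e (IH (ltnW lt)).
  by rewrite -e -eD.
have prodE : \prod_(i <- es) i = n by rewrite -[es]drop0 dropE.
have es2 : all (leq 2) es.
  by apply/(all_nthP 0) => k; rewrite szes => lt; rewrite nth_mkseq // e2.
have takeE k : k <= h -> \prod_(i <- take k es) i = n %/ d k.+1.
  move=> le; rewrite -prodE -{2}(cat_take_drop k es) big_cat /= dropE // mulnK //.
exists es; rewrite szes; split=> //.
pose N k := n %/ d k.+1.
have ND k : N k * d k.+1 = n by rewrite divnK.
have NS k : N k.+1 = N k * e_ k.
  apply/eqP; rewrite -(eqn_pmul2r (dpos k.+1)) ND -mulnA -eD ND //.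
have dr_lt k : k < h -> d k.+1 * nth 0 r k.+1 < n * n.
  move=> lt; rewrite mulnn; apply: leq_ltn_trans last.
  have : forall m, m < h -> d (h - m) * nth 0 r (h - m) <= d h * nth 0 r h.
    elim=> [|m IH] ltm; first by rewrite subn0.
    apply: leq_trans (IH (ltnW ltm)); apply: ltnW.
    have -> : h - m = (h - m.+1).+1 by rewrite subnS prednK // subn_gt0 ltnW.
    by apply: mono; rewrite subn_gt0 ltm ltn_subrL h0.
  move=> /(_ (h - k.+1)); rewrite subKn //; apply.
  by rewrite ltn_subrL h0.
have bound k : k < h -> nth 0 r k.+1 + d k.+2 <= n * N k.
  move=> lt; have := dr_lt k lt; have /dvdnP[a ea] := dS_dvdr k.+1.
  have nE : n * n = d k.+1 * d k.+2 * (N k * N k.+1).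
    by rewrite -{1}(ND k) -(ND k.+1); ring.
  rewrite nE ea [a * _]mulnC mulnA ltn_pmul2l ?muln_gt0 ?dpos // => lta.
  rewrite -[n in n * N k](ND k.+1) -{2}[d k.+2]muln1 -mulnDr addn1.
  by rewrite [N k.+1 * _]mulnC -mulnA leq_pmul2l // mulnC.
have sumE m : m <= h -> \sum_(1 <= k < m.+1) (d k %/ d k.+1 - 1) * (n * N k.-1) + n = n * N m.
  elim: m => [_|m IH lt]; first by rewrite big_geq // add0n /N d1 divnn n0 muln1.
  rewrite big_nat_recr //= addnAC IH 1?ltnW // NS -/(e_ m).
  have := e2 _ lt; move: (e_ m) => [|e] // _; rewrite subn1 /=; ring.
have sumD m : m <= h -> \sum_(1 <= k < m.+1) (d k %/ d k.+1 - 1) * d k.+1 + d m.+1 = n.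
  elim: m => [_|m IH lt]; first by rewrite big_geq // add0n d1.
  rewrite big_nat_recr //= -[RHS](IH (ltnW lt)) -addnA; congr (_ + _).
  rewrite -/(e_ m) (eD m); have := e2 _ lt; move: (e_ m) => [|e] // _.
  by rewrite subn1 /= mulSn addnC.
have eqk k : k < h -> nth 0 r k.+1 + d k.+2 = n * N k.
  move=> lt; apply/eqP; rewrite eqn_leq bound //= leqNgt; apply/negP => ltk.
  have : \sum_(1 <= k < h.+1) (d k %/ d k.+1 - 1) * (nth 0 r k + d k.+1) <
         \sum_(1 <= k < h.+1) (d k %/ d k.+1 - 1) * (n * N k.-1).
    rewrite !big_add1 /= !big_mkord (bigD1 (Ordinal lt)) //= [X in _ < X](bigD1 (Ordinal lt)) //=.
    rewrite -addSn leq_add //.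
      by rewrite ltn_pmul2l // subn_gt0; exact: e2 lt.
    by apply: leq_sum => i _; rewrite leq_mul2l bound ?orbT.
  under eq_bigr => i _ do rewrite mulnDr.
  rewrite big_split /= sumr.
  have := sumE h (leqnn h); have := sumD h (leqnn h).
  have -> : N h = n by rewrite /N dlast divn1.
  rewrite dlast; move: (\sum_(1 <= k < _) _) (\sum_(1 <= k < _) _) => S S'.
  case: (n) n0 => // m _; rewrite subn1 /= => eS eS' ltS.
  by move: eS' eS ltS; rewrite -mulnn; nia.
apply: (@eq_from_nth _ 0); first by rewrite /am_seq /= size_am_tail szes /h prednK.
move=> [|k] ltk; first by rewrite /am_seq /= prodE.
have lt : k < h by rewrite /h -ltnS prednK.
rewrite /am_seq /= nth_am_tail ?szes // mul1n takeE 1?ltnW // dropE // prodE -/(N k).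
by rewrite -(eqk k lt) addnK.
Qed.

End Numerical.

(** * The Euclidean algorithm on coordinate lines *)

Section Chain.
Variable K : fieldType.
Notation P2 := {mpoly K[2]}.
Notation X := ('X_(ord0 : 'I_2) : P2).
Notation Y := ('X_(ord_max : 'I_2) : P2).
Implicit Types (f g h p q u w : P2) (P x y L : {poly K}) (Ps : seq {poly K}).

Definition pev P u : P2 := (map_poly (@mpolyC 2 K) P).[u].

Lemma cmp_pev f g P u : cmp f g (pev P u) = pev P (cmp f g u).
Proof.
rewrite /pev -horner_map -map_poly_comp /=; congr _.[_].
by apply: eq_map_poly => a /=; rewrite [LHS]ev2C.
Qed.

Lemma curve_ev_pev a b P u : curve_ev a b (pev P u) = P \Po curve_ev a b u.
Proof.
rewrite /pev -horner_map -map_poly_comp /= /comp_poly; congr _.[_].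
by apply: eq_map_poly => c /=; rewrite [LHS]ev2C.
Qed.

Lemma curve_ev_comp (a b c : {poly K}) h :
  curve_ev a b h \Po c = curve_ev (a \Po c) (b \Po c) h.
Proof.
rewrite -[LHS]/((comp_poly c \o curve_ev a b) h) (@rmorph_ev2 _ _ _ (@polyC K)) => [|k] /=.
  by rewrite [curve_ev a b X]ev2X [curve_ev a b Y]ev2Y.
by rewrite [curve_ev a b _]ev2C comp_polyC.
Qed.

(** Composition with the elementary automorphism (X, Y) |-> (X, Y + P(X)). *)
Lemma elementary_pair f g p q P (E := Y + pev P X) : inverse_pair f g p q ->
  inverse_pair (cmp E X f) (cmp E X g) q (p - pev P q).
Proof.
case=> ep eq ef eg.
have e1 : cmp (cmp E X f) (cmp E X g) q = X by rewrite -cmp_cmp eq cmpY.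
split; first exact: e1.
- by rewrite rmorphB /= cmp_pev e1 -cmp_cmp ep cmpX addrK.
- by rewrite cmp_cmp /E rmorphD /= cmp_pev cmpX cmpY subrK ef.
- by rewrite cmp_cmp /E rmorphD /= cmp_pev cmpX cmpY subrK eg.
Qed.

Lemma step_pair u w p q P : inverse_pair u w p q ->
  exists p' q', inverse_pair w (u - pev P w) p' q'.
Proof.
move=> /inverse_pair_sym/(elementary_pair P)/inverse_pair_sym inv.
by eexists; eexists; exact: inv.
Qed.

Lemma flip_pair u w p q : inverse_pair u w p q -> exists p' q', inverse_pair w u p' q'.
Proof.
move=> /inverse_pair_sym/inverse_pair_swap/inverse_pair_sym inv.
by eexists; eexists; exact: inv.
Qed.

(** The parametrizations by the parameter axis of the lines f = 0, for f a
    coordinate of the plane. *)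
Definition coordinate_curve (x y : {poly K}) := exists f g p q,
  [/\ inverse_pair f g p q, curve_ev 0 'X p = x & curve_ev 0 'X q = y].

Lemma coordinate_curve_step x y P :
  coordinate_curve x y -> coordinate_curve y (x - (P \Po y)).
Proof.
case=> f [g [p [q [/(elementary_pair P) inv ex ey]]]].
do 4 eexists; split; first exact: inv; first exact: ey.
by rewrite rmorphB /= curve_ev_pev ex ey.
Qed.

Lemma coordinate_curve_swap x y : coordinate_curve x y -> coordinate_curve y x.
Proof. by move=> /(coordinate_curve_step 0); rewrite comp_poly0 subr0. Qed.

Lemma coordinate_curve_dvd x y a b : coordinate_curve x y ->
  (0 < a)%N -> (0 < b)%N -> size x = b.+1 -> size y = a.+1 -> (a %| b)%N || (b %| a)%N.
Proof.
case=> f [g [p [q [inv <- <-]]]] ap bp sx sy.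
exact: degree_dvd inv ap bp sx sy.
Qed.

Lemma size_sub_lead (a b : {poly K}) : a != 0 -> size a = size b ->
  lead_coef a = lead_coef b -> (size (a - b)%R < size a)%N.
Proof.
move=> nz sab lab; have sp : (0 < size a)%N by rewrite size_poly_gt0.
rewrite -(prednK sp) ltnS; apply/leq_sizeP => j; rewrite leq_eqVlt => /orP[/eqP<-|lt].
  by rewrite coefB -[a`__]/(lead_coef a) lab lead_coefE sab subrr.
by rewrite coefB !nth_default ?subrr // -?sab -(prednK sp).
Qed.

(** As long as deg x >= deg y, by [degree_dvd] a multiple of a power of y has the
    leading term of x, and subtracting it does not leave the class of coordinate
    curves. A nonzero constant remainder is moved into P. *)
Lemma coordinate_curve_reduce n x y : (size x <= n)%N -> coordinate_curve x y ->
  (1 < size y)%N ->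
  exists P x', [/\ x = P \Po y + x', (size x' < size y)%N & size x' != 1%N].
Proof.
move=> + + sy; elim: n x => [|n IH] x sx cc.
  exists 0, 0; rewrite size_poly0 (ltnW sy) comp_poly0 addr0; split=> //.
  by apply/eqP; rewrite -size_poly_eq0 -leqn0.
have [lt|le] := ltnP (size x) (size y).
  have [e1|ne1] := eqVneq (size x) 1%N; last by exists 0, x; rewrite comp_poly0 add0r.
  have /size_poly1P[c _ ->] : size x == 1%N by rewrite e1.
  by exists c%:P, 0; rewrite comp_polyC addr0 size_poly0 (ltnW sy).
have [a sa] : exists a, size y = a.+1 by exists (size y).-1; rewrite prednK // ltnW.
have [b sb] : exists b, size x = b.+1.
  by exists (size x).-1; rewrite prednK // (leq_trans _ le) // ltnW.
have ap : (0 < a)%N by rewrite -ltnS -sa.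
have bp : (0 < b)%N by rewrite (leq_trans ap) // -ltnS -sb -sa.
have ab : (a %| b)%N.
  have /orP[//|] := coordinate_curve_dvd cc ap bp sb sa.
  move=> /dvdn_leq-/(_ ap) leba; suff -> : a = b by [].
  by apply/eqP; rewrite eqn_leq leba andbT -ltnS -sa -sb.
have xn0 : x != 0 by rewrite -size_poly_gt0 sb.
have yn0 : y != 0 by rewrite -size_poly_gt0 sa.
have lyn0 : lead_coef y != 0 by rewrite lead_coef_eq0.
pose k := (b %/ a)%N; pose c := lead_coef x / lead_coef y ^+ k.
have cn0 : c != 0 by rewrite mulf_neq0 ?lead_coef_eq0 // invr_neq0 // expf_neq0.
have lt : (size (x - c *: y ^+ k)%R < size x)%N.
  apply: size_sub_lead => //.
    rewrite size_scale // -(prednK (n := size (y ^+ k))) ?size_poly_gt0 ?expf_neq0 //.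
    by rewrite size_exp sa sb /= mulnC divnK.
  by rewrite lead_coefZ lead_coef_exp /c divfK // expf_neq0.
have [||P [x' [e lt' ne']]] := IH (x - c *: y ^+ k).
- by rewrite -ltnS (leq_trans lt).
- have -> : c *: y ^+ k = (c *: 'X^k) \Po y by rewrite comp_polyZ comp_Xn_poly.
  exact/coordinate_curve_swap/coordinate_curve_step.
exists (c *: 'X^k + P), x'; split=> //.
rewrite comp_polyD comp_polyZ comp_Xn_poly -addrA -e; ring.
Qed.

(** The first two terms of the sequence p_{k-1} = p_{k+1} + P_k(p_k) that ends with
    p_h = t and p_{h+1} = 0. *)
Definition chain_curve Ps : {poly K} * {poly K} :=
  foldr (fun P ab => (ab.2 + (P \Po ab.1), ab.1)) ('X, 0) Ps.

Definition chain_degrees Ps := [seq (size P).-1 | P <- Ps].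
Definition nonlinear := all (fun P : {poly K} => 2 < size P)%N.
Definition chain_degree Ps := (\prod_(d <- chain_degrees Ps) d)%N.

Lemma chain_degree_cons P Ps : chain_degree (P :: Ps) = ((size P).-1 * chain_degree Ps)%N.
Proof. by rewrite /chain_degree /= big_cons. Qed.

(** Iterated [coordinate_curve_reduce]. The process stops at (L, 0), and L is linear
    since it generates K[t]. *)
Lemma coordinate_curve_chain n x y : (size x <= n)%N -> coordinate_curve x y ->
  (size y < size x)%N -> size y != 1%N ->
  exists Ps L, [/\ nonlinear Ps, size L = 2%N, x = (chain_curve Ps).1 \Po L & y = (chain_curve Ps).2 \Po L].
Proof.
elim: n x y => [|n IH] x y sx cc lt ne1; first by rewrite ltnNge (leq_trans sx) in lt.
have [e0|ne0] := eqVneq (size y) 0%N.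
  have y0 : y = 0 by apply/eqP; rewrite -size_poly_eq0 e0.
  exists [::], x; rewrite /= comp_polyX comp_poly0; split=> //.
  case: cc => f [g [p [q [inv ex ey]]]].
  have := curve_second inv; rewrite ex ey y0 => e.
  have := curve_ev_comp 'X 0 x g; rewrite comp_polyX comp_poly0 e.
  move=> /(congr1 (fun P : {poly K} => (size P).-1)); rewrite size_comp_poly size_polyX.
  move=> /= /eqP; rewrite muln_eq1 => /andP[_ /eqP e2].
  by rewrite -(prednK (n := size x)) ?e2 // (leq_ltn_trans _ lt).
have sy : (1 < size y)%N by case: (size y) ne0 ne1 => [|[]].
have [P [x' [e lt' ne']]] := coordinate_curve_reduce sx cc sy.
have [||Ps [L [nl sL ey ex']]] := IH y x' _ _ lt' ne'.
- by rewrite -ltnS (leq_trans lt).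
- have -> : x' = x - (P \Po y) by rewrite e addrC addKr.
  exact: coordinate_curve_step.
exists (P :: Ps), L; split=> //=; last first.
  by rewrite comp_polyD -comp_polyA -ey -ex' addrC.
rewrite nl andbT; have := size_comp_poly P y.
have <- : size x = size (P \Po y).
  rewrite e size_addl //; apply: (leq_trans lt'); rewrite leqNgt; apply/negP => lt2.
  have := size_polyD (P \Po y) x'; rewrite -e => /(leq_trans lt).
  by rewrite leq_max !ltnNge (ltnW lt2) (ltnW lt').
have : ((size y).-1 < (size x).-1)%N by move: sy lt; case: (size y); case: (size x).
move=> /[swap] ->; case: (size P) => [|[|[|]]] //=; rewrite ?mul0n ?mul1n ?ltnn ?ltn0 //.
Qed.

Lemma size_chain_curve Ps : nonlinear Ps ->
  [/\ (0 < chain_degree Ps)%N, size (chain_curve Ps).1 = (chain_degree Ps).+1, (size (chain_curve Ps).2 <= chain_degree Ps)%N &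
     forall P, size (chain_curve (P :: Ps)).2 = (chain_degree Ps).+1].
Proof.
elim: Ps => [_|P Ps IH] /=; first by rewrite /chain_degree /= big_nil size_polyX size_poly0.
case/andP=> sP /IH[d0 s1 s2 _].
have sP' : size (P \Po (chain_curve Ps).1) = ((size P).-1 * chain_degree Ps).+1.
  rewrite -(prednK (n := size (P \Po _))) ?size_comp_poly ?s1 //.
  rewrite size_poly_gt0 comp_poly_eq0 ?s1 // -size_poly_gt0.
  exact: leq_trans sP.
have p2 : (1 < (size P).-1)%N by rewrite -ltnS prednK // ltnW // ltnW.
rewrite chain_degree_cons muln_gt0 d0 (ltnW p2) s1 addrC size_addl sP'; last first.
  by rewrite ltnS (leq_trans s2) // leq_pmull // ltnW.
split=> //; first by rewrite -[X in (X < _)%N]mul1n ltn_pmul2r.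
Qed.

End Chain.

(** * Key polynomials along a chain *)

Lemma gt2E n : (2 < n)%N -> exists e, n = e.+3.
Proof. by case: n => [|[|[|e]]] // _; exists e. Qed.

Section TopForms.
Variable K : fieldType.
Notation P2 := {mpoly K[2]}.
Implicit Types (f g h p q u w l : P2) (P x y L : {poly K}) (Ps : seq {poly K}).

Lemma msizeM_leq p q a b : (msize p <= a)%N -> (msize q <= b.+1)%N ->
  (msize (p * q) <= a + b)%N.
Proof.
have [->|nzp] := eqVneq p 0; first by rewrite mul0r mmeasure0.
have [->|nzq] := eqVneq q 0; first by rewrite mulr0 mmeasure0.
by rewrite msizeM //; move: (msize p) (msize q) => s s'; lia.
Qed.

Lemma msizeX_leq p a k : (msize p <= a.+1)%N -> (msize (p ^+ k) <= (k * a).+1)%N.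
Proof.
move=> le; elim: k => [|k IH]; first by rewrite expr0 msize1.
by rewrite exprS mulSn; exact: msizeM_leq le IH.
Qed.

Lemma msizeD_leq p q a : (msize p <= a)%N -> (msize q <= a)%N -> (msize (p + q) <= a)%N.
Proof.
by move=> le1 le2; apply: leq_trans (mmeasureD_le _ _ _) _; rewrite geq_max le1.
Qed.

Lemma msizeN_leq p a : (msize p <= a)%N -> (msize (- p) <= a)%N.
Proof. by rewrite mmeasureN. Qed.

Variable l : P2.
Hypothesis sl : (msize l <= 2)%N.

(** h has degree N, and its form of degree N is a nonzero multiple of l^N. *)
Definition top N h := exists2 k, k != 0 & (msize (h - k *: l ^+ N) <= N)%N.

Lemma msize_topform N k : (msize (k *: l ^+ N) <= N.+1)%N.
Proof. by apply: leq_trans (msizeZ_le _ _) _; have := msizeX_leq N sl; rewrite muln1. Qed.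

Lemma top_msize N h : top N h -> (msize h <= N.+1)%N.
Proof.
case=> k nz le; rewrite -(subrK (k *: l ^+ N) h).
by apply: msizeD_leq; [apply: leqW | apply: msize_topform].
Qed.

Lemma top1 : top 0 1.
Proof. by exists 1; rewrite ?oner_neq0 // expr0 scale1r subrr mmeasure0. Qed.

Lemma topM N N' h h' : top N h -> top N' h' -> top (N + N') (h * h').
Proof.
move=> t t'; have s' := top_msize t'; case: t => k nz le; case: t' => k' nz' le'.
exists (k * k'); first by rewrite mulf_neq0.
have -> : h * h' - (k * k') *: l ^+ (N + N') =
   (h - k *: l ^+ N) * h' + (h' - k' *: l ^+ N') * (k *: l ^+ N).
  by rewrite -!mul_mpolyC mpolyCM exprD; ring.
apply: msizeD_leq; first exact: msizeM_leq le s'.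
by rewrite addnC; apply: msizeM_leq le' (msize_topform _ _).
Qed.

Lemma topX N h e : top N h -> top (e * N) (h ^+ e).
Proof.
by move=> t; elim: e => [|e IH]; [exact: top1 | rewrite exprS mulSn; exact: topM].
Qed.

Lemma topD N h h' : top N h -> (msize h' <= N)%N -> top N (h + h').
Proof.
case=> k nz le le'; exists k => //; rewrite addrAC; exact: msizeD_leq.
Qed.

Lemma topZ N h c : c != 0 -> top N h -> top N (c *: h).
Proof.
move=> nzc [k nz le]; exists (c * k); first by rewrite mulf_neq0.
by rewrite -scalerA -scalerBr; apply: leq_trans (msizeZ_le _ _) le.
Qed.

Lemma pevE P w : pev P w = \sum_(i < size P) P`_i *: w ^+ i.
Proof.
rewrite /pev (horner_coef_wide _ (size_poly _ _)); apply: eq_bigr => i _.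
by rewrite coef_map /= mul_mpolyC.
Qed.

Lemma top_step N e u w P : (0 < N)%N -> size P = e.+2 -> (msize u <= N.+1)%N ->
  top N w -> (0 < e)%N -> top (N * e.+1) (u - pev P w).
Proof.
move=> N0 sP su t e0; have sw := top_msize t.
rewrite pevE sP big_ord_recr /= opprD addrA addrC mulnC.
apply: topD.
  rewrite -scaleNr; apply: topZ; last exact: topX.
  by rewrite oppr_eq0; have := lead_coef_eq0 P; rewrite lead_coefE sP /= => ->; rewrite -size_poly_gt0 sP.
apply: msizeD_leq; first by apply: leq_trans su _; nia.
apply: msizeN_leq; apply: (big_ind (fun h => msize h <= e.+1 * N)%N) => [|h h'|i _].
- by rewrite mmeasure0.
- exact: msizeD_leq.
apply: leq_trans (msizeZ_le _ _) _; apply: leq_trans (msizeX_leq i sw) _.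
have : (i * N <= e * N)%N by rewrite leq_mul2r -ltnS ltn_ord orbT.
by rewrite mulSn; lia.
Qed.

(** Starting from (u, w), each P of the chain is used to eliminate the first
    polynomial of the pair; if (u, w) restrict to [chain_curve Ps], the last pair
    restricts to (t, 0). *)
Definition chain_end Ps u w : P2 * P2 := foldl (fun ab P => (ab.2, ab.1 - pev P ab.2)) (u, w) Ps.

Lemma chain_end_pair Ps u w p q : inverse_pair u w p q ->
  exists p' q', inverse_pair (chain_end Ps u w).1 (chain_end Ps u w).2 p' q'.
Proof.
rewrite /chain_end; elim: Ps u w p q => [|P Ps IH] u w p q inv; first by exists p, q.
by have [p' [q' inv']] := step_pair P inv; exact: IH inv'.
Qed.

Variables x y : {poly K}.

Lemma chain_end_curve Ps u w : curve_ev x y u = (chain_curve Ps).1 -> curve_ev x y w = (chain_curve Ps).2 ->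
  curve_ev x y (chain_end Ps u w).1 = 'X /\ curve_ev x y (chain_end Ps u w).2 = 0.
Proof.
rewrite /chain_end; elim: Ps u w => [|P Ps IH] u w //= eu ew.
by apply: IH => //; rewrite rmorphB /= curve_ev_pev eu ew addrK.
Qed.

Lemma chain_end_top Ps u w N : nonlinear Ps -> (0 < N)%N -> (msize u <= N.+1)%N -> top N w ->
  top (N * chain_degree Ps) (chain_end Ps u w).2.
Proof.
rewrite /chain_end; elim: Ps u w N => [|P Ps IH] u w N /= nl N0 su t.
  by rewrite /chain_degree /= big_nil muln1.
case/andP: nl => sP nl; have [e se] := gt2E sP.
rewrite chain_degree_cons mulnA se /=; apply: IH => //.
- by rewrite muln_gt0 N0.
- apply: leq_trans (top_msize t) _; rewrite ltnS -{1}[N]muln1 leq_mul2l; lia.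
- exact: top_step se su t _.
Qed.

(** The generators r_k come from the intermediate polynomials of the chain: such a
    polynomial of degree N' that restricts to degree d on the curve will have
    intersection number n N' - d with the branch at infinity. *)
Lemma chain_end_keys Ps u w N n r : nonlinear Ps -> (0 < N)%N -> (msize u <= N.+1)%N -> top N w ->
  n = (N * chain_degree Ps)%N ->
  curve_ev x y u = (chain_curve Ps).1 -> curve_ev x y w = (chain_curve Ps).2 ->
  r \in am_tail n N (chain_degrees Ps) ->
  exists N' d h, [/\ top N' h, size (curve_ev x y h) = d.+1, (d <= n * N')%N & r = (n * N' - d)%N].
Proof.
elim: Ps u w N => [//|P Ps IH] u w N /=; case/andP=> sP nl N0 su t en eu ew.
have [d0 _ _ /(_ P) sy] := size_chain_curve nl.
have [e se] := gt2E sP.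
rewrite inE => /orP[/eqP er|mem].
  exists N, (chain_degree Ps), w; split=> //; first by rewrite ew.
  rewrite en chain_degree_cons.
  have -> : (N * ((size P).-1 * chain_degree Ps) * N = chain_degree Ps * (N * (size P).-1 * N))%N by ring.
  by rewrite leq_pmulr // !muln_gt0 N0 se.

apply: (IH w (u - pev P w) (N * (size P).-1)%N) => //.
- by rewrite muln_gt0 N0 se.
- by apply: leq_trans (top_msize t) _; rewrite ltnS se /= -{1}[N]muln1 leq_mul2l; lia.
- by rewrite se; apply: top_step se su t _.
- by rewrite en chain_degree_cons mulnA.
- by rewrite rmorphB /= curve_ev_pev eu ew addrK.
Qed.

(** Polynomials of each degree j < N, with the expected top form, whose
    restrictions to the curve have distinct degrees smaller than n. The number
    n j - pi j is the intersection number with the branch at infinity, and it has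
    to lie in the semigroup Sg. *)
Definition good_family n (Sg : nat -> Prop) N (d : nat) (G : nat -> P2) (pi : nat -> nat) :=
  (forall j, (j < N)%N -> [/\ top j (G j), size (curve_ev x y (G j)) = (pi j).+1,
     (d %| pi j)%N, (pi j < n)%N /\ (pi j <= n * j)%N & Sg (n * j - pi j)%N]) /\
  (forall i j, (i < N)%N -> (j < N)%N -> pi i = pi j -> i = j).

(** Multiplying by w^i with i < e refines a family of size N into one of size N e:
    the degrees pi are multiples of e d, while w contributes i d. *)
Lemma family_step n Sg N d e w G pi :
  (forall a b, Sg a -> Sg b -> Sg (a + b)%N) ->
  (0 < N)%N -> (0 < d)%N -> (0 < e)%N -> n = (N * (e * d))%N ->
  top N w -> size (curve_ev x y w) = d.+1 -> Sg 0%N -> Sg (n * N - d)%N ->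
  good_family n Sg N (e * d) G pi ->
  good_family n Sg (N * e) d (fun j => G (j %% N)%N * w ^+ (j %/ N)%N)
     (fun j => pi (j %% N) + (j %/ N) * d)%N.
Proof.
move=> SgD N0 d0 e0 en tw sw Sg0 Sgr [fam inj]; split=> [j ltj|i j lti ltj].
  have [t s dv [ltn len] sg] := fam _ (ltn_pmod j N0).
  have lta : (j %/ N < e)%N by rewrite ltn_divLR // mulnC.
  have led : (d <= n * N)%N.
    have -> : (n * N = d * (N * e * N))%N by rewrite en; ring.
    by rewrite leq_pmulr // !muln_gt0 N0 e0.
  split.
  - rewrite {1}(divn_eq j N) addnC; apply: topM => //; exact: topX.
  - rewrite rmorphM rmorphXn /= size_mul ?expf_neq0 -?size_poly_gt0 ?s ?sw //.
    rewrite -(prednK (n := size (curve_ev x y w ^+ (j %/ N)%N))); last by rewrite size_poly_gt0 expf_neq0 // -size_poly_gt0 sw.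
    by rewrite size_exp sw /= addnS mulnC.
  - rewrite dvdn_add ?dvdn_mull // (dvdn_trans _ dv) // dvdn_mull //.
  - split.
      have /dvdnP[m em] := dv; rewrite em.
      have : (m < N)%N by move: ltn; rewrite em en ltn_pmul2r // muln_gt0 e0.
      rewrite en => ltm; apply: (@leq_trans (m.+1 * (e * d))); last by rewrite leq_mul2r ltm orbT.
      by rewrite mulSn addnC ltn_add2r ltn_pmul2r.
    rewrite [in X in (_ <= X)%N](divn_eq j N) mulnDr addnC leq_add //.
    by rewrite mulnCA leq_mul2l led orbT.
  - have -> : (n * j - (pi (j %% N) + j %/ N * d) =
       (n * (j %% N) - pi (j %% N)) + j %/ N * (n * N - d))%N.
      have -> : (n * j = j %/ N * (n * N) + n * (j %% N))%N.
        by rewrite {1}(divn_eq j N) mulnDr mulnCA.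
      have h1 : (j %/ N * d <= j %/ N * (n * N))%N by rewrite leq_mul2l led orbT.
      rewrite mulnBr; move: h1 len; move: (j %/ N * d)%N (j %/ N * _)%N (n * _)%N (pi _).
      by move=> t1 t2 t3 t4; lia.
    apply: (SgD) => //; elim: (j %/ N)%N => [|a IH]; first by rewrite mul0n.
    by rewrite mulSn; apply: SgD.
have [_ _ dvi [] _ _ _] := fam _ (ltn_pmod i N0).
have [_ _ dvj [] _ _ _] := fam _ (ltn_pmod j N0).
have /dvdnP[mi emi] := dvi; have /dvdnP[mj emj] := dvj.
have lti' : (i %/ N < e)%N by rewrite ltn_divLR // mulnC.
have ltj' : (j %/ N < e)%N by rewrite ltn_divLR // mulnC.
rewrite emi emj !mulnA -!mulnDl => /eqP; rewrite eqn_pmul2r // => /eqP eq.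
have e1 : (i %/ N = j %/ N)%N.
  by have := congr1 (modn^~ e) eq; rewrite !modnMDl !modn_small.
have e2 : mi = mj.
  by move: eq; rewrite e1 => /addIn/eqP; rewrite eqn_pmul2r // => /eqP.
rewrite (divn_eq i N) (divn_eq j N) e1; congr (_ + _)%N.
by apply: inj; rewrite ?ltn_pmod // emi emj e2.
Qed.

Lemma chain_end_family Ps u w N n Sg G pi :
  (forall a b, Sg a -> Sg b -> Sg (a + b)%N) -> Sg 0%N ->
  nonlinear Ps -> (0 < N)%N -> (msize u <= N.+1)%N -> top N w ->
  n = (N * chain_degree Ps)%N ->
  curve_ev x y u = (chain_curve Ps).1 -> curve_ev x y w = (chain_curve Ps).2 ->
  (forall r, r \in am_tail n N (chain_degrees Ps) -> Sg r) ->
  good_family n Sg N (chain_degree Ps) G pi ->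
  exists G' pi', good_family n Sg n 1 G' pi'.
Proof.
move=> SgD Sg0; elim: Ps u w N G pi => [|P Ps IH] u w N G pi.
  by rewrite /chain_degree /= big_nil muln1 => _ _ _ _ -> _ _ _ fam; exists G, pi.
rewrite /= => /andP[sP nl] N0 su t en eu ew mem fam.
have [d0 _ _ /(_ P) sy] := size_chain_curve nl.
have [e se] := gt2E sP.
apply: (IH w (u - pev P w) (N * (size P).-1)%N) => //; first 5 last.
- by move=> r mr; apply: mem; rewrite inE mr orbT.
- rewrite chain_degree_cons in fam; apply: (family_step (w := w)) fam => //.
  + by rewrite se.
  + by rewrite en chain_degree_cons.
  + by rewrite ew.
  + by apply: mem; rewrite inE eqxx.
- by rewrite muln_gt0 N0 se.
- by apply: leq_trans (top_msize t) _; rewrite ltnS se /= -{1}[N]muln1 leq_mul2l; lia.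
- by rewrite se; apply: top_step se su t _.
- by rewrite en chain_degree_cons mulnA.
- by rewrite rmorphB /= curve_ev_pev eu ew addrK.
Qed.

End TopForms.

(** * Power series *)

Section SeriesOfPolynomials.
Variables (n : nat) (R : comNzRingType).
Implicit Types (f g h : mfps n R) (m : 'X_{1..n}) (p q : {mpoly R[n]}).

(** [mfps_of_mpoly], renamed in order to carry the structure of a ring morphism. *)
Definition pol : {mpoly R[n]} -> mfps n R := @mfps_of_mpoly n R.

Fact pol_is_zmod_morphism : zmod_morphism pol.
Proof. by move=> p q; apply/mfpsP => m; rewrite /= mcoeffB. Qed.
Fact pol_is_monoid_morphism : monoid_morphism pol.
Proof.
split; first by apply/mfpsP => m /=; rewrite mcoeff1.
by move=> p q; apply/mfpsP => m; rewrite /= mcoeffM.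
Qed.
HB.instance Definition _ := GRing.isZmodMorphism.Build _ _ pol pol_is_zmod_morphism.
HB.instance Definition _ := GRing.isMonoidMorphism.Build _ _ pol pol_is_monoid_morphism.

Definition cst (c : R) : mfps n R := pol c%:MP.
HB.instance Definition _ := GRing.RMorphism.copy cst (pol \o @mpolyC n R).

Lemma psD f g m : mfps_coef (f + g) m = mfps_coef f m + mfps_coef g m.
Proof. by []. Qed.
Lemma psB f g m : mfps_coef (f - g) m = mfps_coef f m - mfps_coef g m.
Proof. by []. Qed.
Lemma psM f g m : mfps_coef (f * g) m =
  \sum_(k : 'X_{1..n < (mdeg m).+1, (mdeg m).+1} | m == (k.1 + k.2)%MM)
     mfps_coef f k.1 * mfps_coef g k.2.
Proof. by []. Qed.
Lemma coef_pol p m : mfps_coef (pol p) m = p@_m. Proof. by []. Qed.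
Lemma coef_cst c m : mfps_coef (cst c) m = c * (m == 0%MM)%:R.
Proof. by rewrite coef_pol mcoeffC. Qed.

Lemma psXM i f m : mfps_coef (pol 'X_i * f) m =
  if m i == 0%N then 0 else mfps_coef f (m - U_(i))%MM.
Proof.
case: eqP => [m0|/eqP nz].
  rewrite psM big1 // => k /eqP e; rewrite coef_pol mcoeffX; case: eqP => [e1|_].
    by have := congr1 (fun M : 'X_{1..n} => M i) e; rewrite /= m0 mnmDE -e1 mnm1E eqxx.
  by rewrite mul0r.
have e : m = ((m - U_(i)) + U_(i))%MM by rewrite submK // lep1mP.
have lt : (mdeg (m - U_(i))%MM < (mdeg m).+1)%N by rewrite ltnS {2}e mdegD leq_addr.
have lt1 : (mdeg (U_(i)%MM : 'X_{1..n}) < (mdeg m).+1)%N.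
  by rewrite ltnS {1}e mdegD leq_addl.
rewrite psM (bigD1 (BMultinom lt1, BMultinom lt)) /=; last by rewrite addmC -e.
rewrite mcoeffX eqxx mul1r big1 ?addr0 // => -[k1 k2] /= /andP[/eqP ek ne].
rewrite mcoeffX; case: eqP => [e1|_]; last by rewrite mul0r.
case/eqP: ne; congr (_, _); apply: val_inj => //=.
by have := congr1 (fun M : 'X_{1..n} => (M - U_(i))%MM) ek; rewrite -e1 addmC addmK.
Qed.

(** Total order at least d. *)
Definition vo d f := forall m, (mdeg m < d)%N -> mfps_coef f m = 0.

Lemma voM d e f g : vo d f -> vo e g -> vo (d + e) (f * g).
Proof.
move=> vf vg m lt; rewrite psM; apply: big1 => k /eqP em.
have lt' : (mdeg k.1 + mdeg k.2 < d + e)%N by rewrite -mdegD -em.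
have [lt1|le1] := ltnP (mdeg k.1) d; first by rewrite vf ?mul0r.
rewrite vg ?mulr0 // ltnNge; apply/negP => le2.
by have := leq_add le1 le2; rewrite leqNgt lt'.
Qed.

Lemma vo0 f : vo 0 f. Proof. by []. Qed.

Lemma voX f k : vo 1 f -> vo k (f ^+ k).
Proof.
by move=> v; elim: k => [|k IH]; [exact: vo0 | rewrite exprS -add1n; exact: voM].
Qed.

End SeriesOfPolynomials.

Section LastVariable.
Variables (n : nat) (R : comNzRingType).
Notation V := (mfps n.+1 R).
Notation imax := (ord_max : 'I_n.+1).
Implicit Types (f g h x y : V) (m : 'X_{1..n.+1}) (w : nat -> V).

(** In K[[u, v]] this is v; in K[[t]] it is the parameter t. *)
Definition vv : V := pol 'X_imax.

Lemma coef_vM f m : mfps_coef (vv * f) m =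
  if m imax == 0%N then 0 else mfps_coef f (m - U_(imax))%MM.
Proof. exact: psXM. Qed.

Lemma coef_vMD f m : mfps_coef (vv * f) (m + U_(imax))%MM = mfps_coef f m.
Proof. by rewrite coef_vM mnmDE mnm1E eqxx addn1 /= addmK. Qed.

Lemma coef_vXM k f m : (m imax < k)%N -> mfps_coef (vv ^+ k * f) m = 0.
Proof.
elim: k m => [//|k IH] m ltm; rewrite exprS -mulrA coef_vM.
case: eqP => // nz; apply: IH; rewrite mnmBE mnm1E eqxx; lia.
Qed.

Lemma v_separated x : (forall k, exists y, x = vv ^+ k * y) -> x = 0.
Proof.
move=> H; apply/mfpsP => m; have [y ->] := H (m imax).+1.
by rewrite coef_vXM.
Qed.

Lemma v_regular x : vv * x = 0 -> x = 0.
Proof. by move=> e; apply/mfpsP => m; rewrite -coef_vMD e. Qed.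

Lemma vX_regular k x : vv ^+ k * x = 0 -> x = 0.
Proof. by elim: k => [|k IH]; rewrite ?expr0 ?mul1r // exprS -mulrA => /v_regular. Qed.

Lemma v_divides x : (forall m, m imax = 0%N -> mfps_coef x m = 0) -> exists y, x = vv * y.
Proof.
move=> H; exists (Mfps (fun m => mfps_coef x (m + U_(imax))%MM)).
apply/mfpsP => m; rewrite coef_vM; case: eqP => [/H //|/eqP nz] /=.
by rewrite submK // lep1mP.
Qed.

(** The series sum_i w_i v^i, for arbitrary coefficients w_i. *)
Definition vsum w : V := Mfps (fun m =>
  \sum_(i < (m imax).+1) mfps_coef (w i) (m - U_(imax) *+ i)%MM).

Lemma vsumS w : vsum w = w 0%N + vv * vsum (w \o S).
Proof.
apply/mfpsP => m; rewrite psD coef_vM {1}/vsum /= big_ord_recl mulm0n subm0.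
congr (_ + _); case: eqP => [->|/eqP nz]; first by rewrite big_ord0.
rewrite mnmBE mnm1E eqxx subn1 prednK ?lt0n //; apply: eq_bigr => i _.
by congr mfps_coef; rewrite submDA mulmS.
Qed.

(** Successive approximation: if each x of X is an element of A plus v times an
    element of X, then x is the v-adic sum of a sequence of elements of A. *)
Lemma v_closed (A J X : V -> Prop) :
  (forall w, (forall i, A (w i)) -> J (vsum w)) ->
  (forall x, X x -> exists a x', [/\ A a, X x' & x = a + vv * x']) ->
  forall x, X x -> J x.
Proof.
move=> AJ step x Xx.
have {}step (z : {z | X z}) : exists y : V * {z | X z},
   A y.1 /\ sval z = y.1 + vv * sval y.2.
  case: z => z Xz; have [a [x' [Aa Xx' e]]] := step z Xz.
  by exists (a, exist _ x' Xx').
have [F FP] := choice step.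
pose s := fix s i := if i is i'.+1 then (F (s i')).2 else exist _ x Xx.
pose a i := (F (s i)).1.
have key i : sval (s i) - vsum (fun j => a (i + j)%N) =
   vv * (sval (s i.+1) - vsum (fun j => a (i.+1 + j)%N)).
  have [_ ->] := FP (s i); rewrite vsumS addn0 -/(a i).
  have -> : vsum ((fun j => a (i + j)%N) \o S) = vsum (fun j => a (i.+1 + j)%N).
    by congr vsum; apply/funext => j /=; rewrite addnS addSn.
  by rewrite /=; ring.
suff /eqP : x - vsum a = 0.
  by rewrite subr_eq0 => /eqP ->; apply: AJ => i; have [] := FP (s i).
apply: v_separated => k; exists (sval (s k) - vsum (fun j => a (k + j)%N)).
elim: k => [|k IH]; first by rewrite expr0 mul1r.
by rewrite IH key exprSr mulrA.
Qed.

Lemma vsumM w f : vsum w * f = vsum (fun i => w i * f).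
Proof.
apply/eqP; rewrite -subr_eq0; apply/eqP; apply: v_separated => k.
exists (vsum (fun i => w (k + i)%N) * f - vsum (fun i => w (k + i)%N * f)).
elim: k => [|k ->]; first by rewrite expr0 mul1r.
rewrite [vsum (fun i => w (k + i)%N)]vsumS [vsum (fun i => w (k + i)%N * f)]vsumS addn0.
have -> : vsum ((fun i => w (k + i)%N) \o S) = vsum (fun i => w (k.+1 + i)%N).
  by congr vsum; apply/funext => j /=; rewrite addnS addSn.
have -> : vsum ((fun i => w (k + i)%N * f) \o S) = vsum (fun i => w (k.+1 + i)%N * f).
  by congr vsum; apply/funext => j /=; rewrite addnS addSn.
by rewrite exprSr; ring.
Qed.

Lemma vsumD w w' : vsum (fun i => w i + w' i) = vsum w + vsum w'.
Proof.
apply/mfpsP => m; rewrite psD /= -big_split.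
by apply: eq_bigr.
Qed.

Lemma vsum_sum (I : finType) (w : I -> nat -> V) :
  vsum (fun i => \sum_j w j i) = \sum_j vsum (w j).
Proof.
have H (r : seq I) : vsum (fun i => \sum_(j <- r) w j i) = \sum_(j <- r) vsum (w j).
  elim: r => [|j r IH].
    rewrite big_nil; apply/mfpsP => m /=; apply: big1 => i _.
    by rewrite big_nil.
  rewrite big_cons -IH -vsumD; congr vsum; apply/funext => i.
  by rewrite big_cons.
exact: H.
Qed.
End LastVariable.
Arguments vv {n R}.

Section UnitsAndVSeries.
Variables (n : nat) (K : fieldType).
Notation V := (mfps n.+1 K).
Implicit Types (c x y : V).

Lemma unit_series (k : K) x : k != 0 -> exists g, g * (cst _ k + vv * x) = 1.
Proof.
move=> nz; pose h := - (cst _ k^-1 * x).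
have e : vsum (fun i => h ^+ i) = 1 + vv * (vsum (fun i => h ^+ i) * h).
  rewrite vsumM {1}vsumS expr0; congr (_ + _ * vsum _).
  by apply/funext => i /=; rewrite exprSr.
exists (cst _ k^-1 * vsum (fun i => h ^+ i)).
have -> : cst n.+1 k + vv * x = cst _ k * (1 - vv * h).
  by rewrite /h mulrN opprK mulrDr mulr1 mulrCA [cst _ k * _]mulrA -rmorphM mulfV // rmorph1 mul1r.
rewrite mulrACA -rmorphM mulVf // rmorph1 mul1r mulrBr mulr1 {1}e.
by rewrite [_ * (vv * h)]mulrCA addrK.
Qed.
End UnitsAndVSeries.

(** * Orders and substitutions of power series in one variable *)

Section Orders.
Variable K : fieldType.
Notation T := (mfps 1 K).
Implicit Types (f g h : T).
Notation c1 := (@cst 1 K).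

Definition ordge N f := exists g, f = vv ^+ N * g.
(** The order of f is N. A leading coefficient and a cofactor are kept explicit, so
    that orders are handled by identities in the ring. *)
Definition is_ord f N := exists c g, c != 0 /\ f = vv ^+ N * (c1 c + vv * g).

Lemma decomp1 f : exists c g, f = c1 c + vv * g.
Proof.
have [m|g e] := @v_divides 0 K (f - c1 (mfps_coef f 0%MM)).
  move=> m0; have -> : m = 0%MM.
    by apply/mnmP => k; rewrite mnm0E -[RHS]m0 (ord1 k) (ord1 ord_max).
  by rewrite psB coef_cst eqxx mulr1 subrr.
by exists (mfps_coef f 0%MM), g; rewrite -e addrC subrK.
Qed.

Lemma cst_vM_eq c x y : c1 c + vv * x = vv * y -> c = 0.
Proof.
move=> /(congr1 (fun z : T => mfps_coef z 0%MM)); rewrite psD !coef_vM coef_cst.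
by rewrite mnm0E eqxx addr0 eqxx mulr1.
Qed.

Lemma ordgeS N f : ordge N f -> is_ord f N \/ ordge N.+1 f.
Proof.
case=> g ->; have [c [h ->]] := decomp1 g.
have [->|nz] := eqVneq c 0; last by left; exists c, h.
by right; exists h; rewrite rmorph0 add0r mulrA -exprSr.
Qed.

Lemma is_ord_ordge f N M : is_ord f N -> ordge M f -> (M <= N)%N.
Proof.
case=> c [g [nz ->]] [h e]; rewrite leqNgt; apply/negP => lt.
have e0 : vv ^+ N * ((c1 c + vv * g) - vv * (vv ^+ (M - N.+1) * h)) = 0.
  rewrite mulrBr e; apply/eqP; rewrite subr_eq0 !mulrA -exprSr -exprD.
  by rewrite subnKC.
by move: nz; rewrite (cst_vM_eq (subr0_eq (vX_regular e0))) eqxx.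
Qed.

Lemma is_ordW f N : is_ord f N -> ordge N f.
Proof. by case=> c [g [_ ->]]; eexists. Qed.

Lemma is_ord_uniq f N M : is_ord f N -> is_ord f M -> N = M.
Proof.
move=> o o'; apply/eqP; rewrite eqn_leq.
by rewrite (is_ord_ordge o' (is_ordW o)) (is_ord_ordge o (is_ordW o')).
Qed.

Lemma ordge0 f : ordge 0 f. Proof. by exists f; rewrite expr0 mul1r. Qed.

Lemma ordge_leq M N f : (M <= N)%N -> ordge N f -> ordge M f.
Proof.
by move=> le [g ->]; exists (vv ^+ (N - M) * g); rewrite mulrA -exprD subnKC.
Qed.

Lemma ordgeD N f g : ordge N f -> ordge N g -> ordge N (f + g).
Proof. by case=> f' -> [g' ->]; exists (f' + g'); rewrite mulrDr. Qed.

Lemma ordge_zero N : ordge N 0. Proof. by exists 0; rewrite mulr0. Qed.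

Lemma is_ord_neq0 f N : is_ord f N -> f <> 0.
Proof.
move=> o e; have := is_ord_ordge o; rewrite e => /(_ N.+1 (ordge_zero _)).
by rewrite ltnn.
Qed.

Lemma ord_dichotomy f : f = 0 \/ exists N, is_ord f N.
Proof.
have [[N o]|no] := pselect (exists N, is_ord f N); [by right; exists N | left].
have all N : ordge N f.
  elim: N => [|N IH]; first exact: ordge0.
  by case: (ordgeS IH) => // o; case: no; exists N.
exact: v_separated.
Qed.

Lemma is_ordM f g N M : is_ord f N -> is_ord g M -> is_ord (f * g) (N + M).
Proof.
case=> c [f' [nz ->]] [d [g' [nz' ->]]].
exists (c * d), (c1 c * g' + f' * (c1 d + vv * g')); split; first by rewrite mulf_neq0.
rewrite mulrACA -exprD rmorphM; ring.
Qed.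

Lemma is_ord_cst c : c != 0 -> is_ord (c1 c) 0.
Proof. by move=> nz; exists c, 0; rewrite expr0 mulr0 mul1r addr0. Qed.

Lemma is_ord_unit c g : c != 0 -> is_ord (c1 c + vv * g) 0.
Proof. by move=> nz; exists c, g; rewrite expr0 mul1r. Qed.

Lemma is_ordX f N k : is_ord f N -> is_ord (f ^+ k) (k * N).
Proof.
move=> o; elim: k => [|k IH]; last by rewrite exprS mulSn; apply: is_ordM.
by rewrite expr0 -(rmorph1 c1); apply: is_ord_cst; rewrite oner_eq0.
Qed.

Lemma is_ord_vvX N : is_ord (vv ^+ N) N.
Proof. by exists 1, 0; rewrite oner_eq0 rmorph1 mulr0 addr0 mulr1. Qed.

Lemma is_ordD f g N : is_ord f N -> ordge N.+1 g -> is_ord (f + g) N.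
Proof.
case=> c [f' [nz ->]] [g' ->]; exists c, (f' + g'); split=> //.
by rewrite exprSr; ring.
Qed.

Lemma same_ord f g N : ordge N f -> is_ord g N ->
  exists k, ordge N.+1 (f - c1 k * g) /\ (is_ord f N -> k != 0).
Proof.
case=> f' -> [d [g' [nzd ->]]]; have [c [f'' ->]] := decomp1 f'.
exists (c / d); split.
  exists (f'' - c1 (c / d) * g').
  have -> : c1 c = c1 (c / d) * c1 d by rewrite -rmorphM divfK.
  by rewrite exprSr; ring.
move=> o; rewrite mulf_eq0 negb_or invr_eq0 nzd andbT; apply/eqP => c0.
suff ge : ordge N.+1 (vv ^+ N * (c1 c + vv * f'')) by have := is_ord_ordge o ge; rewrite ltnn.
by exists f''; rewrite c0 rmorph0 add0r exprSr mulrA.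
Qed.

(** Terms of pairwise distinct orders do not cancel. *)
Lemma is_ord_sum (I : finType) (F : I -> T) (o : I -> nat) :
  (forall i, F i = 0 \/ is_ord (F i) (o i)) ->
  (forall i j, F i <> 0 -> F j <> 0 -> o i = o j -> i = j) ->
  (forall i, F i = 0) \/
  exists i, [/\ F i <> 0, is_ord (\sum_i F i) (o i) & forall j, F j <> 0 -> (o i <= o j)%N].
Proof.
move=> oF inj; have [[i0 nz]|no] := pselect (exists i, F i <> 0); last first.
  by left=> i; apply: contrapT => nz; apply: no; exists i.
right; have nz0 : F i0 != 0 by apply/eqP.
case: (@arg_minnP I i0 (fun i => F i != 0) o nz0) => i nzi mini.
exists i; split; [exact/eqP | | by move=> j /eqP nzj; exact: mini].
rewrite (bigD1 i) //=; apply: is_ordD.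
  by case: (oF i) => // e; rewrite e eqxx in nzi.
apply: (big_ind (ordge (o i).+1)) => [||j ne]; [exact: ordge_zero | exact: ordgeD |].
case: (oF j) => [->|oj]; first exact: ordge_zero.
have nzj : F j != 0 by apply/eqP; apply: is_ord_neq0 oj.
apply: ordge_leq (is_ordW oj); rewrite ltn_neqAle mini // andbT.
by apply: contraNneq ne => e; apply/eqP/inj => //; apply/eqP.
Qed.

End Orders.

Section Substitution.
Variable K : fieldType.
Variables a b : mfps 1 K.
Hypotheses (va : vo 1 a) (vb : vo 1 b).
Implicit Types (psi : mfps 2 K) (p : {mpoly K[2]}).

Definition evs : {mpoly K[2]} -> mfps 1 K := ev2 (@cst 1 K) a b.
HB.instance Definition _ := GRing.RMorphism.copy evs evs.

(** As a and b have no constant term, monomials of high degree go to series of high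
    order; this is what makes substitution of a series well defined. *)
Lemma evs_vo d p : (forall m, p@_m != 0 -> (d <= mdeg m)%N) -> vo d (evs p).
Proof.
move=> low; rewrite /evs ev2E => m lt; rewrite big_seq.
apply: (big_ind (fun f : mfps 1 K => mfps_coef f m = 0)) => [//|f g ef eg|k].
  by rewrite psD ef eg addr0.
rewrite mcoeff_msupp => /low le; have : vo (0 + (k ord0 + k ord_max))
    (@cst 1 K p@_k * (a ^+ k ord0 * b ^+ k ord_max)).
  by apply: voM; [exact: vo0 | apply: voM; apply: voX].
apply; rewrite add0n; apply: leq_trans lt _; apply: leq_trans le _.
by rewrite {1}(mnE k) mn_deg.
Qed.

(** The coefficient of total degree d depends on the terms of psi of degree at most
    d only, so it is read off a truncation of psi. *)
Definition subst psi : mfps 1 K :=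
  Mfps (fun m => mfps_coef (evs (mfps_trunc (mdeg m).+1 psi)) m).

Lemma substE psi p m : (forall k, (mdeg k <= mdeg m)%N -> p@_k = mfps_coef psi k) ->
  mfps_coef (subst psi) m = mfps_coef (evs p) m.
Proof.
move=> e; rewrite /subst /=; apply/eqP; rewrite -subr_eq0 -psB -rmorphB.
apply/eqP; apply: (@evs_vo (mdeg m).+1); last exact: ltnSn.
move=> k; apply: contraNT; rewrite -leqNgt => le.
by rewrite mcoeffB mcoeff_trunc // e // subrr.
Qed.

Lemma subst_pol p : subst (pol p) = evs p.
Proof. by apply/mfpsP => m; apply: substE. Qed.

Lemma evsB p q : evs (p - q) = evs p - evs q. Proof. exact: (rmorphB evs). Qed.
Lemma evsM p q : evs (p * q) = evs p * evs q. Proof. exact: (rmorphM evs). Qed.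

Lemma coef_subst_trunc psi (m k : 'X_{1..1}) : (mdeg k <= mdeg m)%N ->
  mfps_coef (subst psi) k = mfps_coef (evs (mfps_trunc (mdeg m).+1 psi)) k.
Proof.
move=> le; apply: substE => l le'; apply: mcoeff_trunc.
by rewrite ltnS (leq_trans le').
Qed.

Fact subst_is_zmod_morphism : zmod_morphism subst.
Proof.
move=> psi psi'; apply/mfpsP => m; set d := (mdeg m).+1.
have e : mfps_coef (subst (psi - psi')) m =
    mfps_coef (evs (mfps_trunc d psi - mfps_trunc d psi')) m.
  by apply: substE => k le; rewrite mcoeffB !mcoeff_trunc.
rewrite e evsB; exact: (f_equal2 (fun x y => x - y)
  (esym (coef_subst_trunc psi (leqnn (mdeg m))))
  (esym (coef_subst_trunc psi' (leqnn (mdeg m))))).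
Qed.

Fact subst_is_monoid_morphism : monoid_morphism subst.
Proof.
split; first by rewrite -[1 in LHS](rmorph1 (@pol 2 K)) subst_pol rmorph1.
move=> psi psi'; apply/mfpsP => m; set d := (mdeg m).+1.
have e : mfps_coef (subst (psi * psi')) m =
    mfps_coef (evs (mfps_trunc d psi * mfps_trunc d psi')) m.
  by apply: substE => k le; rewrite -mfps_mulE.
rewrite e evsM [LHS]psM [RHS]psM; apply: eq_bigr => k _.
have le1 : (mdeg k.1 <= mdeg m)%N by rewrite -ltnS bmdeg.
have le2 : (mdeg k.2 <= mdeg m)%N by rewrite -ltnS bmdeg.
exact: (f_equal2 (fun x y => x * y)
  (esym (coef_subst_trunc psi le1)) (esym (coef_subst_trunc psi' le2))).
Qed.

HB.instance Definition _ := GRing.isZmodMorphism.Build _ _ subst subst_is_zmod_morphism.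
HB.instance Definition _ := GRing.isMonoidMorphism.Build _ _ subst subst_is_monoid_morphism.

Definition substR : {rmorphism mfps 2 K -> mfps 1 K} := GRing.RMorphism.clone _ _ subst _.

Lemma subst_cst c : subst (@cst 2 K c) = @cst 1 K c.
Proof. by rewrite /cst subst_pol [LHS]ev2C. Qed.

End Substitution.

Lemma decomp2 (K : fieldType) (f : mfps 2 K) :
  exists c g h, f = @cst 2 K c + pol 'X_ord0 * g + vv * h.
Proof.
pose f0 : mfps 2 K := Mfps (fun m => if m ord_max == 0%N then mfps_coef f m else 0).
pose g : mfps 2 K := Mfps (fun m => if m ord_max == 0%N then mfps_coef f (m + U_(ord0))%MM else 0).
have [m m0|h eh] := @v_divides 1 K (f - f0); first by rewrite psB /= m0 eqxx subrr.
exists (mfps_coef f 0%MM), g, h; rewrite -eh.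
suff <- : f0 = @cst 2 K (mfps_coef f 0%MM) + pol 'X_ord0 * g by rewrite addrC subrK.
apply/mfpsP => m; rewrite psD coef_cst psXM /= mnmBE mnm1E subn0.
case: (eqVneq (m ord_max) 0%N) => [m1|nz1]; last first.
  case: eqP => [e|_]; first by rewrite e mnm0E eqxx in nz1.
  by rewrite mulr0 add0r; case: ifP.
case: (eqVneq (m ord0) 0%N) => [m0|nz0].
  by rewrite (mnE m) m0 m1 (_ : mn 0 0 = 0%MM) ?eqxx ?mulr1 ?addr0 // [RHS]mnE !mnm0E.
rewrite submK ?lep1mP //; case: eqP => [e|_]; first by rewrite e mnm0E eqxx in nz0.
by rewrite mulr0 add0r.
Qed.

(** * The semigroup of a parametrized branch *)

(** Expressing two bases of the quotient in each other gives two matrices with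
    product 1. *)
Lemma has_codim_leq (K : fieldType) (V : lmodType K) (W : set V) m m' :
  W 0 -> (forall a x y, W x -> W y -> W (a *: x + y)) ->
  has_codim W m -> has_codim W m' -> (m <= m')%N.
Proof.
move=> W0 WD [e eP] [e' eP'].
have WZ a x : W x -> W (a *: x) by move=> Wx; rewrite -[a *: x]addr0; apply: WD.
have WA x y : W x -> W y -> W (x + y) by move=> Wx Wy; rewrite -[x]scale1r; apply: WD.
have Wsum (I : finType) (F : I -> V) : (forall i, W (F i)) -> W (\sum_i F i).
  by move=> WF; apply: (big_ind W).
have [A AP] := choice (fun i : 'I_m => eP' (e i)).
have [B BP] := choice (fun j : 'I_m' => eP (e' j)).
pose MA : 'M[K]_(m, m') := \matrix_(i, j) A i 0 j.
pose MB : 'M[K]_(m', m) := \matrix_(j, i) B j 0 i.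
apply: (@mulmx1_min K m m' MA MB).
apply/row_matrixP => i.
have [d [Wd uniq]] := eP (e i).
have -> : row i (MA *m MB) = d.
  apply/esym/uniq; have [Wi _] := AP i.
  have -> : e i - \sum_k row i (MA *m MB) 0 k *: e k =
     (e i - \sum_j A i 0 j *: e' j) + \sum_j A i 0 j *: (e' j - \sum_k B j 0 k *: e k).
    rewrite -addrA; congr (_ + _).
    under [X in _ = _ + X]eq_bigr => j _ do rewrite scalerBr.
    rewrite big_split /= addrA addNr add0r sumrN; congr (- _).
    under [in RHS]eq_bigr => j _ do rewrite scaler_sumr.
    rewrite exchange_big; apply: eq_bigr => k _ /=.
    rewrite mxE mxE scaler_suml; apply: eq_bigr => j _.
    by rewrite scalerA !mxE.
  by apply: WA => //; apply: Wsum => j; apply: WZ; have [] := BP j.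
apply: uniq; rewrite (bigD1 i) //= big1 ?addr0 => [|k ne]; last first.
  by rewrite !mxE eq_sym (negPf ne) scale0r.
by rewrite !mxE eqxx scale1r subrr.
Qed.

Lemma scale_cst (K : fieldType) n (c : K) (f : mfps n K) : c *: f = @cst n K c * f.
Proof.
apply/mfpsP => m; have lt := ltnSn (mdeg m).
rewrite [RHS](mfps_mulE _ _ lt) (@eq_mcoeffM _ _ _ _ c%:MP _ (mfps_trunc (mdeg m).+1 f) _ lt) //.
  by rewrite mcoeffCM mcoeff_trunc.
by move=> k ltk; rewrite mcoeff_trunc.
Qed.

Section Local.
Variable K : fieldType.
Notation V := (mfps 2 K).
Notation u := (pol 'X_(ord0 : 'I_2) : V).
Notation v := (vv : V).
Notation c2 := (@cst 2 K).
Variables (n : nat) (Phi : {rmorphism V -> mfps 1 K}).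
Hypothesis n0 : (0 < n)%N.
Hypothesis Phi_cst : forall c, Phi (c2 c) = @cst 1 K c.
Hypothesis Phi_v : is_ord (Phi v) n.

Definition monic_mod_v j (x : V) := exists k h, k != 0 /\ x = c2 k * u ^+ j + v * h.

Variable G0 : V.
Hypothesis G0_monic : monic_mod_v n G0.
Hypothesis Phi_G0 : Phi G0 = 0.
Variables (g : nat -> V) (s : nat -> nat).
Hypothesis g_monic : forall j, (j < n)%N -> monic_mod_v j (g j).
Hypothesis g_ord : forall j, (j < n)%N -> is_ord (Phi (g j)) (s j).
Hypothesis s_inj : forall i j, (i < n)%N -> (j < n)%N -> s i = s j %[mod n] -> i = j.
Implicit Types (x y psi : V).

Lemma u_expansion N x : exists (c : nat -> K) q y,
  x = \sum_(j < N) c2 (c j) * u ^+ j + u ^+ N * q + v * y.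
Proof.
elim: N => [|N [c [q [y ->]]]].
  by exists (fun=> 0), x, 0; rewrite big_ord0 expr0 mul1r mulr0 add0r addr0.
have [k [q' [y' ->]]] := decomp2 q.
exists (fun j => if (j < N)%N then c j else k), q', (y + u ^+ N * y').
rewrite big_ord_recr /= ltnn; have -> : \sum_(j < N) c2 (if (j < N)%N then c j else k) * u ^+ j =
   \sum_(j < N) c2 (c j) * u ^+ j by apply: eq_bigr => j _; rewrite ltn_ord.
by rewrite exprSr; ring.
Qed.

Lemma monic_solve j x : monic_mod_v j x -> exists a h, u ^+ j = c2 a * x + v * h.
Proof.
case=> k [h [nz ->]]; exists k^-1, (- (c2 k^-1 * h)).
have e : c2 k^-1 * c2 k = 1 by rewrite -rmorphM mulVf ?rmorph1.
by rewrite mulrDr mulrA e; ring.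
Qed.

Lemma weierstrass_step x : exists q (c : nat -> K) y,
  x = (q * G0 + \sum_(j < n) c2 (c j) * g j) + v * y.
Proof.
have [c [q [y ->]]] := u_expansion n x.
have [a0 [h0 ->]] := monic_solve G0_monic.
have [a aP] := choice (fun j : 'I_n => monic_solve (g_monic (ltn_ord j))).
have [h hP] := choice aP.
exists (c2 a0 * q), (fun j => if insub j is Some j' then c j * a j' else 0),
  (\sum_(j < n) c2 (c j) * h j + h0 * q + y).
have -> : \sum_(j < n) c2 (c j) * u ^+ j =
   \sum_(j < n) c2 (c j * a j) * g j + v * \sum_(j < n) c2 (c j) * h j.
  rewrite mulr_sumr -big_split; apply: eq_bigr => j _ /=.
  by rewrite hP rmorphM /=; ring.
have -> : \sum_(j < n) c2 (if insub (j : nat) is Some j' then c j * a j' else 0) * g j =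
   \sum_(j < n) c2 (c j * a j) * g j by apply: eq_bigr => j _; rewrite valK.
by ring.
Qed.

Definition vseries (c : V) := exists a : nat -> K, c = vsum (fun i => c2 (a i)).

(** Weierstrass division in the basis g_0, ..., g_{n-1} adapted to Phi: modulo v
    these are the powers of u below u^n, so each step is a division of polynomials
    in u, and [v_closed] iterates it. *)
Lemma weierstrass x : exists q (c : nat -> V),
  (forall j, vseries (c j)) /\ x = q * G0 + \sum_(j < n) c j * g j.
Proof.
pose A x := exists q (c : nat -> K), x = q * G0 + \sum_(j < n) c2 (c j) * g j.
pose J x := exists q (c : nat -> V),
  (forall j, vseries (c j)) /\ x = q * G0 + \sum_(j < n) c j * g j.
apply: (@v_closed 1 K A J (fun=> True)) => // [w /choice[q /choice[c cP]]|{}x _].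
  exists (vsum q), (fun j => vsum (fun i => c2 (c i j))); split.
    by move=> j; exists (fun i => c i j).
  rewrite vsumM; under [in RHS]eq_bigr => j _ do rewrite vsumM.
  rewrite -vsum_sum -vsumD; congr vsum; apply/funext => i; exact: cP.
have [q [c [y ->]]] := weierstrass_step x.
by exists (q * G0 + \sum_(j < n) c2 (c j) * g j), y; split=> //; exists q, c.
Qed.

(** The order of a series in v alone is a multiple of n = ord Phi(v). *)
Lemma vseries_order c : vseries c -> exists t,
  c = 0 \/ (exists c', c = v ^+ t * c') /\ is_ord (Phi c) (n * t).
Proof.
case=> a ->.
have shift i : (forall l, (l < i)%N -> a l = 0) ->
    vsum (fun l => c2 (a l)) = v ^+ i * vsum (fun l => c2 (a (i + l)%N)).
  elim: i => [_|i IH z]; first by rewrite expr0 mul1r.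
  rewrite IH => [|l lt]; last by apply: z; apply: ltnW.
  rewrite vsumS addn0 z // rmorph0 add0r mulrA -exprSr; congr (_ * vsum _).
  by apply/funext => l /=; rewrite addnS addSn.
have [[i nz]|no] := pselect (exists i, a i != 0); last first.
  exists 0%N; left; apply/mfpsP => m; apply: big1 => i _.
  rewrite coef_cst; suff -> : a i = 0 by rewrite mul0r.
  by apply/eqP; apply: contrapT => nz; apply: no; exists i; apply/negP.
have exa : exists i, a i != 0 by exists i.
case: (ex_minnP exa) => t nzt mint; exists t; right.
have zt l : (l < t)%N -> a l = 0.
  by move=> lt; apply/eqP; apply: contraTT lt => nzl; rewrite -leqNgt mint.
rewrite (shift t zt); split; first by eexists.
rewrite rmorphM rmorphXn -[(n * t)%N]addn0 mulnC; apply: is_ordM; first exact: is_ordX.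
rewrite vsumS addn0 rmorphD rmorphM /= Phi_cst; apply: is_ordD; first exact: is_ord_cst.
have [k [h [_ ->]]] := Phi_v; rewrite -mulrA; apply: (@ordge_leq _ _ n) => //.
by eexists.
Qed.

Lemma expansion x : exists q (c : nat -> V) (t : 'I_n -> nat),
  x = q * G0 + \sum_(j < n) c j * g j /\ forall j : 'I_n, c j = 0 \/
    (exists c', c j = v ^+ t j * c') /\ is_ord (Phi (c j * g j)) (n * t j + s j).
Proof.
have [q [c [cP ->]]] := weierstrass x.
have [t tP] := choice (fun j : 'I_n => vseries_order (cP j)).
exists q, c, t; split=> // j; case: (tP j) => [|[ex o]]; [by left | right].
by split=> //; rewrite rmorphM; apply: is_ordM o (g_ord _).
Qed.

(** The orders of Phi(c_j g_j) are congruent to s j modulo n, so they are distinct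
    and the order of the sum is the least of them. *)
Lemma expansion_orders (c : nat -> V) (t : 'I_n -> nat) :
  (forall j : 'I_n, c j = 0 \/
    (exists c', c j = v ^+ t j * c') /\ is_ord (Phi (c j * g j)) (n * t j + s j)) ->
  (forall j : 'I_n, c j = 0) \/
  exists j : 'I_n, is_ord (\sum_(j < n) Phi (c j * g j)) (n * t j + s j) /\
    forall i : 'I_n, c i <> 0 -> (n * t j + s j <= n * t i + s i)%N.
Proof.
move=> H; have [j|i j nzi nzj e|all0|[j [nzj oj minj]]] :=
  @is_ord_sum K 'I_n (fun j => Phi (c j * g j)) (fun j => n * t j + s j)%N.
- by case: (H j) => [->|[_]]; [left; rewrite mul0r rmorph0 | right].
- apply: val_inj; apply: (s_inj (ltn_ord i) (ltn_ord j)); have := congr1 (modn^~ n) e.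
  by rewrite /= ![(n * _)%N]mulnC !modnMDl.
- left=> j; case: (H j) => [//|[_ o]].
  by exfalso; exact: (is_ord_neq0 o (all0 j)).
right; exists j; split=> // i nzi; apply: minj.
by case: (H i) => // -[_ o]; apply: is_ord_neq0 o.
Qed.

Lemma Phi_sum q (c : nat -> V) :
  Phi (q * G0 + \sum_(j < n) c j * g j) = \sum_(j < n) Phi (c j * g j).
Proof. by rewrite rmorphD rmorphM Phi_G0 mulr0 add0r rmorph_sum. Qed.

(** In an expansion without cancellation, a zero sum has only zero terms. *)
Lemma kernel_Phi x : Phi x = 0 -> exists q, x = q * G0.
Proof.
have [q [c [t [-> H]]]] := expansion x; rewrite Phi_sum => e0.
have [all0|[j [o _]]] := expansion_orders H; last by case: (is_ord_neq0 o).
by exists q; rewrite big1 ?addr0 // => j _; rewrite all0 mul0r.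
Qed.

Lemma orders_Phi x m : is_ord (Phi x) m -> exists (j : 'I_n) t, m = (n * t + s j)%N.
Proof.
have [q [c [t [-> H]]]] := expansion x; rewrite Phi_sum => o.
have [all0|[j [o' _]]] := expansion_orders H; last by exists j, (t j); apply: is_ord_uniq o o'.
by case: (is_ord_neq0 o); apply: big1 => j _; rewrite all0 mul0r rmorph0.
Qed.

(** If Phi(x) has high order, every c_j has positive order in v. *)
Lemma high_order_divisible M x : (forall j, (j < n)%N -> (s j + n <= M)%N) ->
  ordge M (Phi x) -> exists q y, x = q * G0 + v * y.
Proof.
move=> sM; have [q [c [t [-> H]]]] := expansion x; rewrite Phi_sum => ge.
suff [y yP] : exists y : 'I_n -> V, forall j : 'I_n, c j * g j = v * y j.
  by exists q, (\sum_j y j); rewrite mulr_sumr; congr (_ + _); apply: eq_bigr => j _.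
suff H' (i : 'I_n) : exists y : V, c i * g i = v * y by have [y yP] := choice H'; exists y.
have [all0|[j [o minj]]] := expansion_orders H.
  by exists 0; rewrite all0 mul0r mulr0.
have [->|nz] := pselect (c i = 0); first by exists 0; rewrite mul0r mulr0.
case: (H i) => [//|[[c' ->] _]].
have le1 := leq_trans (is_ord_ordge o ge) (minj i nz).
have : (0 < t i)%N.
  have := leq_trans (sM i (ltn_ord i)) le1; case: (t i) => // .
  by rewrite muln0 add0n -{2}[s i]addn0 leq_add2l leqNgt n0.
case: (t i) => // t' _; exists (v ^+ t' * c' * g i).
by rewrite exprS !mulrA.
Qed.

Definition values m := exists x, is_ord (Phi x) m.

Lemma valuesD m m' : values m -> values m' -> values (m + m').
Proof. by case=> x ox [y oy]; exists (x * y); rewrite rmorphM; apply: is_ordM. Qed.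

Lemma values0 : values 0.
Proof.
by exists 1; rewrite rmorph1 -(rmorph1 (@cst 1 K)); apply: is_ord_cst; rewrite oner_eq0.
Qed.

Lemma valuesE m : values m <-> exists (j : 'I_n) t, m = (n * t + s j)%N.
Proof.
split=> [[x /orders_Phi]//|[j [t ->]]].
exists (v ^+ t * g j); rewrite rmorphM rmorphXn mulnC; apply: is_ordM (g_ord _) => //.
exact: is_ordX.
Qed.

Definition smax := (\max_(j < n) s j)%N.

Lemma s_le_smax j : (j < n)%N -> (s j <= smax)%N.
Proof. by move=> lt; rewrite /smax (leq_bigmax (Ordinal lt)). Qed.

(** The residues s j exhaust the classes modulo n. *)
Lemma values_large m : (smax <= m)%N -> values m.
Proof.
move=> le; pose f (j : 'I_n) : 'I_n := Ordinal (ltn_pmod (s j) n0).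
have fI : injective f.
  by move=> i j /(congr1 val) /= e; apply: val_inj; apply: (s_inj (ltn_ord i) (ltn_ord j)).
have /codomP[j /(congr1 val) /= ej] : Ordinal (ltn_pmod m n0) \in codom f.
  exact: injF_onto.
apply/valuesE; exists j, ((m - s j) %/ n)%N.
have lej := leq_trans (s_le_smax (ltn_ord j)) le.
rewrite mulnC divnK ?subnK //; rewrite -(eqn_mod_dvd n lej); exact/eqP.
Qed.

Section Intersection.
Variables (psi : V) (m0 : nat).
Hypothesis psi_ord : is_ord (Phi psi) m0.
Let J := ideal2 G0 psi.

Lemma ideal2D x y : J x -> J y -> J (x + y).
Proof.
by case=> a [b ->] [a' [b' ->]]; exists (a + a'), (b + b'); ring.
Qed.

Lemma ideal2M a x : J x -> J (a * x).
Proof. by case=> b [d ->]; exists (a * b), (a * d); ring. Qed.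

Lemma ideal2_psi a : J (a * psi).
Proof. by exists 0, a; rewrite mul0r add0r. Qed.

(** Any order from m0 + smax on is the order of a multiple of psi, so the leading
    term of Phi(x) can be removed modulo psi. *)
Lemma reduce_order N x : (m0 + smax <= N)%N -> ordge N (Phi x) ->
  exists b y, x = b * psi + y /\ ordge N.+1 (Phi y).
Proof.
move=> le ge; have [y oy] : values (N - m0)%N by apply: values_large; lia.
have oN : is_ord (Phi (y * psi)) N.
  rewrite rmorphM -(@subnK m0 N); [exact: is_ordM | lia].
have [k [ge' _]] := same_ord ge oN.
exists (c2 k * y), (x - c2 k * y * psi); split; first by rewrite addrC subrK.
by rewrite rmorphB -mulrA rmorphM Phi_cst.
Qed.

(** After n applications of [reduce_order] the remainder is, modulo G0, divisible
    by v with a quotient of the same order bound; [v_closed] concludes. *)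
Lemma high_order_ideal x : ordge (m0 + smax + n) (Phi x) -> J x.
Proof.
set C := (m0 + smax + n)%N.
apply: (@v_closed 1 K J J (fun x => ordge C (Phi x))) => [w|{}x ge].
  move=> /choice[a /choice[b abP]]; exists (vsum a), (vsum b).
  rewrite !vsumM -vsumD; congr vsum; apply/funext => i; exact: abP.
have all k : exists b y, x = b * psi + y /\ ordge (C + k) (Phi y).
  elim: k => [|k [b [y [e gey]]]]; first by exists 0, x; rewrite mul0r add0r addn0.
  have [|b' [y' [e' gey']]] := reduce_order _ gey; first by rewrite /C; lia.
  by exists (b + b'), y'; rewrite addnS; split=> //; rewrite e e'; ring.
have [b [y [-> gey]]] := all n.
have [j lt|q [z ez]] := @high_order_divisible (C + n) y _ gey.
  by have := s_le_smax lt; rewrite /C; lia.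
exists (q * G0 + b * psi), z; split.
- by exists q, b.
- have [->|nz] := pselect (Phi z = 0); first exact: ordge_zero.
  case: (ord_dichotomy (Phi z)) => [//|[M oz]].
  apply: ordge_leq (is_ordW oz).
  have : is_ord (Phi y) (n + M).
    by rewrite ez rmorphD !rmorphM Phi_G0 mulr0 add0r; apply: is_ordM.
  by move=> /is_ord_ordge/(_ gey); rewrite addnC leq_add2l.
- by rewrite ez; ring.
Qed.

Let C := (m0 + smax + n)%N.
Let Sb m := `[< values m >].
Let in_mult m := (m0 <= m)%N && Sb (m - m0)%N.
(** The values that are not values plus m0: as for Apery sets, there are exactly m0
    of them, and they index a basis of the quotient by (G0, psi). *)
Definition apery := [seq m <- iota 0 C | Sb m && ~~ in_mult m].

(** Below C, count the values in two ways: those of the form m0 + value are as many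
    as the values below C - m0, and all of the m0 integers from C - m0 on are
    values. *)
Lemma size_apery : size apery = m0.
Proof.
have e1 : count Sb (iota 0 C) = (count in_mult (iota 0 C) + size apery)%N.
  rewrite -size_filter -(count_predC in_mult) !count_filter size_filter.
  congr (_ + _)%N; apply: eq_count => m /=; last by rewrite andbC.
  rewrite andb_idr // => /andP[le /asboolP sm]; apply/asboolP.
  rewrite -(subnK le); apply: valuesD => //; by exists psi.
have e2 : count in_mult (iota 0 C) = count Sb (iota 0 (C - m0)).
  rewrite -[in iota 0 C](@subnKC m0 C); last by rewrite /C; lia.
  rewrite iotaD count_cat add0n -{2}[m0]addn0 iotaDl count_map.
  rewrite (eq_in_count (a2 := pred0)) ?count_pred0 ?add0n.
    by apply: eq_count => m /=; rewrite /in_mult leq_addr addKn.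
  by move=> m; rewrite mem_iota add0n => /andP[_ lt] /=; rewrite /in_mult leqNgt lt.
have e3 : count Sb (iota 0 C) = (count Sb (iota 0 (C - m0)) + m0)%N.
  rewrite -[in LHS](@subnK m0 C); last by rewrite /C; lia.
  rewrite iotaD count_cat add0n; congr (_ + _)%N.
  rewrite -[RHS](size_iota (C - m0) m0); apply/eqP; rewrite -all_count; apply/allP => m.
  rewrite mem_iota => /andP[le _]; apply/asboolP/values_large.
  by apply: leq_trans le; rewrite /C; lia.
by move: e1; rewrite e2 e3 => /addnI.
Qed.

Lemma mem_apery m : (m \in apery) = [&& (m < C)%N, Sb m & ~~ in_mult m].
Proof. by rewrite mem_filter mem_iota add0n andbC. Qed.

Lemma ideal2_order x m : J x -> is_ord (Phi x) m -> in_mult m.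
Proof.
case=> a [b ->]; rewrite rmorphD !rmorphM Phi_G0 mulr0 add0r => o.
case: (ord_dichotomy (Phi b)) => [e|[M ob]].
  by case: (is_ord_neq0 o); rewrite e mul0r.
have -> := is_ord_uniq o (is_ordM ob psi_ord).
by rewrite /in_mult leq_addl addnK; apply/asboolP; exists b.
Qed.

(** Elements e_i whose orders run through [apery] form a basis modulo (G0, psi).
    They are independent because a combination has its order in [apery], whereas
    the elements of the ideal have orders of the form m0 + value. They generate
    because the leading term of Phi(x) is cancelled by some e_i or by a multiple of
    psi, until [high_order_ideal] applies. *)
Lemma codim_ideal2 : has_codim J m0.
Proof.
have szT := size_apery; have uT : uniq apery by rewrite filter_uniq ?iota_uniq.
pose sg (i : 'I_m0) := nth 0%N apery i.
have sgT i : sg i \in apery by apply: mem_nth; rewrite szT.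
have [e eP] : exists e : 'I_m0 -> V, forall i, is_ord (Phi (e i)) (sg i).
  suff H (i : 'I_m0) : exists x : V, is_ord (Phi x) (sg i).
    by have [e eP] := choice H; exists e.
  by have := sgT i; rewrite mem_apery => /and3P[_ /asboolP].
have span k x : (k <= C)%N -> ordge (C - k) (Phi x) ->
    exists c : 'I_m0 -> K, J (x - \sum_i c2 (c i) * e i).
  elim: k x => [|k IH] x lek ge.
    exists (fun=> 0); rewrite big1 => [|i _]; last by rewrite rmorph0 mul0r.
    by rewrite subr0; apply: high_order_ideal; rewrite subn0 in ge.
  have eN : (C - k.+1).+1 = (C - k)%N by rewrite subnS prednK // subn_gt0.
  have [o|] := ordgeS ge; last by rewrite eN => /(IH _ (ltnW lek)).
  set N := (C - k.+1)%N in ge o eN.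
  have [|nT] := boolP (N \in apery).
    move=> /(nthP 0%N)[i0]; rewrite szT => lti ei; pose i := Ordinal lti.
    have oi : is_ord (Phi (e i)) N by rewrite -ei; apply: eP.
    have [a [ge' _]] := same_ord ge oi.
    have [|c Jc] := IH (x - c2 a * e i) (ltnW lek).
      by rewrite -eN rmorphB rmorphM Phi_cst.
    exists (fun j => c j + (if j == i then a else 0)).
    suff -> : \sum_j c2 (c j + (if j == i then a else 0)) * e j =
              \sum_j c2 (c j) * e j + c2 a * e i by rewrite opprD addrCA addrC -addrA addrC in Jc *.
    under eq_bigr => j _ do rewrite rmorphD mulrDl.
    rewrite big_split; congr (_ + _); rewrite (bigD1 i) //= eqxx big1 ?addr0 // => j ne.
    by rewrite (negPf ne) rmorph0 mul0r.
  have : in_mult N.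
    move: nT; rewrite mem_apery ltn_subrL /= (_ : Sb N) /=; last by apply/asboolP; exists x.
    by rewrite negb_and negbK -leqNgt leqn0 /C; case: in_mult => //; lia.
  move=> /andP[leN /asboolP[y oy]].
  have oN : is_ord (Phi (y * psi)) N by rewrite rmorphM -(subnK leN); apply: is_ordM.
  have [a [ge' _]] := same_ord ge oN.
  have [|c Jc] := IH (x - c2 a * (y * psi)) (ltnW lek).
    by rewrite -eN rmorphB [Phi (c2 a * _)]rmorphM Phi_cst.
  exists c; have -> : x - \sum_i c2 (c i) * e i =
     (x - c2 a * (y * psi) - \sum_i c2 (c i) * e i) + c2 a * (y * psi) by ring.
  by apply: ideal2D => //; rewrite mulrA; apply: ideal2_psi.
have indep (d : 'I_m0 -> K) : J (\sum_i c2 (d i) * e i) -> forall i, d i = 0.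
  move=> Jd; have [i|i j nzi nzj eij|all0 i|[i [nzi oi _]]] :=
      @is_ord_sum K 'I_m0 (fun i => Phi (c2 (d i) * e i)) sg.
  - have [->|nz] := eqVneq (d i) 0; first by left; rewrite rmorph0 mul0r rmorph0.
    by right; rewrite rmorphM Phi_cst -[sg i]add0n; apply: is_ordM (eP i); apply: is_ord_cst.
  - have lt (l : 'I_m0) : (val l < size apery)%N by rewrite szT ltn_ord.
    by apply/val_inj/eqP; rewrite -(nth_uniq 0%N (lt i) (lt j) uT); apply/eqP; exact: eij.
  - apply/eqP; apply: contraT => nz; case: (@is_ord_neq0 K (Phi (c2 (d i) * e i)) (0 + sg i)%N).
      by rewrite rmorphM Phi_cst; apply: is_ordM (eP i); apply: is_ord_cst.
    exact: all0.
  rewrite -rmorph_sum in oi; have := ideal2_order Jd oi.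
  by have := sgT i; rewrite mem_apery => /and3P[_ _ /negPf->].
exists e => x; have [c Jc] := span C x (leqnn C) (ltac:(rewrite subnn; exact: ordge0)).
have sumE (d : 'I_m0 -> K) : \sum_i (\row_i d i) 0 i *: e i = \sum_i c2 (d i) * e i.
  by apply: eq_bigr => i _; rewrite mxE scale_cst.
exists (\row_i c i); split; first by rewrite sumE.
move=> d Jd; apply/rowP => i; rewrite mxE.
have := indep (fun i => d 0 i - c i); move=> H; apply/esym/eqP; rewrite -subr_eq0; apply/eqP.
apply: H => {i}; have -> : \sum_i c2 (d 0 i - c i) * e i =
   (x - \sum_i c2 (c i) * e i) + c2 (- 1) * (x - \sum_i d 0 i *: e i).
  rewrite rmorphN rmorph1 mulN1r opprB.
  rewrite [RHS]addrC addrA subrK -sumrB; apply: eq_bigr => i _.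
  by rewrite scale_cst rmorphB mulrBl.
by apply: ideal2D => //; apply: ideal2M.
Qed.
End Intersection.

(** Intersection numbers are orders by [codim_ideal2]; the codimension determines
    them by [has_codim_leq], and a multiple of G0 is precisely an element of ker Phi. *)
Lemma branch_semigroup_values : branch_semigroup G0 = values :> set nat.
Proof.
apply/seteqP; split=> m.
  case=> [->|[psi [_ ndiv codim]]]; first exact: values0.
  have [e|[m' o]] := ord_dichotomy (Phi psi).
    by case: ndiv; have [q ->] := kernel_Phi e; exists q.
  have codim' := codim_ideal2 o.
  have I0 : ideal2 G0 psi 0 by exists 0, 0; rewrite !mul0r addr0.
  have ID a x y : ideal2 G0 psi x -> ideal2 G0 psi y -> ideal2 G0 psi (a *: x + y).
    by move=> Jx Jy; rewrite scale_cst; apply: ideal2D => //; apply: ideal2M.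
  suff -> : m = m' by exists psi.
  apply/eqP; rewrite eqn_leq.
  by rewrite (has_codim_leq I0 ID codim codim') (has_codim_leq I0 ID codim' codim).
case=> psi o; right; exists psi; split; last exact: codim_ideal2.
  by apply/eqP => e; case: (is_ord_neq0 o); rewrite e rmorph0.
by case=> q e; case: (is_ord_neq0 o); rewrite e rmorphM Phi_G0 mulr0.
Qed.

Lemma u_divides k x y : u ^+ k * x = v * y -> exists z, x = v * z.
Proof.
elim: k x => [|k IH] x; first by rewrite expr0 mul1r => ->; exists y.
rewrite exprSr -mulrA => /IH[z ez]; apply: v_divides => m m1.
have := congr1 (fun f : V => mfps_coef f (m + U_(ord0))%MM) ez.
rewrite psXM coef_vM !mnmDE !mnm1E eqxx addn1 /= addmK m1 /=.
by [].
Qed.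

(** A solution of G0 x = 0 is divisible by v, since G0 is u^n modulo v, and then
    indefinitely so. *)
Lemma G0_regular x : G0 * x = 0 -> x = 0.
Proof.
move=> e0; have [k [h [nz eG]]] := G0_monic.
have step y : G0 * y = 0 -> exists z, y = v * z /\ G0 * z = 0.
  move=> e; have [|z ez] := @u_divides n (c2 k * y) (- (h * y)).
    by apply/eqP; rewrite mulrN -addr_eq0; apply/eqP; rewrite -[RHS]e eG; ring.
  have ey : y = v * (c2 k^-1 * z).
    by rewrite mulrCA -ez mulrA -rmorphM mulVf // rmorph1 mul1r.
  exists (c2 k^-1 * z); split=> //; apply: v_regular.
  by rewrite -[RHS]e ey; ring.
apply: v_separated => i.
suff [z [-> _]] : exists z, x = v ^+ i * z /\ G0 * z = 0 by exists z.
elim: i => [|i [z [-> ez]]]; first by exists x; rewrite expr0 mul1r.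
by have [z' [-> ez']] := step z ez; exists z'; rewrite mulrA -exprSr.
Qed.

Lemma G0_factor b c : G0 = b * c -> Phi b = 0 -> c \is a GRing.unit.
Proof.
move=> e /kernel_Phi[q eq].
apply/unitrPr; exists q; apply/eqP; rewrite eq_sym -subr_eq0; apply/eqP.
apply: G0_regular; rewrite mulrBr mulr1 {1}e eq; ring.
Qed.

(** ker Phi is prime, K[[t]] being a domain, and it is generated by G0. *)
Lemma G0_irreducible : irreducible_elt G0.
Proof.
split.
- apply/eqP => e; have [k [h [nz]]] := G0_monic; rewrite e => eG.
  have /eqP := oner_neq0 V; apply; apply: G0_regular; rewrite e mul0r //.
- apply/negP => /unitrPr[y /(congr1 Phi)]; rewrite rmorphM Phi_G0 mul0r rmorph1 => e.
  by have := oner_neq0 (mfps 1 K); rewrite -e eqxx.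
move=> b c e; have := congr1 Phi e; rewrite rmorphM Phi_G0 => e0.
have [eb|[N oN]] := ord_dichotomy (Phi b); first by right; apply: G0_factor eb.
have [ec|[M oM]] := ord_dichotomy (Phi c).
  by left; apply: G0_factor ec; rewrite mulrC.
by case: (is_ord_neq0 (is_ordM oN oM)).
Qed.

Lemma G0_irreducible_factor gamma : irreducible_factor gamma G0 -> associate gamma G0.
Proof.
case=> -[_ nu _] [c e]; exists c => //.
have [_ _ /(_ c gamma e)[//|ug]] := G0_irreducible.
by rewrite ug in nu.
Qed.
End Local.

Lemma associate_semigroup (K : fieldType) (a b : mfps 2 K) :
  associate a b -> branch_semigroup a = branch_semigroup b.
Proof.
case=> c uc eb.
have ea : a = c^-1 * b by rewrite eb mulKr.
have eI psi : ideal2 a psi = ideal2 b psi.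
  apply/seteqP; split=> x [s [t ->]].
    by exists (s * c^-1), t; rewrite ea mulrA.
  by exists (s * c), t; rewrite eb mulrA.
have eD psi : divides a psi <-> divides b psi.
  split=> -[d ->]; first by exists (d * c^-1); rewrite ea mulrA.
  by exists (d * c); rewrite eb mulrA.
apply/seteqP; split=> m [->|[psi [nz nd co]]]; [by left | right | by left | right].
  by exists psi; split=> //; [rewrite -eD | rewrite /intersection_number -eI].
by exists psi; split=> //; [rewrite eD | rewrite /intersection_number eI].
Qed.

(** * Homogenization and projective closure *)

Section Homogenization.
Variable K : fieldType.
Notation P2 := {mpoly K[2]}.
Notation P3 := {mpoly K[3]}.
Notation z3 := (ord_max : 'I_3).
Implicit Types (f h q : P2) (G H : P3).

Definition mhom N (m : 'X_{1..2}) : 'X_{1..3} :=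
  [multinom (if unlift z3 k is Some j then m j else N - mdeg m)%N | k < 3].
Definition mdehom (m : 'X_{1..3}) : 'X_{1..2} := [multinom m (lift z3 j) | j < 2].

Lemma mdeg_mdehom m : mdeg m = (mdeg (mdehom m) + m z3)%N.
Proof.
rewrite !mdegE (bigD1_ord z3) //= addnC; congr (_ + _)%N.
by apply: eq_bigr => j _; rewrite mnmE.
Qed.

Lemma mhomK N m : mdehom (mhom N m) = m.
Proof. by apply/mnmP => j; rewrite !mnmE liftK. Qed.

Lemma mhom_max N m : mhom N m z3 = (N - mdeg m)%N.
Proof. by rewrite mnmE unlift_none. Qed.

Lemma mdehomK N m : mdeg m = N -> mhom N (mdehom m) = m.
Proof.
move=> e; apply/mnmP => k; rewrite mnmE; case: unliftP => [j ->|->].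
  by rewrite mnmE.
by rewrite -e mdeg_mdehom addKn.
Qed.

Lemma mdeg_mhom N m : (mdeg m <= N)%N -> mdeg (mhom N m) = N.
Proof. by move=> le; rewrite mdeg_mdehom mhomK mhom_max subnKC. Qed.

Definition homogenize N h : P3 := \sum_(m <- msupp h) h@_m *: 'X_[mhom N m].

Definition dehom : P3 -> P2 :=
  mmap (@mpolyC 2 K) (fun k => if unlift z3 k is Some j then 'X_j else 1).
HB.instance Definition _ := GRing.RMorphism.copy dehom dehom.

Lemma dehomX m : dehom 'X_[m] = 'X_[mdehom m].
Proof.
rewrite /dehom mmapX /mmap1 (bigD1_ord z3) //= unlift_none expr1n mul1r mpolyXE_id.
by apply: eq_bigr => j _; rewrite liftK mnmE.
Qed.

Lemma dehomZ c G : dehom (c *: G) = c *: dehom G.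
Proof. by rewrite /dehom mmapZ mul_mpolyC. Qed.

Lemma dehom_homz N h : dehom (homogenize N h) = h.
Proof.
rewrite rmorph_sum [RHS]mpolyE; apply: eq_bigr => m _.
by rewrite /= dehomZ dehomX mhomK.
Qed.

Lemma homz_homog N h : (msize h <= N.+1)%N -> homogenize N h \is N.-homog.
Proof.
move=> le; rewrite /homogenize big_seq; apply: rpred_sum => m ms.
by apply: rpredZ; rewrite dhomogX /= mdeg_mhom // -ltnS (leq_trans (msize_mdeg_lt ms)).
Qed.

Lemma dehomE G : dehom G = \sum_(m <- msupp G) G@_m *: 'X_[mdehom m].
Proof.
rewrite {1}[G]mpolyE rmorph_sum; apply: eq_bigr => m _.
by rewrite /= dehomZ dehomX.
Qed.

Lemma mcoeff_dehom N G m : G \is N.-homog -> mdeg m = N ->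
  (dehom G)@_(mdehom m) = G@_m.
Proof.
move=> hG em; rewrite dehomE raddf_sum /= [RHS](_ : _ =
   \sum_(k <- msupp G) G@_k * (k == m)%:R); last first.
  by rewrite {1}[G]mpolyE raddf_sum; apply: eq_bigr => k _; rewrite /= mcoeffZ mcoeffX.
rewrite big_seq [RHS]big_seq; apply: eq_bigr => k ks.
rewrite mcoeffZ mcoeffX; congr (_ * (nat_of_bool _)%:R).
have ek := dhomogP _ _ _ hG k ks.
by apply/eqP/eqP => [e|-> //]; rewrite -(mdehomK ek) e mdehomK.
Qed.

(** On forms of a given degree, setting z = 1 loses nothing. *)
Lemma dehom_inj N G H : G \is N.-homog -> H \is N.-homog -> dehom G = dehom H -> G = H.
Proof.
move=> hG hH e; apply/mpolyP => m; have [em|ne] := eqVneq (mdeg m) N.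
  by rewrite -(mcoeff_dehom hG em) -(mcoeff_dehom hH em) e.
by rewrite (dhomog_nemf_coeff hG ne) (dhomog_nemf_coeff hH ne).
Qed.

Lemma msize_dehom N G : G \is N.-homog -> (msize (dehom G) <= N.+1)%N.
Proof.
move=> hG; rewrite dehomE big_seq.
apply: (big_ind (fun h => msize h <= N.+1)%N) => [|h h' le le'|m ms].
- by rewrite mmeasure0.
- by apply: leq_trans (mmeasureD_le _ _ _) _; rewrite geq_max le.
apply: leq_trans (msizeZ_le _ _) _.
have em : mdeg m = N := dhomogP _ _ _ hG m ms.
by rewrite mmeasureX /= ltnS -em mdeg_mdehom leq_addr.
Qed.

Lemma homz_mul N N' h h' : (msize h <= N.+1)%N -> (msize h' <= N'.+1)%N ->
  homogenize N h * homogenize N' h' = homogenize (N + N') (h * h').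
Proof.
move=> le le'; apply: (@dehom_inj (N + N')).
- by apply: dhomogM; apply: homz_homog.
- apply: homz_homog; have [->|nz] := eqVneq h 0; first by rewrite mul0r mmeasure0.
  have [->|nz'] := eqVneq h' 0; first by rewrite mulr0 mmeasure0.
  by rewrite msizeM //; move: le le'; move: (msize h) (msize h') => a b; lia.
by rewrite rmorphM /= !dehom_homz.
Qed.

(** If f divides the dehomogenization of G, the cofactor can be homogenized in the
    degree left over. *)
Lemma homz_divides n f d G : (msize f = n.+1)%N -> G \is d.-homog ->
  divides f (dehom G) -> divides (homogenize n f) G.
Proof.
move=> sf hG [c e]; have [e0|nz] := eqVneq (dehom G) 0.
  exists 0; rewrite mul0r; apply: (@dehom_inj d) => //; first exact: dhomog0.
  by rewrite e0 rmorph0.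
have cn0 : c != 0 by apply: contraNneq nz => c0; rewrite e c0 mul0r.
have fn0 : f != 0 by rewrite -msize_poly_eq0 sf.
have := msize_dehom hG; rewrite e msizeM // sf => le.
have sc : (0 < msize c)%N by rewrite lt0n msize_poly_eq0.
exists (homogenize (d - n) c).
have led : (n <= d)%N by move: le sc; move: (msize c) => a; lia.
have lec : (msize c <= (d - n).+1)%N by move: le sc led; move: (msize c) => a; lia.
rewrite homz_mul ?sf // subnK //; apply: (@dehom_inj d) => //; last by rewrite dehom_homz.
by apply: homz_homog; rewrite -e (msize_dehom hG).
Qed.

End Homogenization.

Section Evaluation3.
Variables (K : fieldType) (S : comNzRingType) (iota : {rmorphism K -> S}).

Lemma mmap_scale N (G : {mpoly K[3]}) (c : S) (a : 'I_3 -> S) : G \is N.-homog ->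
  mmap iota (fun k => c * a k) G = c ^+ N * mmap iota a G.
Proof.
move=> hG; rewrite /mmap mulr_sumr big_seq [RHS]big_seq; apply: eq_bigr => m ms.
have em : mdeg m = N := dhomogP _ _ _ hG m ms.
rewrite mulrCA; congr (_ * _); rewrite -em mdegE -prodrXr -big_split /=.
by apply: eq_bigr => k _; rewrite exprMn.
Qed.

Lemma mmap_homz N (h : {mpoly K[2]}) (a : 'I_3 -> S) :
  mmap iota a (homogenize N h) = \sum_(m <- msupp h) iota h@_m *
    ((\prod_(j < 2) a (lift ord_max j) ^+ m j) * a ord_max ^+ (N - mdeg m)%N).
Proof.
rewrite raddf_sum; apply: eq_bigr => m _; rewrite /= mmapZ mmapX; congr (_ * _).
rewrite /mmap1 (bigD1_ord ord_max) //= mulrC mhom_max; congr (_ * _).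
by apply: eq_bigr => j _; rewrite mnmE liftK.
Qed.
End Evaluation3.

Section Projective.
Variable K : closedFieldType.
Notation P2 := {mpoly K[2]}.
Notation P3 := {mpoly K[3]}.
Implicit Types (f h : P2) (G : P3) (Gamma : set 'rV[K]_2).
Local Open Scope classical_set_scope.

Lemma affine_embed_max (Q : 'rV[K]_2) : affine_embed Q 0 ord_max = 1.
Proof.
rewrite /affine_embed (_ : ord_max = rshift 2 (ord0 : 'I_1)); last exact: val_inj.
by rewrite row_mxEr mxE.
Qed.

Lemma meval_dehom G (Q : 'rV[K]_2) : G.@[affine_embed Q 0] = (dehom G).@[Q 0].
Proof.
rewrite dehomE {1}[G]mpolyE !raddf_sum /=; apply: eq_bigr => m _ /=.
rewrite !mevalZ !mevalX; congr (_ * _).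
rewrite (bigD1_ord ord_max) //=.
rewrite affine_embed_max expr1n mul1r; apply: eq_bigr => j _; rewrite mnmE; congr (_ ^+ _).
rewrite /affine_embed (_ : lift ord_max j = lshift 1 j) ?row_mxEl //.
by apply: val_inj; rewrite /= /bump leqNgt ltn_ord.
Qed.

Lemma affine_embed_neq0 (Q : 'rV[K]_2) : affine_embed Q != 0.
Proof.
apply/eqP => /rowP/(_ ord_max); rewrite affine_embed_max mxE => /eqP.
by rewrite oner_eq0.
Qed.

Variables (Gamma : set 'rV[K]_2) (f : P2) (n : nat).
Hypothesis minf : minimal_equation Gamma f.
Hypothesis sf : msize f = n.+1.

(** A form vanishes on the projective closure exactly when its dehomogenization
    vanishes on the affine curve; this is where the minimal equation enters. *)
Lemma closure_sub d G : G \is d.-homog ->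
  (projective_closure Gamma `<=` [set P : 'rV[K]_3 | G.@[P 0] = 0]) <->
  divides (homogenize n f) G.
Proof.
move=> hG; split.
  move=> sub; apply: (homz_divides sf hG); apply/minf => Q GQ; rewrite /zeros /= -meval_dehom.
  by apply: sub; split; [exact: affine_embed_neq0 | move=> e F _ FG; apply: FG].
case=> c eG P [_ PC]; apply: (PC d G hG) => Q GQ; rewrite meval_dehom.
have : divides f (dehom G) by exists (dehom c); rewrite eG rmorphM /= dehom_homz.
by move=> /minf; apply.
Qed.

Lemma homz_minimal : homogeneous_minimal_equation (projective_closure Gamma) (homogenize n f).
Proof.
split; first by exists n; apply: homz_homog; rewrite sf.
by move=> d G hG; apply: closure_sub hG.
Qed.

Lemma closure_equation (P : 'rV[K]_3) : P != 0 ->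
  projective_closure Gamma P <-> (homogenize n f).@[P 0] = 0.
Proof.
move=> nz; have hf : homogenize n f \is n.-homog by apply: homz_homog; rewrite sf.
split=> [PC|e].
  have /(closure_sub hf)/(_ P PC) // : divides (homogenize n f) (homogenize n f).
  by exists 1; rewrite mul1r.
split=> // d G hG GG.
have [c ->] : divides (homogenize n f) G.
  by apply/(closure_sub hG) => Q [_]; apply; [exact: hG | exact: GG].
by rewrite mevalM e mulr0.
Qed.

(** Two homogeneous minimal equations divide each other. *)
Lemma minimal_germ (F : P3) i O :
  homogeneous_minimal_equation (projective_closure Gamma) F ->
  associate (germ i O (homogenize n f)) (germ i O F).
Proof.
case=> -[d hF] minF; have hf : homogenize n f \is n.-homog by apply: homz_homog; rewrite sf.
have [a ea] : divides (homogenize n f) F.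
  by apply/(closure_sub hF)/(minF _ _ hF); exists 1; rewrite mul1r.
have [b eb] : divides F (homogenize n f).
  by apply/(minF _ _ hf)/(closure_sub hf); exists 1; rewrite mul1r.
have nz : homogenize n f != 0.
  apply/eqP => e; have := congr1 (@dehom K) e.
  by rewrite dehom_homz rmorph0 => f0; move: sf; rewrite f0 mmeasure0.
have ba : b * a = 1.
  by apply: (mulIf nz); rewrite mul1r -mulrA -ea -eb.
exists (germ i O a); last by rewrite /germ ea rmorphM /= [LHS](rmorphM (@pol 2 K)).
apply/unitrPr; exists (germ i O b).
rewrite mulrC /germ -[LHS](rmorphM (@pol 2 K)) -rmorphM /= ba.
by rewrite rmorph1 [LHS](rmorph1 (@pol 2 K)).
Qed.
End Projective.

(** * Germs at a point at infinity *)

Section Reversal.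
Variable K : fieldType.
Notation T := (mfps 1 K).
Notation c1 := (@cst 1 K).
Notation t := (vv : T).
Implicit Types (a b : {poly K}).

(** t^D a(1/t), for deg a <= D: the expansion at infinity of a. *)
Definition revp D a : T := \sum_(i < D.+1) c1 a`_i * t ^+ (D - i)%N.

Lemma revpD D a b : revp D (a + b) = revp D a + revp D b.
Proof.
by rewrite /revp -big_split; apply: eq_bigr => i _; rewrite /= coefD rmorphD mulrDl.
Qed.

Lemma revp0 D : revp D 0 = 0.
Proof. by rewrite /revp big1 // => i _; rewrite coef0 rmorph0 mul0r. Qed.

Lemma revpCM D c a : revp D (c%:P * a) = c1 c * revp D a.
Proof.
rewrite /revp mulr_sumr; apply: eq_bigr => i _.
by rewrite coefCM rmorphM mulrA.
Qed.

Lemma revp_sum D (I : eqType) (r : seq I) (F : I -> {poly K}) :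
  revp D (\sum_(i <- r) F i) = \sum_(i <- r) revp D (F i).
Proof.
elim: r => [|i r IH]; first by rewrite !big_nil revp0.
by rewrite !big_cons revpD IH.
Qed.

Lemma revpXn D i : (i <= D)%N -> revp D 'X^i = t ^+ (D - i).
Proof.
move=> le; rewrite /revp (bigD1 (Ordinal (le : i < D.+1)%N)) //= coefXn eqxx rmorph1 mul1r.
rewrite big1 ?addr0 // => j ne; rewrite coefXn (_ : (_ == _) = false) ?rmorph0 ?mul0r //.
by apply: contraNF ne => /eqP e; apply/eqP/val_inj.
Qed.

Lemma poly_cut a D : (size a <= D)%N -> a = \sum_(0 <= i < D) (a`_i)%:P * 'X^i.
Proof.
move=> le; rewrite big_mkord.
apply/polyP => j; rewrite coef_sum.
have [lt|ge] := ltnP j D.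
  rewrite (bigD1 (Ordinal lt)) //= coefCM coefXn eqxx mulr1 big1 ?addr0 // => i ne.
  rewrite coefCM coefXn (_ : (_ == _) = false) ?mulr0 //.
  by apply: contraNF ne => /eqP e; apply/eqP/val_inj.
rewrite nth_default ?(leq_trans le) // big1 // => i _.
by rewrite coefCM coefXn gtn_eqF ?mulr0 // (leq_trans (ltn_ord i)).
Qed.

Lemma revpM D E a b : (size a <= D.+1)%N -> (size b <= E.+1)%N ->
  revp (D + E) (a * b) = revp D a * revp E b.
Proof.
move=> sa sb; rewrite (poly_cut sa) (poly_cut sb) mulr_suml revp_sum [in RHS]revp_sum mulr_suml.
apply: eq_big_seq => i; rewrite mem_index_iota => /andP[_ lti].
rewrite mulr_sumr revp_sum [in RHS]revp_sum mulr_sumr.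
apply: eq_big_seq => j; rewrite mem_index_iota => /andP[_ ltj].
rewrite mulrACA -rmorphM -exprD !revpCM !revpXn ?leq_add // rmorphM mulrACA -exprD.
by congr (_ * _ ^+ _); lia.
Qed.

Lemma revp_shift D E a : (size a <= E.+1)%N -> (E <= D)%N -> revp D a = t ^+ (D - E) * revp E a.
Proof.
move=> sa le; rewrite -{1}(subnKC le) addnC -[a]mul1r revpM ?size_poly1 // mul1r; congr (_ * _).
by rewrite -[1]/('X^0 : {poly K}) revpXn // subn0.
Qed.

Lemma revpX D k a : (size a <= D.+1)%N -> revp (k * D) (a ^+ k) = revp D a ^+ k.
Proof.
move=> sa; elim: k => [|k IH].
  by rewrite !expr0 /revp big_ord_recl big_ord0 addr0 coefC subnn expr0 mulr1 rmorph1.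
rewrite mulSn !exprS revpM ?IH //.
have [->|nz] := eqVneq a 0; first by case: k {IH} => [|k]; rewrite ?expr0 ?size_poly1 // expr0n size_poly0.
rewrite -(prednK (n := size (a ^+ k))) ?size_poly_gt0 ?expf_neq0 // size_exp ltnS mulnC leq_mul2l.
by rewrite -ltnS prednK ?size_poly_gt0 // sa orbT.
Qed.

Lemma revp_decomp D a : exists h, revp D a = c1 a`_D + t * h.
Proof.
exists (\sum_(i < D) c1 a`_i * t ^+ (D - i.+1)).
rewrite /revp big_ord_recr /= subnn expr0 mulr1 addrC mulr_sumr; congr (_ + _).
apply: eq_bigr => i _; rewrite mulrCA -exprS; congr (_ * _ ^+ _).
by rewrite subnSK.
Qed.

Lemma revp_ord D d a : size a = d.+1 -> (d <= D)%N -> is_ord (revp D a) (D - d).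
Proof.
move=> sa le; have [h eh] := revp_decomp d a.
exists a`_d, h; rewrite -eh; split; last by apply: revp_shift; rewrite ?sa.
by have := lead_coef_eq0 a; rewrite /lead_coef sa /= -size_poly_eq0 sa => ->.
Qed.

End Reversal.

Section Germs.
Variable K : closedFieldType.
Implicit Types (F : {mpoly K[3]}).

(** Naming the substitution exhibits [germ] as a composite of ring morphisms. *)
Definition chart i (O : 'rV[K]_3) : 3.-tuple {mpoly K[2]} := [tuple
  (if unlift i k is Some j then (O 0 k / O 0 i)%:MP + 'X_j else 1) | k < 3].
HB.instance Definition _ i O :=
  GRing.RMorphism.copy (germ i O) (@pol 2 K \o comp_mpoly (chart i O)).

Lemma germX i (O : 'rV[K]_3) k : germ i O 'X_k =
  if unlift i k is Some j then cst 2 (O 0 k / O 0 i) + pol 'X_j else 1.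
Proof.
rewrite /germ comp_mpolyXU -tnth_nth tnth_mktuple -[LHS]/(pol _).
by case: unliftP => [j _|_]; rewrite ?rmorphD ?rmorph1.
Qed.

Lemma germC i (O : 'rV[K]_3) c : germ i O c%:MP = cst 2 c.
Proof. by rewrite /germ comp_mpolyC. Qed.

Lemma substR_germ a b (va : vo 1 a) (vb : vo 1 b) i (O : 'rV[K]_3) F :
  substR va vb (germ i O F) = mmap (@cst 1 K) (fun k => substR va vb (germ i O 'X_k)) F.
Proof.
pose S : {rmorphism {mpoly K[3]} -> mfps 1 K} :=
  GRing.RMorphism.clone _ _ (substR va vb \o germ i O) _.
pose M : {rmorphism {mpoly K[3]} -> mfps 1 K} :=
  GRing.RMorphism.clone _ _ (mmap (@cst 1 K) (fun k => substR va vb (germ i O 'X_k))) _.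
apply: (@mpoly_rmorph_ext _ _ _ S M) => [c|k] /=.
  by transitivity (@cst 1 K c); [rewrite germC subst_cst | rewrite [RHS]mmapC].
by apply/esym; rewrite -[LHS]/(mmap _ _ _) mmapX mmap1U.
Qed.

End Germs.

(** * The parametrization of the branch at infinity *)

Notation x3 := (lift (ord_max : 'I_3) (ord0 : 'I_2)).
Notation y3 := (lift (ord_max : 'I_3) (ord_max : 'I_2)).

Lemma chart_indices (i : 'I_3) : i != ord_max -> exists i' : 'I_3,
  [/\ (i = x3 /\ i' = y3) \/ (i = y3 /\ i' = x3), unlift i i' = Some (ord0 : 'I_2),
      unlift i ord_max = Some (ord_max : 'I_2) & forall k, [\/ k = i, k = i' | k = ord_max]].
Proof.
have cov (k : 'I_3) : [\/ k = x3, k = y3 | k = ord_max].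
  by case: k => [[|[|[|]]] ltk] //; [constructor 1 | constructor 2 | constructor 3]; apply: val_inj.
case: (cov i) => -> // _; [exists y3 | exists x3]; split; try by [left | right].
- by rewrite (_ : y3 = lift x3 (ord0 : 'I_2)) ?liftK //; apply: val_inj.
- by rewrite (_ : ord_max = lift x3 (ord_max : 'I_2)) ?liftK //; apply: val_inj.
- exact: cov.
- by rewrite (_ : x3 = lift y3 (ord0 : 'I_2)) ?liftK //; apply: val_inj.
- by rewrite (_ : ord_max = lift y3 (ord_max : 'I_2)) ?liftK //; apply: val_inj.
by move=> k; case: (cov k) => ->; [constructor 2 | constructor 1 | constructor 3].
Qed.

Lemma vo1_vM (K : fieldType) (z : mfps 1 K) : vo 1 (vv * z).
Proof.
apply: (@voM _ _ 1 0); last exact: vo0.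
move=> m; rewrite ltnS leqn0 mdeg_eq0 => /eqP->.
by rewrite coef_pol mcoeffX; case: eqP => // /(congr1 (@mdeg _)); rewrite mdeg1 mdeg0.
Qed.

Section Chart.
Variable K : closedFieldType.
Notation P2 := {mpoly K[2]}.
Notation t := (vv : mfps 1 K).
Notation c1 := (@cst 1 K).
Notation z3 := (ord_max : 'I_3).

Variables (x y : {poly K}) (n : nat) (O : 'rV[K]_3) (c : K) (i : 'I_3).
Hypotheses (n0 : (0 < n)%N) (sx : (size x <= n.+1)%N) (sy : (size y <= n.+1)%N).
Hypotheses (c0 : c != 0) (Ox : O 0 x3 = c * x`_n) (Oy : O 0 y3 = c * y`_n) (Oz : O 0 z3 = 0).
Hypothesis Oi : O 0 i != 0.

(** The projective parametrization (x(1/t) : y(1/t) : 1), cleared of denominators. *)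
Definition param (k : 'I_3) : mfps 1 K :=
  if unlift z3 k is Some j then (if j == ord0 then revp n x else revp n y) else t ^+ n.

Lemma param_decomp k : exists h, param k = c1 (c^-1 * O 0 k) + t * h.
Proof.
rewrite /param; case: unliftP => [j ->|->]; last first.
  exists (t ^+ n.-1); rewrite Oz mulr0 rmorph0 add0r -exprS prednK //.
case: eqP => [->|/eqP ne]; first by rewrite Ox mulKf //; exact: revp_decomp.
have -> : j = ord_max by apply: val_inj; case: j ne => [[|[|]]].
by rewrite Oy mulKf //; exact: revp_decomp.
Qed.

Lemma param_homz N h : (msize h <= N.+1)%N ->
  mmap c1 param (homogenize N h) = revp (n * N) (curve_ev x y h).
Proof.
move=> sh; rewrite mmap_homz /curve_ev ev2E revp_sum; apply: eq_big_seq => m ms.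
rewrite revpCM; congr (_ * _).
have le : (mdeg m <= N)%N by rewrite -ltnS (leq_trans (msize_mdeg_lt ms)).
have eZ : param z3 = t ^+ n by rewrite /param unlift_none.
have eX j : param (lift z3 j) = if j == ord0 then revp n x else revp n y by rewrite /param liftK.
rewrite eZ !big_ord_recl big_ord0 mulr1 !eX /= (_ : lift ord0 ord0 = ord_max); last exact: val_inj.
have em : mdeg m = (m ord0 + m ord_max)%N.
  by rewrite mdegE !big_ord_recl big_ord0 addn0; congr (_ + m _)%N; exact: val_inj.
have sX (a : {poly K}) k : (size a <= n.+1)%N -> (size (a ^+ k) <= (k * n).+1)%N.
  move=> sa; apply: leq_trans (size_poly_exp_leq _ _) _; rewrite ltnS mulnC leq_mul2l.
  by rewrite (_ : (size a).-1 <= n)%N ?orbT //; move: sa; case: (size a).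
rewrite -!revpX // -revpM ?sX // -mulnDl -em.
rewrite (@revp_shift _ (n * N) (n * mdeg m)%N); first 1 last.
- rewrite mulnC em mulnDl; apply: leq_trans (size_polyMleq _ _) _.
  move: (sX x (m ord0) sx) (sX y (m ord_max) sy).
  move: (size _) (size _) (_ * n)%N (_ * n)%N => A B C D; lia.
- by rewrite leq_mul2l le orbT.
by rewrite mulrC -exprM mulnBr [(mdeg m * n)%N]mulnC.
Qed.

Lemma i_affine : i != z3.
Proof. by apply: contraNneq Oi => ->; rewrite Oz. Qed.

(** Dividing the parametrization by its coordinate of index i, which is a unit of
    K[[t]] as the curve passes through O, gives series a and b to substitute for
    the two local coordinates. On forms of degree N the division costs a factor
    e^N of order 0, whence the order of the image of the germ of h is n N minus the
    degree of h on the curve. *)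
Lemma chart_parametrization : exists Phi : {rmorphism mfps 2 K -> mfps 1 K},
  [/\ forall k, Phi (cst 2 k) = c1 k, is_ord (Phi vv) n &
    exists e, is_ord e 0 /\ forall N h, (msize h <= N.+1)%N ->
      e ^+ N * Phi (germ i O (homogenize N h)) = revp (n * N) (curve_ev x y h)].
Proof.
have [i' [_ ui' uz all]] := chart_indices i_affine.
have [hi ei] := param_decomp i; have [hi' ei'] := param_decomp i'.
set pi := c^-1 * O 0 i in ei; set pi' := c^-1 * O 0 i' in ei'.
have pi0 : pi != 0 by rewrite mulf_neq0 ?invr_eq0.
have [g eg] := unit_series hi pi0.
have [q [g' eg']] := decomp1 g.
have qpi : q * pi = 1.
  apply/eqP; rewrite -subr_eq0; apply/eqP.
  apply: (@cst_vM_eq _ _ (c1 q * hi + g' * c1 pi + t * g' * hi) 0).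
  rewrite mulr0 rmorphB rmorphM rmorph1 -eg eg'; ring.
rewrite -ei in eg.
(* The local coordinates x_{i'} / x_i - O_{i'} / O_i and z / x_i on the branch. *)
set a := param i' * g - c1 (O 0 i' / O 0 i); set b := t ^+ n * g.
have va : vo 1 a.
  rewrite (_ : a = t * (c1 pi' * g' + hi' * c1 q + t * hi' * g')); first exact: vo1_vM.
  rewrite /a ei' eg' (_ : O 0 i' / O 0 i = pi' * q); first by rewrite [c1 (pi' * q)]rmorphM; ring.
  have -> : q = pi^-1 by apply: (mulIf pi0); rewrite qpi mulVf.
  by rewrite /pi /pi' invfM invrK mulrACA mulVf // mul1r.
have vb : vo 1 b by rewrite /b -(prednK n0) exprS -mulrA; exact: vo1_vM.
have eU : substR va vb (pol 'X_ord0) = a.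
  by transitivity (evs a b 'X_ord0); [exact: subst_pol | exact: ev2X].
have eV : substR va vb (pol 'X_ord_max) = b.
  by transitivity (evs a b 'X_ord_max); [exact: subst_pol | exact: ev2Y].
have eC k : substR va vb (cst 2 k) = c1 k by exact: subst_cst.
exists (substR va vb); split=> [//||].
  rewrite eV /b -[n]addn0.
  apply: is_ordM; first by rewrite addn0; exact: is_ord_vvX.
  by rewrite eg'; apply: is_ord_unit; apply: contraNneq (oner_neq0 K) => q0; rewrite -qpi q0 mul0r.
have eP k : param i * substR va vb (germ i O 'X_k) = param k.
  rewrite germX; case: (all k) => ->.
  - by rewrite unlift_none rmorph1 mulr1.
  - by rewrite ui' rmorphD eC eU /a addrC subrK mulrCA [param i * g]mulrC eg mulr1.
  rewrite uz Oz mul0r rmorph0 add0r eV /b.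
  by rewrite mulrCA [param i * g]mulrC eg mulr1 /param unlift_none.
exists (param i); split=> [|N h sh]; first by rewrite ei; exact: is_ord_unit.
rewrite substR_germ -mmap_scale; last exact: homz_homog.
rewrite -param_homz //; apply: eq_bigr => m _; congr (_ * _).
by apply: eq_bigr => k _; rewrite eP.
Qed.

End Chart.

(** * The semigroup generated by the key polynomials *)

Section TopGerm.
Variable K : closedFieldType.
Notation P2 := {mpoly K[2]}.
Notation X := ('X_(ord0 : 'I_2) : P2).
Notation Y := ('X_(ord_max : 'I_2) : P2).
Notation z3 := (ord_max : 'I_3).
Variables (al be : K).
Let l := al *: X + be *: Y.

Lemma msize_linear : (msize l <= 2)%N.
Proof.
apply: msizeD_leq; apply: leq_trans (msizeZ_le _ _) _; by rewrite mmeasureX /= mdeg1.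
Qed.

Lemma msize_linear_gt1 : (al != 0) || (be != 0) -> (1 < msize l)%N.
Proof.
have c0 : l@_U_(ord0) = al.
  by rewrite mcoeffD !mcoeffZ !mcoeffX eqxx mulr1 (_ : (_ == _) = false) ?mulr0 ?addr0 ?eq_mnm1.
have c1 : l@_U_(ord_max) = be.
  by rewrite mcoeffD !mcoeffZ !mcoeffX eqxx mulr1 (_ : (_ == _) = false) ?mulr0 ?add0r ?eq_mnm1.
have big m : l@_m != 0 -> (mdeg m < msize l)%N by rewrite -mcoeff_msupp => /msize_mdeg_lt.
by case/orP; [rewrite -c0 | rewrite -c1] => /big; rewrite mdeg1.
Qed.

Lemma homz_linear : homogenize 1 l = al *: 'X_x3 + be *: 'X_y3.
Proof.
apply: (@dehom_inj _ 1); first exact/homz_homog/msize_linear.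
  by apply: rpredD; apply: rpredZ; rewrite dhomogX /= mdeg1.
rewrite dehom_homz rmorphD /= !dehomZ !dehomX /l; congr (_ *: 'X_[_] + _ *: 'X_[_]);
  by apply/mnmP => j; rewrite !mnmE (inj_eq (@lift_inj _ _)).
Qed.

(** The form of degree N of h is the part prime to z of its homogenization. *)
Lemma homz_top N h k : (msize (h - k *: l ^+ N) <= N)%N ->
  homogenize N h = k *: homogenize 1 l ^+ N + 'X_z3 * homogenize N.-1 (h - k *: l ^+ N).
Proof.
set h' := h - _ => sh'; have eh : h = k *: l ^+ N + h' by rewrite /h' addrC subrK.
have hl : homogenize 1 l ^+ N \is N.-homog.
  by rewrite -[N in N.-homog]mul1n; apply: dhomogMn; apply: homz_homog msize_linear.
have shN : (msize h <= N.+1)%N.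
  rewrite eh; apply: msizeD_leq; last exact: leq_trans sh' _.
  exact/msize_topform/msize_linear.
apply: (@dehom_inj _ N); first exact: homz_homog.
  apply: rpredD; first exact: rpredZ.
  move: h' sh' {eh hl shN}; case: N => [|N] h' /=.
    by rewrite leqn0 msize_poly_eq0 => /eqP->; rewrite /homogenize msupp0 big_nil mulr0 dhomog0.
  by move=> sh'; apply: (@dhomogM _ _ _ 1 _ N _); [rewrite dhomogX /= mdeg1 | exact: homz_homog].
rewrite dehom_homz rmorphD rmorphM /= dehomZ rmorphXn /= !dehom_homz {1}eh; congr (_ + _).
rewrite dehomX (_ : mdehom U_(z3) = 0%MM) ?mpolyX0 ?mul1r //.
by apply/mnmP => j; rewrite !mnmE (negPf (neq_lift _ _)).
Qed.

Variables (O : 'rV[K]_3) (i : 'I_3).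
Hypotheses (Oz : O 0 z3 = 0) (Oi : O 0 i != 0) (Ol : al * O 0 x3 + be * O 0 y3 = 0).
Hypothesis nz : (al != 0) || (be != 0).

(** At the point at infinity of the line l = 0, the first local coordinate is l up
    to a constant. *)
Lemma germ_linear : exists2 k, k != 0 & germ i O (homogenize 1 l) = cst 2 k * pol 'X_ord0.
Proof.
have [i' [cs ui' _ _]] := chart_indices (i_affine Oz Oi).
rewrite homz_linear -!mul_mpolyC rmorphD !rmorphM /= !germC !germX.
have := Ol; case: cs => -[ei ei']; rewrite -ei -ei' unlift_none ui' => Ol'.
  exists be.
    apply/eqP => be0; move: nz Ol'; rewrite be0 eqxx orbF mul0r addr0 => /negPf al0 /eqP.
    by rewrite mulf_eq0 al0 (negPf Oi).
  rewrite mulr1 mulrDr addrA -rmorphM -rmorphD (_ : al + _ = 0) ?rmorph0 ?add0r //.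
  apply: (mulIf Oi); rewrite mulrDl mul0r -mulrA divfK //.
exists al.
  apply/eqP => al0; move: nz Ol'; rewrite al0 eqxx mul0r add0r => /negPf be0 /eqP.
  by rewrite mulf_eq0 be0 (negPf Oi).
rewrite mulr1 mulrDr addrAC -rmorphM -rmorphD (_ : _ + be = 0) ?rmorph0 ?add0r //.
by apply: (mulIf Oi); rewrite mulrDl mul0r -mulrA divfK.
Qed.

Lemma top_germ N h : top l N h -> monic_mod_v N (germ i O (homogenize N h)).
Proof.
case=> k k0 /homz_top->; have [c c0 ec] := germ_linear.
have [_ [_ _ uz _]] := chart_indices (i_affine Oz Oi).
exists (k * c ^+ N), (germ i O (homogenize N.-1 (h - k *: l ^+ N))).
split; first by rewrite mulf_neq0 ?expf_neq0.
rewrite rmorphD rmorphM -mul_mpolyC rmorphM rmorphXn /= ec germC germX uz Oz mul0r.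
by rewrite rmorph0 add0r exprMn rmorphM rmorphXn mulrA.
Qed.
End TopGerm.

Lemma is_ord_cancel (K : fieldType) (e z : mfps 1 K) m :
  is_ord e 0 -> is_ord (e * z) m -> is_ord z m.
Proof.
move=> oe oez; have [z0|[m' oz]] := ord_dichotomy z.
  by case: (is_ord_neq0 oez); rewrite z0 mulr0.
by have := is_ord_uniq oez (is_ordM oe oz); rewrite add0n => ->.
Qed.

Section GeneratedSemigroup.
Implicit Types (r : seq nat).

Lemma generated0 r : generated_semigroup r 0%N.
Proof. by exists (fun=> 0%N); rewrite big1. Qed.

Lemma generatedD r a b : generated_semigroup r a -> generated_semigroup r b ->
  generated_semigroup r (a + b)%N.
Proof.
case=> ca -> [cb ->]; exists (fun i => ca i + cb i)%N.
by rewrite -big_split; apply: eq_bigr => i _; rewrite mulnDl.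
Qed.

Lemma generated_mem r a : a \in r -> generated_semigroup r a.
Proof.
move=> /(nthP 0%N)[k lt <-]; exists (fun i => (i == Ordinal lt) : nat).
rewrite (bigD1 (Ordinal lt)) //= eqxx mul1n big1 ?addn0 // => i /negPf->.
by rewrite mul0n.
Qed.

Lemma generated_sub r (S : nat -> Prop) : S 0%N -> (forall a b, S a -> S b -> S (a + b)%N) ->
  (forall a, a \in r -> S a) -> forall m, generated_semigroup r m -> S m.
Proof.
move=> S0 SD Sr m [c ->]; apply: (big_ind S) => // i _.
elim: (c i) => [|k IH]; first by rewrite mul0n.
by rewrite mulSn; apply: SD => //; apply/Sr/mem_nth.
Qed.
End GeneratedSemigroup.

Section LocalSemigroup.
Variable K : closedFieldType.
Notation P2 := {mpoly K[2]}.
Notation X := ('X_(ord0 : 'I_2) : P2).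
Notation Y := ('X_(ord_max : 'I_2) : P2).
Notation z3 := (ord_max : 'I_3).

Variables (x y : {poly K}) (Ps : seq {poly K}) (al be : K) (u : P2).
Let n := chain_degree Ps.
Let w : P2 := al *: X + be *: Y.
Hypotheses (nl : nonlinear Ps) (su : (msize u <= 2)%N).
Hypotheses (eu : curve_ev x y u = (chain_curve Ps).1) (ew : curve_ev x y w = (chain_curve Ps).2).
Hypotheses (sx : (size x <= n.+1)%N) (sy : (size y <= n.+1)%N).
Hypotheses (nz : (al != 0) || (be != 0)) (lin : al * x`_n + be * y`_n = 0).
Variables (O : 'rV[K]_3) (c : K) (i : 'I_3).
Hypotheses (c0 : c != 0) (Ox : O 0 x3 = c * x`_n) (Oy : O 0 y3 = c * y`_n) (Oz : O 0 z3 = 0).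
Hypothesis Oi : O 0 i != 0.

Let f := (chain_end Ps u w).2.

Let n0 : (0 < n)%N. Proof. by have [] := size_chain_curve nl. Qed.

Lemma top_linear : top w 1 w.
Proof. by exists 1; rewrite ?oner_eq0 // expr1 scale1r subrr mmeasure0. Qed.

Lemma top_equation : top w n f.
Proof.
rewrite -[n]mul1n; apply: (chain_end_top (msize_linear al be)) => //; exact: top_linear.
Qed.

Let Sg := generated_semigroup (am_seq (chain_degrees Ps)).

Let mem_tail r : r \in am_tail n 1 (chain_degrees Ps) -> r \in am_seq (chain_degrees Ps).
Proof. by move=> m; rewrite inE m orbT. Qed.

(** The hypotheses of the study of Phi above are met with g_j the germs of the
    polynomials of a [good_family]: it supplies the values n j - pi j, which belong
    to the generated semigroup, and conversely the generators are values by
    [chain_end_keys]. *)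
Theorem local_semigroup (g0 := germ i O (homogenize n f)) :
  [/\ irreducible_elt g0, forall gamma, irreducible_factor gamma g0 -> associate gamma g0
    & branch_semigroup g0 = Sg].
Proof.
have [Phi [PhiC PhiV [e [oe Phi_eq]]]] := chart_parametrization n0 sx sy c0 Ox Oy Oz Oi.
have Ol : al * O 0 x3 + be * O 0 y3 = 0.
  by rewrite Ox Oy ![_ * (c * _)]mulrCA -mulrDr lin mulr0.
have monic N h : top w N h -> monic_mod_v N (germ i O (homogenize N h)) by exact: top_germ.
have oeX N : is_ord (e ^+ N) 0 by have := is_ordX N oe; rewrite muln0.
have keyord N h d : top w N h -> size (curve_ev x y h) = d.+1 -> (d <= n * N)%N ->
    is_ord (Phi (germ i O (homogenize N h))) (n * N - d).
  move=> t s le; apply: is_ord_cancel (oeX N) _; rewrite (Phi_eq _ _ (top_msize (msize_linear al be) t)).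
  exact: revp_ord.
have g0m : monic_mod_v n g0 by apply: monic top_equation.
have g0P : Phi g0 = 0.
  have [//|[m o]] := ord_dichotomy (Phi g0).
  case: (is_ord_neq0 (is_ordM (oeX n) o)); rewrite (Phi_eq _ _ (top_msize (msize_linear al be) top_equation)).
  by have [_ ->] := chain_end_curve eu ew; exact: revp0.
have Sn : Sg n by apply: generated_mem; rewrite inE eqxx.
have [|||||G [pi [fam inj]]] := @chain_end_family K w (msize_linear al be) x y Ps u w 1 n Sg
   (fun=> 1) (fun=> 0%N) (@generatedD _) (generated0 _) nl isT su top_linear.
- by rewrite mul1n.
- exact: eu.
- exact: ew.
- by move=> r /mem_tail/generated_mem.
- split=> [j|]; last by move=> [|?] [|?].
  rewrite ltnS leqn0 => /eqP->; split=> //; first exact: top1.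
    by rewrite rmorph1 size_poly1.
  by rewrite subn0 muln0; exact: generated0.
pose g j := germ i O (homogenize j (G j)).
pose s j := (n * j - pi j)%N.
have gm j : (j < n)%N -> monic_mod_v j (g j) by move=> /fam[t _ _ _ _]; apply: monic.
have go j : (j < n)%N -> is_ord (Phi (g j)) (s j).
  by move=> /fam[t sz _ [_ le] _]; apply: keyord.
have sI j k : (j < n)%N -> (k < n)%N -> s j = s k %[mod n] -> j = k.
  move=> lj lk e'; apply: inj => //; have [_ _ _ [ltj lej] _] := fam j lj.
  have [_ _ _ [ltk lek] _] := fam k lk.
  have ej : (s j + pi j = n * j)%N by rewrite /s subnK.
  have ek : (s k + pi k = n * k)%N by rewrite /s subnK.
  have : (s j + pi j = s j + pi k %[mod n])%N.
    rewrite ej modnMr -[RHS]modnDml e' modnDml ek modnMr //.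
  by move/eqP; rewrite eqn_modDl !modn_small // => /eqP.
split.
- exact: (G0_irreducible n0 PhiC PhiV g0m g0P gm go sI).
- exact: (G0_irreducible_factor n0 PhiC PhiV g0m g0P gm go sI).
rewrite (branch_semigroup_values n0 PhiC PhiV g0m g0P gm go sI).
apply/seteqP; split=> m.
  case/(valuesE n0 PhiC PhiV g0m g0P gm go sI) => j [k ->]; apply: generatedD.
    elim: k => [|k IH]; first by rewrite muln0; exact: generated0.
    by rewrite mulnS; apply: generatedD.
  by have [] := fam j (ltn_ord j).
apply: generated_sub; [exact: values0 | exact: valuesD | move=> r].
rewrite inE => /orP[/eqP->|mr]; first by exists vv.
have [|N [d [h [t sz le ->]]]] := @chain_end_keys K w (msize_linear al be) x y Ps u w 1 n r nl isT su top_linear _ eu ew mr.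
  by rewrite mul1n.
by exists (germ i O (homogenize N h)); apply: keyord.
Qed.
End LocalSemigroup.

(** * Polynomial functions over an algebraically closed field *)

Section Pointwise.
Variable K : closedFieldType.
Notation P2 := {mpoly K[2]}.
Notation X := ('X_(ord0 : 'I_2) : P2).
Notation Y := ('X_(ord_max : 'I_2) : P2).
Implicit Types (f g h p q : P2) (P : 'rV[K]_2).

(** Otherwise a X + 1, whose only value is 1, would have a root. *)
Lemma poly_vanishing (a : {poly K}) : (forall c, a.[c] = 0) -> a = 0.
Proof.
move=> a0; apply/eqP; apply: contraT => nz.
have /closed_rootP[c /eqP] : size (a * 'X + 1) != 1%N.
  rewrite size_addl size_mulX // ?size_poly1 ?ltnS ?size_poly_gt0 //.
  by rewrite eqSS size_poly_eq0.
by rewrite !hornerE a0 mul0r add0r => /eqP; rewrite oner_eq0.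
Qed.

Lemma meval_ev2 h P : h.@[P 0] = ev2 idfun (P 0 ord0) (P 0 ord_max) h.
Proof.
pose M : {rmorphism P2 -> K} := GRing.RMorphism.clone _ _ (meval (P 0)) _.
rewrite -[LHS]/(M h) (@rmorph_ev2 _ _ _ idfun) => [|c]; last exact: mevalC.
by rewrite /= !mevalXU.
Qed.

Definition pt (a b : K) : 'rV[K]_2 := \row_k (if k == ord0 then a else b).

Lemma meval_pt h a b : h.@[pt a b 0] = ev2 idfun a b h.
Proof. by rewrite meval_ev2 !mxE. Qed.

Lemma mpoly_vanishing h : (forall P, h.@[P 0] = 0) -> h = 0.
Proof.
move=> h0; apply: (@toPP_inj K); rewrite rmorph0; apply/polyP => j; rewrite coef0.
apply: poly_vanishing => a.
have e b : (map_poly (horner_eval a) (toPP h)).[b] = h.@[pt a b 0].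
  rewrite meval_pt -[LHS]/((horner_eval b \o map_poly (horner_eval a) \o @toPP K) h).
  rewrite (@rmorph_ev2 _ _ _ idfun) => [|c] /=; rewrite /toPP.
    by rewrite ev2X ev2Y /= map_polyC map_polyX /= /horner_eval hornerX hornerC hornerX.
  by rewrite ev2C /= map_polyC /= /horner_eval !hornerC.
have : map_poly (horner_eval a) (toPP h) = 0 by apply: poly_vanishing => b; rewrite e.
by move/(congr1 (fun p : {poly K} => p`_j)); rewrite coef0 coef_map.
Qed.

Lemma meval_cmp f g h P : (cmp f g h).@[P 0] = h.@[pt f.@[P 0] g.@[P 0] 0].
Proof.
pose M : {rmorphism P2 -> K} := GRing.RMorphism.clone _ _ (meval (P 0)) _.
rewrite meval_pt -[LHS]/(M (cmp f g h)) /cmp ev2_comp /= !ev2E.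
by apply: eq_bigr => m _; congr (_ * _); exact: mevalC.
Qed.

Lemma meval_curve (a b : {poly K}) h c : (curve_ev a b h).[c] = h.@[pt a.[c] b.[c] 0].
Proof.
rewrite meval_pt -[LHS]/(horner_eval c (curve_ev a b h)) /curve_ev ev2_comp /= !ev2E.
by apply: eq_bigr => m _; congr (_ * _); exact: hornerC.
Qed.

Lemma polymapE (F : 2.-tuple P2) P :
  polymap F P = pt (tnth F ord0).@[P 0] (tnth F ord_max).@[P 0].
Proof.
apply/rowP => k; rewrite !mxE; case: eqP => [->//|/eqP ne].
by have -> : k = ord_max by apply: val_inj; case: k ne => [[|[|]]].
Qed.

Lemma cmp_identity f g h k : (forall P, h.@[pt f.@[P 0] g.@[P 0] 0] = P 0 k) -> cmp f g h = 'X_k.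
Proof.
move=> e; apply/eqP; rewrite -subr_eq0; apply/eqP/mpoly_vanishing => P.
by rewrite mevalB meval_cmp e mevalXU subrr.
Qed.

Lemma automorphism_inverse_pair (F : 2.-tuple P2) : polynomial_automorphism F ->
  exists p q, inverse_pair (tnth F ord0) (tnth F ord_max) p q.
Proof.
case=> G [FK GK]; exists (tnth G ord0), (tnth G ord_max).
by split; apply: cmp_identity => P; rewrite -polymapE;
  [rewrite -{2}(FK P) | rewrite -{2}(FK P) | rewrite -{2}(GK P) | rewrite -{2}(GK P)]; rewrite mxE.
Qed.

Lemma inverse_pair_automorphism f g p q : inverse_pair f g p q ->
  polynomial_automorphism [tuple f; g].
Proof.
move=> [ep eq ef eg]; exists [tuple p; q]; split=> P; rewrite !polymapE; apply/rowP => k.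
  rewrite -!meval_cmp /tnth /= ep eq !mevalXU !mxE; case: eqP => [->//|/eqP ne].
  by have -> : k = ord_max by apply: val_inj; case: k ne => [[|[|]]].
rewrite -!meval_cmp /tnth /= ef eg !mevalXU !mxE; case: eqP => [->//|/eqP ne].
by have -> : k = ord_max by apply: val_inj; case: k ne => [[|[|]]].
Qed.

Local Open Scope classical_set_scope.
Implicit Types (Gamma : set 'rV[K]_2).

(** Over an infinite field, a polynomial vanishing at the points of the
    parametrized curve vanishes identically on the parametrization. *)
Lemma param_minimal (a b : {poly K}) f : curve_ev a b f = 0 ->
  (forall h, curve_ev a b h = 0 -> divides f h) -> minimal_equation (zeros f) f.
Proof.
move=> f0 ker h; split=> [sub|[T ->] P /= fP].
  apply/ker/poly_vanishing => c; rewrite meval_curve; apply: sub.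
  by rewrite /zeros /= -meval_curve f0 horner0.
by rewrite /zeros /= mevalM fP mulr0.
Qed.

(** The ideal of f is the kernel of a morphism to K[t], hence prime. *)
Lemma param_irreducible (a b : {poly K}) f : curve_ev a b f = 0 ->
  (forall h, curve_ev a b h = 0 -> divides f h) -> (1 < msize f)%N ->
  irreducible_curve (zeros f).
Proof.
move=> f0 ker sf; split=> [|A B [p _ eA] [q _ eB] eU]; first by exists f.
have sub h : curve_ev a b h = 0 -> zeros f `<=` zeros h.
  by move=> /ker; case: (param_minimal f0 ker h).
have : curve_ev a b (p * q) = 0.
  apply/poly_vanishing => c; rewrite meval_curve mevalM.
  have : zeros f (pt a.[c] b.[c]) by rewrite /zeros /= -meval_curve f0 horner0.
  by rewrite eU eA eB => -[/= ->|/= ->]; rewrite ?mul0r ?mulr0.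
rewrite rmorphM /= => /eqP; rewrite mulf_eq0 => /orP[]/eqP/sub sub'; [left | right].
  by apply/seteqP; split; [rewrite eU => P; left | rewrite eA].
by apply/seteqP; split; [rewrite eU => P; right | rewrite eB].
Qed.

Lemma divides_refl (A : comUnitRingType) (a : A) : divides a a.
Proof. by exists 1; rewrite mul1r. Qed.

Lemma minimal_equation_eq Gamma f g : minimal_equation Gamma f -> divides f g -> divides g f ->
  minimal_equation Gamma g.
Proof.
move=> minf [s eg] [t ef] h; rewrite minf; split=> -[r ->].
  by exists (r * t); rewrite -mulrA -ef.
by exists (r * s); rewrite -mulrA -eg.
Qed.

Lemma minimal_equation_divides Gamma f g : minimal_equation Gamma f -> minimal_equation Gamma g ->
  divides f g.
Proof. by move=> minf ming; apply/minf/ming/divides_refl. Qed.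

Lemma divides_msize f g : divides f g -> g != 0 -> (msize f <= msize g)%N.
Proof.
case=> c ->; rewrite mulf_eq0 negb_or => /andP[c0 f0]; rewrite msizeM //.
by have := msize_poly_eq0 c; rewrite (negPf c0); case: (msize c) => // k _; exact: leq_addl.
Qed.
End Pointwise.

(** * The curve attached to a chain *)

Lemma orthogonal_proportional (K : fieldType) (al be x y x' y' : K) :
  (al != 0) || (be != 0) -> al * x + be * y = 0 -> al * x' + be * y' = 0 ->
  (x != 0) || (y != 0) -> (x' != 0) || (y' != 0) ->
  exists c, [/\ c != 0, x' = c * x & y' = c * y].
Proof.
have half (a b z t z' t' : K) : b != 0 -> a * z + b * t = 0 -> a * z' + b * t' = 0 ->
    (z != 0) || (t != 0) -> (z' != 0) || (t' != 0) ->
    exists c, [/\ c != 0, z' = c * z & t' = c * t].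
  move=> b0 e e' nz nz'.
  have solve r s : a * r + b * s = 0 -> s = - (a / b) * r.
    move=> /eqP; rewrite addrC addr_eq0 => /eqP es; apply: (mulfI b0); rewrite es; by field.
  have et := solve _ _ e; have et' := solve _ _ e'.
  have z0 : z != 0 by apply: contraTneq nz => z0; rewrite et z0 mulr0 eqxx.
  have z0' : z' != 0 by apply: contraTneq nz' => z0'; rewrite et' z0' mulr0 eqxx.
  exists (z' / z); split; first by rewrite mulf_neq0 ?invr_eq0.
    by rewrite divfK.
  by rewrite et et' mulrCA divfK.
move=> /orP[a0|b0] e e' nz nz'; last exact: half e e' nz nz'.
have [||||c [c0 ey ex]] := @half be al y x y' x' a0; rewrite 1?addrC 1?orbC //.
by exists c.
Qed.

Lemma predn_addn_gt A B N : (1 < A)%N -> (N < B)%N -> (N.+1 < (A + B).-1)%N.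
Proof. lia. Qed.

Section Model.
Variable K : closedFieldType.
Notation P2 := {mpoly K[2]}.
Notation X := ('X_(ord0 : 'I_2) : P2).
Notation Y := ('X_(ord_max : 'I_2) : P2).
Notation z3 := (ord_max : 'I_3).
Local Open Scope classical_set_scope.

Variables (x y : {poly K}) (Ps : seq {poly K}) (a b al be : K) (p0 q0 : P2).
Let n := chain_degree Ps.
Let u : P2 := a *: X + b *: Y.
Let w : P2 := al *: X + be *: Y.
Hypotheses (inv : inverse_pair u w p0 q0) (nl : nonlinear Ps).
Hypotheses (eu : curve_ev x y u = (chain_curve Ps).1) (ew : curve_ev x y w = (chain_curve Ps).2).
Hypotheses (sx : (size x <= n.+1)%N) (sy : (size y <= n.+1)%N).
Hypothesis nz : (al != 0) || (be != 0).

Let f := (chain_end Ps u w).2.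

Let n0 : (0 < n)%N. Proof. by have [] := size_chain_curve nl. Qed.

Lemma curve_ev_linear (c d : K) : curve_ev x y (c *: X + d *: Y) = c *: x + d *: y.
Proof. by rewrite rmorphD /= /curve_ev !ev2Z ev2X ev2Y !mul_polyC. Qed.

(** The point at infinity (x_n : y_n : 0) lies on w = 0, as deg w < n on the curve. *)
Lemma model_orthogonal : al * x`_n + be * y`_n = 0.
Proof.
have [_ _ s2 _] := size_chain_curve nl; have := congr1 (fun p : {poly K} => p`_n) ew.
by rewrite curve_ev_linear coefD !coefZ [X in _ = X]nth_default.
Qed.

Lemma model_point : (x`_n != 0) || (y`_n != 0).
Proof.
have [_ s1 _ _] := size_chain_curve nl; have := congr1 (fun p : {poly K} => p`_n) eu.
rewrite curve_ev_linear coefD !coefZ; apply: contra_eqT.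
rewrite negb_or !negbK => /andP[/eqP-> /eqP->]; rewrite !mulr0 addr0 eq_sym.
have := lead_coef_eq0 (chain_curve Ps).1; rewrite /lead_coef s1 /= => ->.
by rewrite -size_poly_eq0 s1.
Qed.

Lemma model_curve : curve_ev x y f = 0.
Proof. by have [] := chain_end_curve eu ew. Qed.

Lemma model_pair : exists f' p q, inverse_pair f f' p q.
Proof.
have [p' [q' inv']] := chain_end_pair Ps inv.
by have [p [q inv2]] := flip_pair inv'; exists (chain_end Ps u w).1, p, q.
Qed.

(** The two polynomials of [chain_end Ps u w] form a coordinate system, and (x, y)
    parametrizes its axis f = 0. *)
Lemma model_kernel h : curve_ev x y h = 0 -> divides f h.
Proof.
have [p' [q' inv']] := chain_end_pair Ps inv.
have [p [q inv2]] := flip_pair inv'; have [ex ey] := chain_end_curve eu ew => h0.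
have [ep eq _ _] := inv2; apply: (curve_kernel inv2).
have -> : curve_ev 0 'X p = x.
  by rewrite -ex -ey -curve_ev_cmp ep /curve_ev ev2X.
have -> // : curve_ev 0 'X q = y.
by rewrite -ex -ey -curve_ev_cmp eq /curve_ev ev2Y.
Qed.

Let tf : top w n f. Proof. exact: (top_equation al be nl (msize_linear a b)). Qed.

Lemma model_msize : msize f = n.+1.
Proof.
apply/eqP; rewrite eqn_leq (top_msize (msize_linear al be) tf) ltnNge.
have [k k0 sh] := tf; apply/negP => sf.
have sw := msize_linear_gt1 nz.
have w0 : w != 0 by rewrite -msize_poly_eq0 -lt0n ltnW.
have swN N : (N < msize (w ^+ N))%N.
  elim: N => [|N IH]; first by rewrite expr0 lt0n msize_poly_eq0 oner_eq0.
  by rewrite exprS msizeM ?expf_neq0 //; exact: predn_addn_gt.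
have : (msize (k *: w ^+ n) <= n)%N.
  rewrite (_ : k *: w ^+ n = f - (f - k *: w ^+ n)); last by rewrite opprB addrC subrK.
  by apply: msizeD_leq => //; exact: msizeN_leq.
by rewrite leqNgt; move: (swN n); rewrite (msizeZ _ _) // => ->.
Qed.

Lemma model_coordinate : coordinate_line (zeros f).
Proof.
split; first by exists f => //; rewrite model_msize.
have [f' [p [q inv']]] := model_pair; exists [tuple f; f'].
  exact: inverse_pair_automorphism inv'.
exact: param_minimal model_curve model_kernel.
Qed.

Lemma model_minimal : minimal_equation (zeros f) f.
Proof. exact: param_minimal model_curve model_kernel. Qed.

Lemma model_irreducible : irreducible_curve (zeros f).
Proof. by apply: param_irreducible model_curve model_kernel _; rewrite model_msize. Qed.

Variable Gamma : set 'rV[K]_2.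
Hypothesis minf : minimal_equation Gamma f.

(** On the line at infinity only the top form of f is left. *)
Lemma model_eval (P : 'rV[K]_3) : P 0 z3 = 0 ->
  (homogenize n f).@[P 0] = 0 <-> al * P 0 x3 + be * P 0 y3 = 0.
Proof.
move=> Pz; have [k k0 /homz_top->] := tf.
have e : (homogenize 1 w).@[P 0] = al * P 0 x3 + be * P 0 y3.
  by rewrite homz_linear mevalD !mevalZ !mevalXU.
rewrite mevalD mevalM mevalXU Pz mul0r addr0 mevalZ rmorphXn /= e; split=> [/eqP|->].
  by rewrite mulf_eq0 (negPf k0) expf_eq0 n0 => /eqP.
by rewrite expr0n (gtn_eqF n0) mulr0.
Qed.

Variable O : 'rV[K]_3.
Hypotheses (On0 : O != 0) (Oz : O 0 z3 = 0) (Oxy : al * O 0 x3 + be * O 0 y3 = 0).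

Lemma row3_neq0 (P : 'rV[K]_3) : P != 0 -> P 0 z3 = 0 -> (P 0 x3 != 0) || (P 0 y3 != 0).
Proof.
move=> Pn0 Pz; apply: contraNT Pn0; rewrite negb_or !negbK => /andP[/eqP Px /eqP Py].
apply/eqP/rowP => k; rewrite mxE; case: (unliftP z3 k) => [j ->|-> //].
case: (eqVneq j ord0) => [->//|ne].
by have -> : j = ord_max by apply: val_inj; case: j ne => [[|[|]]].
Qed.

Lemma row3_eq (P Q : 'rV[K]_3) : P 0 x3 = Q 0 x3 -> P 0 y3 = Q 0 y3 -> P 0 z3 = Q 0 z3 -> P = Q.
Proof.
move=> ex ey ez; apply/rowP => k; case: (unliftP z3 k) => [j ->|-> //].
case: (eqVneq j ord0) => [->//|ne].
by have -> : j = ord_max by apply: val_inj; case: j ne => [[|[|]]].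
Qed.

Lemma model_infinity P : (projective_closure Gamma `&` line_at_infinity (K := K)) P <->
  exists2 c : K, c != 0 & P = c *: O.
Proof.
split=> [[PC [Pn0 Pz]]|[c c0 eP]].
  have Pxy : al * P 0 x3 + be * P 0 y3 = 0.
    by apply/(model_eval Pz); have [cm _] := closure_equation minf model_msize Pn0; apply: cm.
  have [c [c0 ex ey]] := orthogonal_proportional nz Oxy Pxy (row3_neq0 On0 Oz) (row3_neq0 Pn0 Pz).
  by exists c => //; apply: row3_eq; rewrite mxE // Pz Oz mulr0.
have Pn0 : P != 0 by rewrite eP scaler_eq0 negb_or c0.
have Pz : P 0 z3 = 0 by rewrite eP mxE Oz mulr0.
split; last by [].
have [_ cm] := closure_equation minf model_msize Pn0; apply/cm/(model_eval Pz).
by rewrite eP !mxE mulrCA [be * _]mulrCA -mulrDr Oxy mulr0.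
Qed.

Variable i : 'I_3.
Hypothesis Oi : O 0 i != 0.

Lemma model_local (g0 := germ i O (homogenize n f)) :
  [/\ irreducible_elt g0, forall gamma, irreducible_factor gamma g0 -> associate gamma g0
    & branch_semigroup g0 = generated_semigroup (am_seq (chain_degrees Ps))].
Proof.
have [c [c0 Ox Oy]] :=
  orthogonal_proportional nz model_orthogonal Oxy model_point (row3_neq0 On0 Oz).
exact: (local_semigroup nl (msize_linear a b) eu ew sx sy nz model_orthogonal c0 Ox Oy Oz Oi).
Qed.

Lemma model_branch gamma : branch_at (projective_closure Gamma) O i gamma ->
  associate gamma (germ i O (homogenize n f)).
Proof.
case=> F minF [irr dv]; have [_ fac _] := model_local; apply: fac; split=> //.
have [c uc ec] := minimal_germ minf model_msize i O minF.
case: dv => d ed; exists (c^-1 * d).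
by rewrite -mulrA -ed ec mulKr.
Qed.

Lemma model_semigroup gamma : branch_at (projective_closure Gamma) O i gamma ->
  branch_semigroup gamma = generated_semigroup (am_seq (chain_degrees Ps)).
Proof.
by move=> /model_branch/associate_semigroup->; have [] := model_local.
Qed.

Lemma model_branch_at : branch_at (projective_closure Gamma) O i (germ i O (homogenize n f)).
Proof.
exists (homogenize n f); first exact: homz_minimal minf model_msize.
by have [irr _ _] := model_local; split=> //; exists 1; rewrite mul1r.
Qed.

End Model.

(** * Semigroups of coordinate lines *)

Lemma associate_sym (A : comUnitRingType) (a b : A) : associate a b -> associate b a.
Proof. by case=> c uc ->; exists c^-1; rewrite ?unitrV // mulKr. Qed.

Section Frames.
Variable K : fieldType.
Notation P2 := {mpoly K[2]}.
Notation X := ('X_(ord0 : 'I_2) : P2).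
Notation Y := ('X_(ord_max : 'I_2) : P2).

Lemma cmp_linear (f g : P2) (a b : K) : cmp f g (a *: X + b *: Y) = a *: f + b *: g.
Proof. by rewrite rmorphD /= /cmp !ev2Z ev2X ev2Y !mul_mpolyC. Qed.

Lemma shear_pair (k : K) : inverse_pair (1 *: X + 0 *: Y) (- k *: X + 1 *: Y) X (k *: X + 1 *: Y).
Proof.
split; rewrite ?cmp_linear ?cmpX ?cmpY !(scale1r, scale0r, addr0) //.
  by rewrite scaleNr addrA subrr add0r.
by rewrite scaleNr addKr.
Qed.

Lemma swap_pair : inverse_pair (0 *: X + 1 *: Y) (1 *: X + 0 *: Y) Y X.
Proof. by split; rewrite ?cmp_linear ?cmpX ?cmpY !(scale1r, scale0r, addr0, add0r). Qed.

(** The two polynomials generate K[t]. *)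
Lemma coordinate_curve_neq0 (x y : {poly K}) : coordinate_curve x y -> (1 < size x)%N || (1 < size y)%N.
Proof.
case=> f [g [p [q [inv ex ey]]]]; apply: contraT; rewrite negb_or -!leqNgt => /andP[sx sy].
have := curve_second inv; rewrite ex ey => e; have := curve_ev_comp x y 0 g.
rewrite (size1_polyC sx) (size1_polyC sy) !comp_polyC in e *.
rewrite e comp_polyX => /esym/eqP; by rewrite polyX_eq0.
Qed.

(** Linear coordinates of the plane for which the second one restricts to the curve
    with smaller degree than the first one, so that the Euclidean algorithm can
    start. *)
Lemma adapted_frame (x y : {poly K}) : coordinate_curve x y -> exists a b al be p0 q0,
  let u := a *: X + b *: Y in let w := al *: X + be *: Y in
  [/\ inverse_pair u w p0 q0, (al != 0) || (be != 0),
      coordinate_curve (curve_ev x y u) (curve_ev x y w),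
      (size (curve_ev x y w) < size (curve_ev x y u))%N
    & (size x <= size (curve_ev x y u))%N /\ (size y <= size (curve_ev x y u))%N].
Proof.
have lin c d : curve_ev x y (c *: X + d *: Y) = c *: x + d *: y.
  by rewrite rmorphD /= /curve_ev !ev2Z ev2X ev2Y !mul_polyC.
move=> cc; have [lt|le] := ltnP (size x) (size y).
  exists 0, 1, 1, 0, Y, X => /=.
  have -> : curve_ev x y (0 *: X + 1 *: Y) = y by rewrite lin scale0r scale1r add0r.
  have -> : curve_ev x y (1 *: X + 0 *: Y) = x by rewrite lin scale0r scale1r addr0.
  split; [exact: swap_pair | by rewrite oner_eq0 | exact: coordinate_curve_swap | by [] |].
  by rewrite (ltnW lt).
(* Equal degrees are made different by subtracting a multiple of x. *)
pose k := if size y == size x then lead_coef y / lead_coef x else 0.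
exists 1, 0, (- k), 1, X, (k *: X + 1 *: Y) => /=.
have -> : curve_ev x y (1 *: X + 0 *: Y) = x by rewrite lin scale0r scale1r addr0.
have -> : curve_ev x y (- k *: X + 1 *: Y) = y - ((k *: 'X) \Po x).
  by rewrite lin scale1r comp_polyZ comp_polyX scaleNr addrC.
split; [exact: shear_pair | by rewrite oner_eq0 orbT | | | by []].
  exact/coordinate_curve_step/coordinate_curve_swap.
rewrite comp_polyZ comp_polyX /k; case: eqVneq => [e|ne]; last first.
  by rewrite scale0r subr0 ltn_neqAle ne.
have sx : (0 < size x)%N by have := coordinate_curve_neq0 cc; rewrite e orbb; apply: ltnW.
have nx : lead_coef x != 0 by rewrite lead_coef_eq0 -size_poly_gt0.
have ny : lead_coef y != 0 by rewrite lead_coef_eq0 -size_poly_gt0 e.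
rewrite -e; apply: size_sub_lead.
- by rewrite -lead_coef_eq0.
- by rewrite size_scale // mulf_neq0 ?invr_eq0.
- by rewrite lead_coefZ divfK.
Qed.
End Frames.

Section Main.
Variable K : closedFieldType.
Notation P2 := {mpoly K[2]}.
Notation X := ('X_(ord0 : 'I_2) : P2).
Notation Y := ('X_(ord_max : 'I_2) : P2).
Local Open Scope classical_set_scope.

Lemma comp_inverse (L : {poly K}) : size L = 2%N -> exists2 M : {poly K}, size M = 2%N &
  (L \Po M = 'X) /\ (M \Po L = 'X).
Proof.
move=> sL; have a0 : L`_1 != 0.
  by have := lead_coef_eq0 L; rewrite /lead_coef sL /= -size_poly_eq0 sL => ->.
have eL : L = L`_1 *: 'X + (L`_0)%:P.
  apply/polyP => -[|[|j]]; rewrite coefD coefZ coefX coefC /= ?mulr1 ?mulr0 ?addr0 ?add0r //.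
  by rewrite nth_default ?sL.
move: (L`_1) (L`_0) a0 eL => c d c0 ->.
exists (c^-1 *: ('X - d%:P)); first by rewrite size_scale ?invr_eq0 // size_XsubC.
split; first by rewrite comp_polyD !comp_polyZ comp_polyX comp_polyC scalerA mulfV // scale1r subrK.
by rewrite comp_polyZ comp_polyB comp_polyX comp_polyC addrK scalerA mulVf // scale1r.
Qed.

(** The Euclidean algorithm parametrizes Gamma by a chain, up to an affine change of
    parameter. The equation rebuilt from the chain and the given one vanish on the
    same curve, so they divide each other. *)
Lemma coordinate_line_semigroup (Gamma : set 'rV[K]_2) (n : nat) (gamma : mfps 2 K) :
  (1 < n)%N -> coordinate_line Gamma -> curve_degree Gamma n -> branch_at_infinity Gamma gamma ->
  exists r : seq nat, [/\ abhyankar_moh_sequence r, nth 0%N r 0 = n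
    & branch_semigroup gamma = generated_semigroup r].
Proof.
move=> n1 [_ [F /automorphism_inverse_pair[p [q inv]] minF]] [f1 min1 s1] [_ [O [OP [i [Oi br _]]]]].
have {}minF : minimal_equation Gamma (tnth F ord0).
  by rewrite (_ : ord0 = 0) //; apply: val_inj.
set f0 := tnth F ord0 in inv minF.
have f0n : f0 != 0 by exact: inverse_pair_neq0 inv.
have s0 : (n < msize f0)%N by rewrite -s1; apply: divides_msize f0n; exact: minimal_equation_divides minF.
set x0 := curve_ev 0 'X p; set y0 := curve_ev 0 'X q.
have cc : coordinate_curve x0 y0 by exists f0, (tnth F ord_max), p, q.
have ker0 h : curve_ev x0 y0 h = 0 -> divides f0 h := curve_kernel inv.
have f00 : curve_ev x0 y0 f0 = 0 := curve_first inv.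
have [a [b [al [be [p0 [q0 /= [inv0 nz ccu lt [lex ley]]]]]]]] := adapted_frame cc.
set u := a *: X + b *: Y in inv0 ccu lt lex ley; set w := al *: X + be *: Y in inv0 ccu lt.
(* A nonzero constant would make w - c an equation of degree 1. *)
have ne1 : size (curve_ev x0 y0 w) != 1%N.
  apply: contraTneq n1 => e1; rewrite -leqNgt -ltnS; apply: leq_trans s0 _.
  have [|T eT] := ker0 (w - ((curve_ev x0 y0 w)`_0)%:MP).
    rewrite rmorphB /= [X in _ - X]ev2C {1}(size1_polyC (eq_leq e1)); exact: subrr.
  have nc : w - ((curve_ev x0 y0 w)`_0)%:MP != 0.
    apply: contraTneq (msize_linear_gt1 nz) => /subr0_eq; rewrite -/w => ->.
    by rewrite -leqNgt msizeC leq_b1.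
  apply: leq_trans (divides_msize (ex_intro _ T eT) nc) _.
  apply: msizeD_leq; first exact: msize_linear.
  by apply: msizeN_leq; rewrite msizeC; case: (_ != 0).
have [Ps [L [nl sL eu ew]]] := coordinate_curve_chain (leqnn _) ccu lt ne1.
have [M sM [LM ML]] := comp_inverse sL.
pose x := x0 \Po M; pose y := y0 \Po M.
have evM h : curve_ev x y h = curve_ev x0 y0 h \Po M by rewrite curve_ev_comp.
have evL h : curve_ev x0 y0 h = curve_ev x y h \Po L by rewrite evM -comp_polyA ML comp_polyXr.
have eu' : curve_ev x y u = (chain_curve Ps).1 by rewrite evM eu -comp_polyA LM comp_polyXr.
have ew' : curve_ev x y w = (chain_curve Ps).2 by rewrite evM ew -comp_polyA LM comp_polyXr.
have [d0 sp _ _] := size_chain_curve nl.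
have su : size (curve_ev x0 y0 u) = (chain_degree Ps).+1 by rewrite eu size_comp_poly2.
have sx : (size x <= (chain_degree Ps).+1)%N by rewrite size_comp_poly2 // -su.
have sy : (size y <= (chain_degree Ps).+1)%N by rewrite size_comp_poly2 // -su.
set f := (chain_end Ps u w).2.
have dff0 : divides f f0.
  by apply: (model_kernel inv0 eu' ew'); rewrite evM f00 comp_poly0.
have df0f : divides f0 f.
  by apply: ker0; rewrite evL (model_curve eu' ew') comp_poly0.
have minf : minimal_equation Gamma f := minimal_equation_eq minF df0f dff0.
have en : n = chain_degree Ps.
  have sf := model_msize a b nl nz.
  apply: succn_inj; rewrite -s1 -sf; apply/eqP; rewrite eqn_leq.
  have fn : f != 0 by rewrite -msize_poly_eq0 sf.
  have f1n : f1 != 0 by rewrite -msize_poly_eq0 s1.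
  by rewrite !divides_msize //; apply: minimal_equation_divides; eassumption.
have [OC [On0 Oz]] : (projective_closure Gamma `&` line_at_infinity (K:=K)) O.
  by apply/OP; exists 1; rewrite ?oner_eq0 // scale1r.
exists (am_seq (chain_degrees Ps)); split.
- apply: am_seq_am.
    apply/allP => e /mapP[P Pm ->]; have := allP nl P Pm.
    by case: (size P).
  rewrite size_map lt0n; apply: contraTneq n1 => /size0nil eP.
  by rewrite en eP /chain_degree big_nil.
- by rewrite en.
have Oxy : al * O 0 x3 + be * O 0 y3 = 0.
  apply/(model_eval a b al be nl Oz).
  by have [cm _] := closure_equation minf (model_msize a b nl nz) On0; apply: cm.
exact: (model_semigroup nl eu' ew' sx sy nz minf On0 Oz Oxy Oi br).
Qed.

(** The factorization of n attached to r is realized by the chain of monomials X^e,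
    with the linear forms X and Y. The branch is centred at (1 : 0 : 0). *)
Lemma characteristic_sequence_realized (r : seq nat) :
  abhyankar_moh_sequence r -> (1 < nth 0%N r 0)%N ->
  exists (Gamma : set 'rV[K]_2) (gamma : mfps 2 K),
    [/\ coordinate_line Gamma, curve_degree Gamma (nth 0%N r 0), branch_at_infinity Gamma gamma
      & branch_semigroup gamma = generated_semigroup r].
Proof.
move=> am r1; have [es [es2 _ er]] := am_seqP am r1.
pose Ps := [seq 'X^e : {poly K} | e <- es].
have eD : chain_degrees Ps = es.
  rewrite /chain_degrees -map_comp -[RHS]map_id; apply: eq_map => e /=.
  by rewrite size_polyXn.
have nl : nonlinear Ps.
  apply/allP => P /mapP[e /(allP es2) e2 ->].
  by rewrite size_polyXn.
have en : nth 0%N r 0 = chain_degree Ps by rewrite er /chain_degree eD.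
pose x := (chain_curve Ps).1; pose y := (chain_curve Ps).2; pose n := chain_degree Ps.
have [n0 sx sy _] := size_chain_curve nl.
have inv : inverse_pair (1 *: X + 0 *: Y : P2) (0 *: X + 1 *: Y) X Y.
  by split; rewrite ?cmp_linear ?cmpX ?cmpY !(scale1r, scale0r, addr0, add0r).
have eu : curve_ev x y (1 *: X + 0 *: Y) = (chain_curve Ps).1.
  by rewrite curve_ev_linear scale1r scale0r addr0.
have ew : curve_ev x y (0 *: X + 1 *: Y) = (chain_curve Ps).2.
  by rewrite curve_ev_linear scale1r scale0r add0r.
have lx : (size x <= n.+1)%N by rewrite sx.
have ly : (size y <= n.+1)%N by apply: leq_trans sy _.
have nz : (0 != 0 :> K) || (1 != 0 :> K) by rewrite oner_eq0 orbT.
set f := (chain_end Ps (1 *: X + 0 *: Y) (0 *: X + 1 *: Y)).2.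
pose O : 'rV[K]_3 := \row_k (k == x3)%:R.
have Ox : O 0 x3 != 0 by rewrite mxE eqxx oner_eq0.
have On0 : O != 0 by apply: contraNneq Ox => ->; rewrite mxE.
have Oz : O 0 ord_max = 0 by rewrite mxE.
have Oxy : 0 * O 0 x3 + 1 * O 0 y3 = 0 by rewrite mul0r mul1r !mxE add0r.
have minf : minimal_equation (zeros f) f := model_minimal inv eu ew.
exists (zeros f), (germ x3 O (homogenize n f)); split.
- exact: (model_coordinate inv nl eu ew nz).
- by exists f => //; rewrite en; exact: (model_msize 1 0 nl nz).
- split; first exact: (model_irreducible inv nl eu ew nz).
  exists O; split; first exact: (model_infinity nl nz minf On0 Oz Oxy).
  exists x3; split=> // [|delta br]; first exact: (model_branch_at nl eu ew lx ly nz minf On0 Oz Oxy Ox).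
  by apply/associate_sym/(model_branch nl eu ew lx ly nz minf On0 Oz Oxy Ox br).
have [_ _ ->] := model_local nl eu ew lx ly nz On0 Oz Oxy Ox.
by rewrite eD -er.
Qed.
End Main.

Local Open Scope classical_set_scope.
Theorem theorem1p3 (K : closedFieldType) :
  (forall (Gamma : set 'rV[K]_2) (n : nat) (gamma : mfps 2 K),
     (1 < n)%N -> coordinate_line Gamma -> curve_degree Gamma n ->
     branch_at_infinity Gamma gamma ->
     exists r : seq nat,
       [/\ abhyankar_moh_sequence r, nth 0%N r 0 = n
         & branch_semigroup gamma = generated_semigroup r])
  /\
  (forall (G : set nat) (n : nat),
     (1 < n)%N ->
     (exists r : seq nat,
        [/\ abhyankar_moh_sequence r, nth 0%N r 0 = n
          & G = generated_semigroup r]) ->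
     exists (Gamma : set 'rV[K]_2) (gamma : mfps 2 K),
       [/\ coordinate_line Gamma, curve_degree Gamma n,
           branch_at_infinity Gamma gamma
         & branch_semigroup gamma = G]).
Proof.
split; first exact: coordinate_line_semigroup.
move=> G n n1 [r [am en ->]]; rewrite -en in n1 *.
exact: characteristic_sequence_realized.
Qed.
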